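(* Let $\alpha>1$, $\beta\in\mathbb{C}$, $C>0$, put $\kappa=1/(\alpha-1)$, and let $F_{\alpha,\beta}$ be the entire function defined in the context. Let $$\Omega_C=\Bigl\{z=x+\mathrm{i}y\in\mathbb{C}:\ |y|\le C\,\frac{\log(2+|x|)}{(1+|x|)^\kappa}\Bigr\}.$$ (1) For $z=x+\mathrm{i}y\in\Omega_C$ with $x$ negative and $|x|$ sufficiently large, $$F_{\alpha,\beta}(z)\ll\begin{cases}|x|^{-1-\operatorname{Re}\beta}&\text{if }-1-\beta\notin\mathbb{N},\\|x|^{-1-\beta}\log|x|&\text{if }-1-\beta\in\mathbb{N}.\end{cases}$$ (2) For any fixed constant $A>\max\bigl(1,(\pi/(2\alpha))^\kappa\bigr)$ and for $z=x+\mathrm{i}y\in\Omega_C$ with $|x|$ sufficiently large, $$F_{\alpha,\beta}(z)\ll\begin{cases}|x|^{\lfloor-1-\operatorname{Re}\beta\rfloor+1}+|x|^{AC}&\text{if }\operatorname{Re}\beta<-1,\\|x|+|x|^{AC}\log|x|&\text{if }\operatorname{Re}\beta=-1,\\|x|^{AC+\frac{\operatorname{Re}\beta+1}{\alpha-1}}&\text{if }\operatorname{Re}\beta>-1.\end{cases}$$ The implied constants may depend on $\alpha,\beta,C$ and $A$ but not on $z$.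
   Context: For $\operatorname{Im}z<0$, $$ \begin{aligned} F_{\alpha,\beta}(z)=\mathrm{F.p.}\int_0^\infty t^\beta \mathrm{e}^{\mathrm{i}t^\alpha-\mathrm{i}zt}\,\mathrm{d}t:={}&\int_1^\infty t^\beta \mathrm{e}^{\mathrm{i}t^\alpha-\mathrm{i}zt}\,\mathrm{d}t+\int_0^1t^\beta\Bigl(\mathrm{e}^{\mathrm{i}t^\alpha-\mathrm{i}zt}-\sum_{m+n\alpha+\operatorname{Re}\beta\le-1}\frac{\mathrm{i}^n(-\mathrm{i}z)^m}{n!\,m!}t^{n\alpha+m}\Bigr)\mathrm{d}t\\ &+\sum'_{m+n\alpha+\operatorname{Re}\beta\le-1}\frac{\mathrm{i}^n(-\mathrm{i}z)^m}{n!\,m!}\,\frac{1}{\beta+n\alpha+m+1}, \end{aligned} $$ where the sums run over integers $m,n\ge0$ satisfying the condition and $\sum'$ omits terms with $\beta+n\alpha+m+1=0$ (Hadamard finite part; the ordinary integral if $\operatorname{Re}\beta>-1$). This function extends to an entire function, also denoted $F_{\alpha,\beta}$. Here $\mathbb{N}=\{0,1,2,\dots\}$, and $f\ll g$ means $f=O(g)$. *)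

(* Defs.v *)
From Stdlib Require Import Reals Lra Lia Factorial.
From Coquelicot Require Import Coquelicot.

Open Scope R_scope.

Definition Cexp (z : C) : C := (exp (Re z) * cos (Im z), exp (Re z) * sin (Im z)).

(* Complex power with positive real base; a junk value if [t <= 0]. *)
Definition cpower (t : R) (b : C) : C := Cexp (b * ln t)%C.

(* [m + n * alpha + Re beta <= -1], the range of both sums below. *)
Definition fp_index (alpha : R) (beta : C) (m n : nat) : Prop :=
  INR m + INR n * alpha + Re beta <= -1.

Definition fp_index_dec (alpha : R) (beta : C) (m n : nat) :
  {fp_index alpha beta m n} + {~ fp_index alpha beta m n} := Rle_dec _ _.

(* For [alpha >= 1] every admissible [m] and [n] is at most [fp_bound beta], see
   [fp_index_bound], so [fp_sum] runs over all admissible pairs. *)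
Definition fp_bound (beta : C) : nat := Z.to_nat (up (Rabs (Re beta))).

Definition fp_sum (alpha : R) (beta : C) (f : nat -> nat -> C) : C :=
  sum_n (fun m => sum_n (fun n =>
    if fp_index_dec alpha beta m n then f m n else RtoC 0)
    (fp_bound beta)) (fp_bound beta).

Lemma fp_index_bound (alpha : R) (beta : C) (m n : nat) :
  1 <= alpha -> fp_index alpha beta m n ->
  (m <= fp_bound beta)%nat /\ (n <= fp_bound beta)%nat.
Proof.
unfold fp_index, fp_bound; intros Ha H.
pose proof (pos_INR m); pose proof (pos_INR n).
assert (INR n <= INR n * alpha) by nra.
assert (- Re beta <= Rabs (Re beta)) by (rewrite <- Rabs_Ropp; apply Rle_abs).
destruct (archimed (Rabs (Re beta))) as [Hup _].
assert (INR m < IZR (up (Rabs (Re beta)))) as Hm by lra.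
assert (INR n < IZR (up (Rabs (Re beta)))) as Hn by lra.
rewrite INR_IZR_INZ in Hm, Hn.
apply lt_IZR in Hm; apply lt_IZR in Hn; lia.
Qed.

(* [i^n (-iz)^m / (n! m!)], the coefficient of [t^(n alpha + m)] in the
   expansion of [e^(i t^alpha - i z t)] at [t = 0]. *)
Definition fp_coef (z : C) (m n : nat) : C :=
  (Ci ^ n * (- Ci * z) ^ m / (INR (fact n) * INR (fact m)))%C.

Definition osc (alpha : R) (z : C) (t : R) : C :=
  Cexp (Ci * Rpower t alpha - Ci * z * t)%C.

(* The Hadamard finite part of the integral of [t^beta e^(i t^alpha - i z t)]
   over [0, oo), for [Im z < 0]. *)
Definition fp_integral (alpha : R) (beta z : C) : C :=
  (RInt_gen (V := C_R_CompleteNormedModule)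
     (fun t => cpower t beta * osc alpha z t)
     (at_point 1) (Rbar_locally p_infty)
   + RInt_gen (V := C_R_CompleteNormedModule)
     (fun t => cpower t beta *
        (osc alpha z t
         - fp_sum alpha beta
             (fun m n => fp_coef z m n * Rpower t (INR n * alpha + INR m)%R)))
     (at_right 0) (at_point 1)
   + fp_sum alpha beta
       (fun m n =>
          let s := beta + (INR n * alpha)%R + INR m + 1 in
          if Ceq_dec s 0 then 0 else fp_coef z m n * (1 / s)))%C.

Definition entire (F : C -> C) : Prop :=
  forall z : C, ex_derive (K := C_AbsRing) (V := C_NormedModule) F z.

(* [F] is the entire function [F_{alpha,beta}]; by the identity theorem at most
   one [F] satisfies this. *)
Definition is_F (alpha : R) (beta : C) (F : C -> C) : Prop :=
  entire F /\ forall z : C, Im z < 0 -> F z = fp_integral alpha beta z.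

Definition kappa (alpha : R) : R := 1 / (alpha - 1).

(* The region [Omega_C]; the constant is called [c] since [C] is the type of
   complex numbers. *)
Definition Omega (alpha c : R) (z : C) : Prop :=
  Rabs (Im z) <=
    c * (ln (2 + Rabs (Re z)) / Rpower (1 + Rabs (Re z)) (kappa alpha)).

Definition is_natural (b : C) : Prop := exists n : nat, b = RtoC (INR n).

(* [F(z) << g(|x|)] for [z = x + i y] in [S] with [|x|] sufficiently large. *)
Definition dominated (S : C -> Prop) (F : C -> C) (g : R -> R) : Prop :=
  exists K X : R, forall z : C,
    S z -> X <= Rabs (Re z) -> Cmod (F z) <= K * g (Rabs (Re z)).

(* Main.v *)
Require Import Defs.
From Stdlib Require Import Reals Lra Lia Psatz Factorial ZArith.
From Coquelicot Require Import Coquelicot.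

Open Scope R_scope.

(** With [t = e^w] the integrand becomes the entire function
    [g w = exp ((beta + 1) w + i e^(alpha w) - i z e^w)], and the ray
    [arg t = phi] becomes the horizontal line [Im w = phi].  On the line of
    height [theta = PI / (2 alpha)] the factor [e^(i t^alpha)] is
    [e^(- |t|^alpha)], which beats [e^(- i z t)] for every [z] because
    [alpha > 1].  So the contour that follows the real line up to some [U],
    climbs to height [theta] and then runs to the right gives a convergent
    integral for all [z], and by Cauchy's theorem ([goursat],
    [contour_indep]) its value does not depend on [U].  At the left end the
    finitely many terms [c e^(s u)] of the expansion of [g] are replaced by
    their primitives ([singular_part]); what remains ([regular]) decays
    exponentially at minus infinity ([regular_le]).

    The truncations [approx] of this representation are entire in [z] and
    converge locally uniformly ([approx_cauchy]).  For [Im z < 0] the limit is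
    the Hadamard finite part ([fp_integral_eq]), since the vertical segment
    can be pushed to infinity there ([arc_small]).  The identity principle
    [unif_limit_zero] then gives [F z = lim approx] for all [z].

    It remains to estimate the contour integral for [X = |Re z|] large, with
    the cut [u1 = - ln X] between singular part and integral.  The singular
    part and the regular part below [u1] are of size [X^(-1 - Re beta)], with an
    extra [ln X] exactly when some exponent [beta + m + 1] vanishes, that is
    when [-1 - beta] is natural.
    - If [Re z < 0], the contour leaves the real line at [U = u1]; on the line
      at height [theta] the factor [e^(- i z t)] decays on the scale [1 / X], so
      the rest of the contour is again of size [X^(-1 - Re beta)]
      ([negative_side]).
    - If [Re z > 0], it leaves at [t = A X^kappa], beyond the stationary
      point.  The condition on [A] says that
      [A^(alpha - 1) sin (alpha phi) >= sin phi] for [0 <= phi <= theta], so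
      nothing is lost on the arc, and the line at height [theta] contributes
      [O(1)] ([positive_side]).  On the real segment
      [|e^(- i z t)| = e^(y t)] is at most a constant times [X^(A c)] by the
      definition of the region, and integrating [t^(Re beta)] gives the three
      cases. *)

(** * Integrals of complex-valued functions and complex derivatives *)

Notation CV := C_R_CompleteNormedModule.
Definition Cint (f : R -> C) (a b : R) : C := RInt (V := CV) f a b.

Lemma Cmod_norm_R (z : C) : norm (K := R_AbsRing) (V := CV) z = Cmod z.
Proof.
unfold norm; simpl; unfold prod_norm, Cmod, norm; simpl; unfold abs; simpl.
f_equal. rewrite 2!Rmult_1_r, <- 2!Rabs_mult, 2!Rabs_right; try ring; nra.
Qed.

(** Continuity is kept in terms of [Cmod], so that the product uniform structure
    behind [RInt] enters only through [curve_cont_continuous]. *)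
Definition curve_cont (f : R -> C) : Prop :=
  forall x eps, 0 < eps ->
  exists d, 0 < d /\ forall y, Rabs (y - x) < d -> Cmod (f y - f x) < eps.

Lemma fst_le_Cmod (z : C) : Rabs (fst z) <= Cmod z.
Proof. eapply Rle_trans; [apply Rmax_l | apply Rmax_Cmod]. Qed.
Lemma snd_le_Cmod (z : C) : Rabs (snd z) <= Cmod z.
Proof. eapply Rle_trans; [apply Rmax_r | apply Rmax_Cmod]. Qed.

Lemma curve_cont_continuous f : curve_cont f -> forall x, continuous (U := CV) f x.
Proof.
intros H x P [eps HP].
destruct (H x eps (cond_pos eps)) as [d [Hd Hf]].
exists (mkposreal d Hd). intros y Hy. apply HP.
specialize (Hf y Hy).
split; [ eapply Rle_lt_trans; [ apply (fst_le_Cmod (f y - f x)%C) | exact Hf ]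
       | eapply Rle_lt_trans; [ apply (snd_le_Cmod (f y - f x)%C) | exact Hf ]].
Qed.

Lemma continuous_curve_cont f : (forall x, continuous (U := CV) f x) -> curve_cont f.
Proof.
intros H x eps Heps.
assert (He : 0 < eps / 2) by lra.
destruct (H x _ (locally_ball (f x) (mkposreal _ He))) as [d Hd].
exists d; split; [apply cond_pos|].
intros y Hy. destruct (Hd y Hy) as [H1 H2].
simpl in H1, H2. unfold ball in H1, H2; simpl in H1, H2.
unfold AbsRing_ball, minus, plus, opp, abs in H1, H2; simpl in H1, H2.
eapply Rle_lt_trans. apply Cmod_2Rmax.
assert (Hs : sqrt 2 < 2). { rewrite <- (sqrt_square 2) at 2 by lra. apply sqrt_lt_1; lra. }
pose proof (sqrt_pos 2).
assert (Rmax (Rabs (fst (f y - f x)%C)) (Rabs (snd (f y - f x)%C)) < eps / 2).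
{ apply Rmax_lub_lt; assumption. }
assert (0 <= Rmax (Rabs (fst (f y - f x)%C)) (Rabs (snd (f y - f x)%C))).
{ eapply Rle_trans; [|apply Rmax_l]. apply Rabs_pos. }
nra.
Qed.

Lemma Cint_ex f a b : curve_cont f -> ex_RInt (V := CV) f a b.
Proof. intros H. apply ex_RInt_continuous. intros; apply curve_cont_continuous, H. Qed.

Lemma Cint_correct f a b : curve_cont f -> is_RInt (V := CV) f a b (Cint f a b).
Proof. intros. apply RInt_correct, Cint_ex, H. Qed.

Lemma Cint_unique f a b l : is_RInt (V := CV) f a b l -> Cint f a b = l.
Proof. apply (is_RInt_unique (V := CV)). Qed.

Lemma Cint_ext f g a b : (forall x, Rmin a b < x < Rmax a b -> f x = g x) -> Cint f a b = Cint g a b.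
Proof. intros. apply (RInt_ext (V := CV)). assumption. Qed.

Lemma Cint_Chasles f a b c : curve_cont f -> (Cint f a b + Cint f b c)%C = Cint f a c.
Proof. intros. apply (RInt_Chasles (V := CV)); apply Cint_ex, H. Qed.

Lemma Cint_point f a : Cint f a a = 0%C.
Proof. apply (RInt_point (V := CV)). Qed.

Lemma Cint_plus f g a b : curve_cont f -> curve_cont g ->
  Cint (fun x => f x + g x)%C a b = (Cint f a b + Cint g a b)%C.
Proof. intros. apply Cint_unique. apply (is_RInt_plus (V := CV)); apply Cint_correct; assumption. Qed.

Lemma Cint_minus f g a b : curve_cont f -> curve_cont g ->
  Cint (fun x => f x - g x)%C a b = (Cint f a b - Cint g a b)%C.
Proof. intros. apply Cint_unique. apply (is_RInt_minus (V := CV)); apply Cint_correct; assumption. Qed.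

(** The real module structure gives only real scalars; a complex factor is
    pulled out componentwise. *)
Lemma Cint_mult c f a b : curve_cont f -> Cint (fun x => c * f x)%C a b = (c * Cint f a b)%C.
Proof.
intros H. apply Cint_unique.
pose proof (Cint_correct f a b H) as Hi.
pose proof (is_RInt_fct_extend_fst _ _ _ _ Hi) as H1.
pose proof (is_RInt_fct_extend_snd _ _ _ _ Hi) as H2.
apply is_RInt_fct_extend_pair; simpl.
- apply (is_RInt_minus (V:=R_NormedModule) (fun x => fst c * fst (f x))%R (fun x => snd c * snd (f x))%R);
  apply (is_RInt_scal (V := R_NormedModule)); assumption.
- apply (is_RInt_plus (V:=R_NormedModule) (fun x => fst c * snd (f x))%R (fun x => snd c * fst (f x))%R);
  apply (is_RInt_scal (V := R_NormedModule)); assumption.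
Qed.

Lemma Cint_const c a b : Cint (fun _ => c) a b = (RtoC (b - a) * c)%C.
Proof.
apply Cint_unique.
replace (RtoC (b - a) * c)%C with (scal (V := CV) (b - a) c).
apply (is_RInt_const (V := CV)).
unfold scal; simpl; unfold prod_scal, scal; simpl; unfold mult; simpl.
unfold Cmult; simpl; f_equal; ring.
Qed.

Lemma Cint_le_gen f g a b lg : curve_cont f -> a <= b ->
  (forall x, a <= x <= b -> Cmod (f x) <= g x) ->
  is_RInt g a b lg -> Cmod (Cint f a b) <= lg.
Proof.
intros Hf Hab Hfg Hg. rewrite <- Cmod_norm_R.
apply (norm_RInt_le f g a b); try assumption.
- intros x Hx. rewrite Cmod_norm_R. apply Hfg, Hx.
- apply Cint_correct, Hf.
Qed.

Lemma Cint_le_const f M a b : curve_cont f -> a <= b ->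
  (forall x, a <= x <= b -> Cmod (f x) <= M) -> Cmod (Cint f a b) <= (b - a) * M.
Proof. intros. apply (Cint_le_gen f (fun _ => M)); try assumption. apply (is_RInt_const (V:=R_NormedModule)). Qed.

Lemma is_RInt_exp lam a b : lam <> 0 ->
  is_RInt (fun u => exp (lam * u)) a b ((exp (lam * b) - exp (lam * a)) / lam).
Proof.
intros H.
replace ((exp (lam * b) - exp (lam * a)) / lam) with (minus (exp (lam * b) / lam) (exp (lam * a) / lam)).
2:{ unfold minus, plus, opp; simpl; field; assumption. }
apply (is_RInt_derive (V := R_CompleteNormedModule) (fun u => exp (lam * u) / lam)).
- intros x _. auto_derive; trivial. field; assumption.
- intros x _. apply (ex_derive_continuous (V:=R_NormedModule)). auto_derive; trivial.
Qed.

Lemma Cint_le_exp f M lam a b : curve_cont f -> a <= b -> lam <> 0 ->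
  (forall x, a <= x <= b -> Cmod (f x) <= M * exp (lam * x)) ->
  Cmod (Cint f a b) <= M * ((exp (lam * b) - exp (lam * a)) / lam).
Proof.
intros. apply (Cint_le_gen f (fun u => M * exp (lam * u))); try assumption.
apply (is_RInt_scal (V:=R_NormedModule)). apply is_RInt_exp; assumption.
Qed.

Lemma curve_cont_const c : curve_cont (fun _ => c).
Proof. intros x e He. exists 1; split; [lra|]. intros y _. replace (c - c)%C with (RtoC 0) by ring. rewrite Cmod_0; assumption. Qed.

Lemma curve_cont_plus f g : curve_cont f -> curve_cont g -> curve_cont (fun x => f x + g x)%C.
Proof.
intros Hf Hg. apply continuous_curve_cont. intros x.
apply (continuous_plus (V:=CV)); apply curve_cont_continuous; assumption.
Qed.

Lemma curve_cont_mult f g : curve_cont f -> curve_cont g -> curve_cont (fun x => f x * g x)%C.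
Proof.
intros Hf Hg x e He.
set (M := Cmod (f x) + Cmod (g x) + 1).
assert (HM : 1 <= M) by (unfold M; pose proof (Cmod_ge_0 (f x)); pose proof (Cmod_ge_0 (g x)); lra).
assert (He2 : 0 < Rmin 1 (e / (2 * M))).
{ apply Rmin_pos; [lra|]. apply Rdiv_lt_0_compat; lra. }
destruct (Hf x _ He2) as [d1 [Hd1 H1]]. destruct (Hg x _ He2) as [d2 [Hd2 H2]].
exists (Rmin d1 d2); split; [apply Rmin_pos; assumption|].
intros y Hy.
specialize (H1 y (Rlt_le_trans _ _ _ Hy (Rmin_l _ _))).
specialize (H2 y (Rlt_le_trans _ _ _ Hy (Rmin_r _ _))).
replace (f y * g y - f x * g x)%C with ((f y - f x) * g x + f x * (g y - g x) + (f y - f x) * (g y - g x))%C by ring.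
set (u := (f y - f x)%C) in *. set (v := (g y - g x)%C) in *.
eapply Rle_lt_trans; [apply Cmod_triangle|].
pose proof (Cmod_triangle (u * g x) (f x * v)) as Ht.
rewrite !Cmod_mult in *.
pose proof (Rmin_l 1 (e/(2*M))). pose proof (Rmin_r 1 (e/(2*M))).
pose proof (Cmod_ge_0 u). pose proof (Cmod_ge_0 v). pose proof (Cmod_ge_0 (f x)). pose proof (Cmod_ge_0 (g x)).
set (k := e/(2*M)) in *.
assert (k * M = e / 2) by (unfold k; field; lra).
assert (Cmod u * Cmod (g x) <= k * Cmod (g x)) by (apply Rmult_le_compat_r; lra).
assert (Cmod (f x) * Cmod v <= Cmod (f x) * k) by (apply Rmult_le_compat_l; lra).
assert (Cmod u * Cmod v <= k * 1) by (apply Rmult_le_compat; lra).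
unfold M in *. nra.
Qed.

Lemma curve_cont_minus f g : curve_cont f -> curve_cont g -> curve_cont (fun x => f x - g x)%C.
Proof.
intros Hf Hg. intros x e He.
destruct (curve_cont_plus f (fun x => (-1) * g x)%C Hf (curve_cont_mult _ _ (curve_cont_const _) Hg) x e He) as [d [Hd H]].
exists d; split; trivial. intros y Hy.
replace (f y - g y - (f x - g x))%C with (f y + -1 * g y - (f x + -1 * g x))%C by ring. auto.
Qed.

Lemma curve_cont_bounded f a b : curve_cont f -> exists M, 0 <= M /\ forall u, a <= u <= b -> Cmod (f u) <= M.
Proof.
intros H.
destruct (Rle_dec a b) as [Hab|Hab].
2:{ exists 0; split; [lra|]. intros; lra. }
destruct (continuity_ab_maj (fun u => Cmod (f u)) a b Hab) as [m [Hm Hm2]].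
- intros c _ e He. destruct (H c e He) as [d [Hd Hf]].
  exists d; split; [lra|]. intros x [_ Hx]. simpl in *. unfold Rdist in *.
  eapply Rle_lt_trans; [|apply (Hf x Hx)].
  apply Rabs_le; split.
  + pose proof (Cmod_triangle (f x) (f c - f x)) as T.
    replace (f x + (f c - f x))%C with (f c) in T by ring.
    replace (f c - f x)%C with (- (f x - f c))%C in T by ring. rewrite Cmod_opp in T. lra.
  + pose proof (Cmod_triangle (f c) (f x - f c)) as T.
    replace (f c + (f x - f c))%C with (f x) in T by ring. lra.
- exists (Cmod (f m)); split; [apply Cmod_ge_0|]. apply Hm.
Qed.

(** The derivative quotient condition, cleared of denominators. *)
Definition is_Cderive (f : C -> C) (z l : C) : Prop :=
  forall eps, 0 < eps -> exists d, 0 < d /\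
    forall k, Cmod k < d -> Cmod (f (z + k)%C - f z - k * l)%C <= eps * Cmod k.

Definition holomorphic (f : C -> C) : Prop := forall z, exists l, is_Cderive f z l.

Lemma entire_holomorphic F : entire F -> holomorphic F.
Proof.
intros H z. destruct (H z) as [l Hl]. exists l.
intros eps Heps. destruct Hl as [_ Hl].
specialize (Hl z (fun P HP => HP) (mkposreal eps Heps)).
destruct Hl as [d Hd]. exists d; split; [apply cond_pos|].
intros k Hk.
specialize (Hd (z + k)%C).
assert (Hb : ball (M := AbsRing_UniformSpace C_AbsRing) z d (z + k)%C).
{ unfold ball; simpl. unfold AbsRing_ball, minus, plus, opp, abs; simpl.
  replace (z + k + - z)%C with k by ring. exact Hk. }
specialize (Hd Hb). simpl in Hd.
change (Cmod (F (z + k) + - F z + - ((z + k + - z) * l))%C <= eps * Cmod (z + k + - z)%C) in Hd.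
replace (z + k + - z)%C with k in Hd by ring. exact Hd.
Qed.

Lemma is_Cderive_ext f g z l : (forall w, f w = g w) -> is_Cderive f z l -> is_Cderive g z l.
Proof. intros E H e He. destruct (H e He) as [d [Hd H1]]. exists d; split; trivial. intros. rewrite <- !E. auto. Qed.

Lemma is_Cderive_const c z : is_Cderive (fun _ => c) z 0.
Proof.
intros e He. exists 1; split; [lra|]. intros k _.
replace (c - c - k * 0)%C with (RtoC 0) by ring. rewrite Cmod_0.
pose proof (Cmod_ge_0 k); nra.
Qed.

Lemma is_Cderive_id z : is_Cderive (fun w => w) z 1.
Proof.
intros e He. exists 1; split; [lra|]. intros k _.
replace (z + k - z - k * 1)%C with (RtoC 0) by ring. rewrite Cmod_0.
pose proof (Cmod_ge_0 k); nra.
Qed.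

Lemma is_Cderive_plus f g z l m : is_Cderive f z l -> is_Cderive g z m -> is_Cderive (fun w => f w + g w)%C z (l + m)%C.
Proof.
intros Hf Hg e He.
destruct (Hf (e/2)) as [d1 [Hd1 H1]]; [lra|]. destruct (Hg (e/2)) as [d2 [Hd2 H2]]; [lra|].
exists (Rmin d1 d2); split; [apply Rmin_pos; assumption|].
intros k Hk.
specialize (H1 k (Rlt_le_trans _ _ _ Hk (Rmin_l _ _))).
specialize (H2 k (Rlt_le_trans _ _ _ Hk (Rmin_r _ _))).
replace (f (z + k) + g (z + k) - (f z + g z) - k * (l + m))%C
 with ((f (z + k) - f z - k * l) + (g (z + k) - g z - k * m))%C by ring.
eapply Rle_trans; [apply Cmod_triangle|]. lra.
Qed.

(** The Lipschitz bound at a point that controls the error terms in the chain and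
    product rules. *)
Lemma is_Cderive_lip f z l : is_Cderive f z l -> exists d, 0 < d /\
  forall k, Cmod k < d -> Cmod (f (z + k)%C - f z)%C <= (Cmod l + 1) * Cmod k.
Proof.
intros H. destruct (H 1) as [d [Hd H1]]; [lra|]. exists d; split; trivial.
intros k Hk. specialize (H1 k Hk).
replace (f (z + k) - f z)%C with ((f (z + k) - f z - k * l) + k * l)%C by ring.
eapply Rle_trans; [apply Cmod_triangle|]. rewrite Cmod_mult. lra.
Qed.

Lemma is_Cderive_comp f g z l m : is_Cderive g z m -> is_Cderive f (g z) l -> is_Cderive (fun w => f (g w)) z (m * l)%C.
Proof.
intros Hg Hf e He.
pose proof (Cmod_ge_0 l) as Hl. pose proof (Cmod_ge_0 m) as Hm.
set (e1 := e / (2 * (Cmod m + 1))).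
assert (He1 : 0 < e1) by (apply Rdiv_lt_0_compat; lra).
set (e2 := e / (2 * (Cmod l + 1))).
assert (He2 : 0 < e2) by (apply Rdiv_lt_0_compat; lra).
assert (E1 : e1 * (Cmod m + 1) = e / 2) by (unfold e1; field; lra).
assert (E2 : e2 * (Cmod l + 1) = e / 2) by (unfold e2; field; lra).
destruct (Hf e1 He1) as [d1 [Hd1 H1]].
destruct (Hg e2 He2) as [d2 [Hd2 H2]].
destruct (is_Cderive_lip g z m Hg) as [d3 [Hd3 H3]].
assert (Hd4 : 0 < d1 / (Cmod m + 1)) by (apply Rdiv_lt_0_compat; lra).
exists (Rmin d2 (Rmin d3 (d1 / (Cmod m + 1)))); split.
{ repeat apply Rmin_pos; assumption. }
intros k Hk.
pose proof (Rlt_le_trans _ _ _ Hk (Rmin_l _ _)) as K2.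
pose proof (Rlt_le_trans _ _ _ Hk (Rmin_r _ _)) as K'.
pose proof (Rlt_le_trans _ _ _ K' (Rmin_l _ _)) as K3.
pose proof (Rlt_le_trans _ _ _ K' (Rmin_r _ _)) as K4. clear K'.
specialize (H2 k K2). specialize (H3 k K3).
set (h := (g (z + k) - g z)%C) in *.
assert (Hh : Cmod h < d1).
{ apply Rle_lt_trans with (1 := H3).
  apply Rmult_lt_compat_l with (r := Cmod m + 1) in K4; [|lra].
  replace ((Cmod m + 1) * (d1 / (Cmod m + 1))) with d1 in K4 by (field; lra). exact K4. }
specialize (H1 h Hh).
replace (g z + h)%C with (g (z + k)%C) in H1 by (unfold h; ring).
replace (f (g (z + k)) - f (g z) - k * (m * l))%C
 with ((f (g (z + k)) - f (g z) - h * l) + (h - k * m) * l)%C by ring.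
eapply Rle_trans; [apply Cmod_triangle|]. rewrite Cmod_mult.
pose proof (Cmod_ge_0 k). pose proof (Cmod_ge_0 (h - k * m)).
assert (e1 * Cmod h <= e1 * ((Cmod m + 1) * Cmod k)) by (apply Rmult_le_compat_l; lra).
assert (Cmod (h - k * m) * Cmod l <= e2 * Cmod k * (Cmod l + 1)).
{ apply Rmult_le_compat; lra. }
nra.
Qed.

Lemma is_Cderive_mult f g z l m : is_Cderive f z l -> is_Cderive g z m ->
  is_Cderive (fun w => f w * g w)%C z (l * g z + f z * m)%C.
Proof.
intros Hf Hg e He.
pose proof (Cmod_ge_0 l) as Pl. pose proof (Cmod_ge_0 m) as Pm.
pose proof (Cmod_ge_0 (f z)) as Pf. pose proof (Cmod_ge_0 (g z)) as Pg.
set (M := 1 + Cmod l + Cmod m + Cmod (f z) + Cmod (g z)).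
assert (HM : 1 <= M) by (unfold M; lra).
assert (He1 : 0 < e / (3 * M)) by (apply Rdiv_lt_0_compat; lra).
destruct (Hf _ He1) as [d1 [Hd1 H1]]. destruct (Hg _ He1) as [d2 [Hd2 H2]].
destruct (is_Cderive_lip f z l Hf) as [d3 [Hd3 H3]]. destruct (is_Cderive_lip g z m Hg) as [d4 [Hd4 H4]].
assert (Hd5 : 0 < e / (3 * M * M)) by (apply Rdiv_lt_0_compat; nra).
exists (Rmin (Rmin d1 d2) (Rmin (Rmin d3 d4) (e / (3 * M * M)))); split.
{ repeat apply Rmin_pos; assumption. }
intros k Hk.
assert (K1 : Cmod k < d1 /\ Cmod k < d2 /\ Cmod k < d3 /\ Cmod k < d4 /\ Cmod k < e / (3 * M * M)).
{ repeat split; eapply Rlt_le_trans; try exact Hk.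
  - eapply Rle_trans; [apply Rmin_l|apply Rmin_l].
  - eapply Rle_trans; [apply Rmin_l|apply Rmin_r].
  - eapply Rle_trans; [apply Rmin_r|eapply Rle_trans; [apply Rmin_l|apply Rmin_l]].
  - eapply Rle_trans; [apply Rmin_r|eapply Rle_trans; [apply Rmin_l|apply Rmin_r]].
  - eapply Rle_trans; [apply Rmin_r|apply Rmin_r]. }
destruct K1 as [K1 [K2 [K3 [K4 K5]]]].
specialize (H1 k K1). specialize (H2 k K2). specialize (H3 k K3). specialize (H4 k K4).
replace (f (z + k) * g (z + k) - f z * g z - k * (l * g z + f z * m))%C with
 ((f (z + k) - f z - k * l) * g z + f z * (g (z + k) - g z - k * m)
  + (f (z + k) - f z) * (g (z + k) - g z))%C by ring.
set (u := (f (z + k) - f z - k * l)%C) in *.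
set (v := (g (z + k) - g z - k * m)%C) in *.
set (p := (f (z + k) - f z)%C) in *. set (q := (g (z + k) - g z)%C) in *.
eapply Rle_trans; [apply Cmod_triangle|].
pose proof (Cmod_triangle (u * g z) (f z * v)) as T. rewrite !Cmod_mult in *.
pose proof (Cmod_ge_0 k). pose proof (Cmod_ge_0 p). pose proof (Cmod_ge_0 q).
pose proof (Cmod_ge_0 u). pose proof (Cmod_ge_0 v).
assert (A1 : Cmod u * Cmod (g z) <= e / (3 * M) * Cmod k * M).
{ apply Rmult_le_compat; unfold M in *; lra. }
assert (A2 : Cmod (f z) * Cmod v <= M * (e / (3 * M) * Cmod k)).
{ apply Rmult_le_compat; unfold M in *; lra. }
assert (A3 : Cmod p * Cmod q <= (M * Cmod k) * (M * (e / (3 * M * M)))).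
{ apply Rmult_le_compat; try lra.
  - apply Rle_trans with (1 := H3). apply Rmult_le_compat_r; unfold M; lra.
  - apply Rle_trans with (1 := H4). apply Rmult_le_compat; try lra. unfold M; lra. }
replace (e / (3 * M) * Cmod k * M) with (e / 3 * Cmod k) in A1 by (field; lra).
replace (M * (e / (3 * M) * Cmod k)) with (e / 3 * Cmod k) in A2 by (field; lra).
replace (M * Cmod k * (M * (e / (3 * M * M)))) with (e / 3 * Cmod k) in A3 by (field; lra).
lra.
Qed.

Lemma holomorphic_const c : holomorphic (fun _ => c).
Proof. intros z; eexists; apply is_Cderive_const. Qed.
Lemma holomorphic_id : holomorphic (fun w => w).
Proof. intros z; eexists; apply is_Cderive_id. Qed.
Lemma holomorphic_plus f g : holomorphic f -> holomorphic g -> holomorphic (fun w => f w + g w)%C.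
Proof. intros Hf Hg z. destruct (Hf z), (Hg z). eexists. apply is_Cderive_plus; eassumption. Qed.
Lemma holomorphic_mult f g : holomorphic f -> holomorphic g -> holomorphic (fun w => f w * g w)%C.
Proof. intros Hf Hg z. destruct (Hf z), (Hg z). eexists. apply is_Cderive_mult; eassumption. Qed.
Lemma holomorphic_comp f g : holomorphic f -> holomorphic g -> holomorphic (fun w => f (g w)).
Proof. intros Hf Hg z. destruct (Hg z) as [m Hm]. destruct (Hf (g z)) as [l Hl].
exists (m * l)%C. apply is_Cderive_comp; assumption. Qed.
Lemma holomorphic_ext f g : (forall w, f w = g w) -> holomorphic f -> holomorphic g.
Proof. intros E H z. destruct (H z) as [l Hl]. exists l. eapply is_Cderive_ext; eassumption. Qed.
Lemma holomorphic_minus f g : holomorphic f -> holomorphic g -> holomorphic (fun w => f w - g w)%C.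
Proof.
intros Hf Hg. apply holomorphic_ext with (fun w => f w + (-1) * g w)%C. { intros; ring. }
apply holomorphic_plus; trivial. apply holomorphic_mult; trivial. apply holomorphic_const.
Qed.

Lemma holomorphic_line f a d : holomorphic f -> curve_cont (fun u => f (a + RtoC u * d)%C).
Proof.
intros Hf x e He.
destruct (Hf (a + RtoC x * d)%C) as [l Hl].
destruct (is_Cderive_lip _ _ _ Hl) as [r [Hr H]].
pose proof (Cmod_ge_0 l). pose proof (Cmod_ge_0 d).
assert (Hp : 0 < Rmin (r / (Cmod d + 1)) (e / ((Cmod l + 1) * (Cmod d + 1)))).
{ apply Rmin_pos; apply Rdiv_lt_0_compat; nra. }
eexists; split; [exact Hp|].
intros y Hy.
pose proof (Rlt_le_trans _ _ _ Hy (Rmin_l _ _)) as K1.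
pose proof (Rlt_le_trans _ _ _ Hy (Rmin_r _ _)) as K2.
assert (Ek : Cmod (RtoC (y - x) * d) <= Rabs (y - x) * (Cmod d + 1)).
{ rewrite Cmod_mult, Cmod_R. pose proof (Rabs_pos (y - x)). nra. }
specialize (H (RtoC (y - x) * d)%C).
replace (a + x * d + RtoC (y - x) * d)%C with (a + y * d)%C in H by (rewrite RtoC_minus; ring).
eapply Rle_lt_trans; [apply H|].
- apply Rle_lt_trans with (1 := Ek).
  apply Rmult_lt_compat_r with (r := Cmod d + 1) in K1; [|lra].
  replace (r / (Cmod d + 1) * (Cmod d + 1)) with r in K1 by (field; lra). exact K1.
- apply Rle_lt_trans with ((Cmod l + 1) * (Rabs (y - x) * (Cmod d + 1))).
  + apply Rmult_le_compat_l; lra.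
  + apply Rmult_lt_compat_r with (r := (Cmod l + 1) * (Cmod d + 1)) in K2; [|nra].
    replace (e / ((Cmod l + 1) * (Cmod d + 1)) * ((Cmod l + 1) * (Cmod d + 1))) with e in K2 by (field; lra).
    nra.
Qed.

Lemma is_Cderive_is_derive f a d x l : is_Cderive f (a + RtoC x * d)%C l ->
  is_derive (K := R_AbsRing) (V := CV) (fun u => f (a + RtoC u * d)%C) x (d * l)%C.
Proof.
intros H. split; [apply is_linear_scal_l|].
intros x' Hx' eps.
assert (x' = x) by (symmetry; apply (is_filter_lim_locally_unique (K:=R_AbsRing) (V := AbsRing_NormedModule R_AbsRing) x x' Hx')). subst x'.
pose proof (Cmod_ge_0 d) as Hd.
assert (He : 0 < eps / (Cmod d + 1)) by (apply Rdiv_lt_0_compat; [apply cond_pos|lra]).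
destruct (H _ He) as [r [Hr H1]].
assert (Hr2 : 0 < r / (Cmod d + 1)) by (apply Rdiv_lt_0_compat; lra).
exists (mkposreal _ Hr2). intros y Hy.
unfold ball in Hy; simpl in Hy. unfold AbsRing_ball, minus, plus, opp, abs in Hy; simpl in Hy.
change (y + - x) with (y - x) in Hy.
assert (Ek : Cmod (RtoC (y - x) * d) <= Rabs (y - x) * (Cmod d + 1)).
{ rewrite Cmod_mult, Cmod_R. pose proof (Rabs_pos (y - x)). nra. }
assert (Ek2 : Cmod (RtoC (y - x) * d) < r).
{ apply Rle_lt_trans with (1 := Ek).
  apply Rmult_lt_compat_r with (r := Cmod d + 1) in Hy; [|lra].
  replace (r / (Cmod d + 1) * (Cmod d + 1)) with r in Hy by (field; lra). exact Hy. }
specialize (H1 _ Ek2).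
replace (a + x * d + RtoC (y - x) * d)%C with (a + y * d)%C in H1 by (rewrite RtoC_minus; ring).
rewrite Cmod_norm_R.
match goal with |- _ <= _ * ?N => change N with (Rabs (y - x)) end.
match goal with |- Cmod ?X <= _ => replace X
 with (f (a + y * d) - f (a + x * d) - RtoC (y - x) * d * l)%C end.
2:{ unfold minus, plus, opp, scal; simpl. unfold prod_plus, prod_opp, prod_scal; simpl.
    unfold Cminus, Cplus, Copp, Cmult, scal, mult, plus, opp; simpl. unfold mult; simpl. f_equal; ring. }
apply Rle_trans with (1 := H1).
apply Rle_trans with (eps / (Cmod d + 1) * (Rabs (y - x) * (Cmod d + 1))).
- apply Rmult_le_compat_l; lra.
- right; field; lra.
Qed.

(** The fundamental theorem of calculus along the line [a + u d]. *)
Lemma Cint_FTC f df a d p q : (forall w, is_Cderive f w (df w)) ->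
  curve_cont (fun u => df (a + RtoC u * d)%C) ->
  Cint (fun u => d * df (a + RtoC u * d))%C p q = (f (a + RtoC q * d) - f (a + RtoC p * d))%C.
Proof.
intros H Hc. apply Cint_unique.
apply (is_RInt_derive (V := CV) (fun u => f (a + RtoC u * d)%C)).
- intros x _. apply is_Cderive_is_derive, H.
- intros x _. apply curve_cont_continuous. apply curve_cont_mult; trivial. apply curve_cont_const.
Qed.

(** * Cauchy's theorem for rectangles *)

Lemma holomorphic_hor f y : holomorphic f -> curve_cont (fun x => f (x, y)).
Proof.
intros H x e He. destruct (holomorphic_line f (0, y) 1 H x e He) as [d [Hd H1]].
exists d; split; trivial. intros u Hu. specialize (H1 u Hu).
replace ((0, y) + u * 1)%C with (u, y) in H1 by (apply injective_projections; simpl; ring).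
replace ((0, y) + x * 1)%C with (x, y) in H1 by (apply injective_projections; simpl; ring). exact H1.
Qed.

Lemma holomorphic_ver f x : holomorphic f -> curve_cont (fun y => f (x, y)).
Proof.
intros H y e He. destruct (holomorphic_line f (x, 0) Ci H y e He) as [d [Hd H1]].
exists d; split; trivial. intros u Hu. specialize (H1 u Hu).
replace ((x, 0) + u * Ci)%C with (x, u) in H1 by (apply injective_projections; simpl; ring).
replace ((x, 0) + y * Ci)%C with (x, y) in H1 by (apply injective_projections; simpl; ring). exact H1.
Qed.

(** The integral of [f w dw] around the rectangle [a <= Re w <= b],
    [c <= Im w <= d], counterclockwise. *)
Definition boundary_int (f : C -> C) (a b c d : R) : C :=
  (Cint (fun x => f (x, c)) a b + Ci * Cint (fun y => f (b, y)) c d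
   - Cint (fun x => f (x, d)) a b - Ci * Cint (fun y => f (a, y)) c d)%C.

Lemma boundary_int_split f a m b c n d : holomorphic f ->
  boundary_int f a b c d =
  (boundary_int f a m c n + boundary_int f m b c n
   + (boundary_int f a m n d + boundary_int f m b n d))%C.
Proof.
intros H. unfold boundary_int.
rewrite <- (Cint_Chasles (fun x => f (x, c)) a m b) by now apply holomorphic_hor.
rewrite <- (Cint_Chasles (fun x => f (x, d)) a m b) by now apply holomorphic_hor.
rewrite <- (Cint_Chasles (fun y => f (b, y)) c n d) by now apply holomorphic_ver.
rewrite <- (Cint_Chasles (fun y => f (a, y)) c n d) by now apply holomorphic_ver.
ring.
Qed.

Lemma boundary_int_minus f g a b c d : holomorphic f -> holomorphic g ->
  boundary_int (fun w => f w - g w)%C a b c d = (boundary_int f a b c d - boundary_int g a b c d)%C.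
Proof.
intros Hf Hg. unfold boundary_int.
rewrite (Cint_minus (fun x => f (x, c)) (fun x => g (x, c))) by now apply holomorphic_hor.
rewrite (Cint_minus (fun x => f (x, d)) (fun x => g (x, d))) by now apply holomorphic_hor.
rewrite (Cint_minus (fun y => f (b, y)) (fun y => g (b, y))) by now apply holomorphic_ver.
rewrite (Cint_minus (fun y => f (a, y)) (fun y => g (a, y))) by now apply holomorphic_ver.
ring.
Qed.

Lemma boundary_int_primitive f df a b c d :
  (forall w, is_Cderive f w (df w)) -> holomorphic df -> boundary_int df a b c d = 0%C.
Proof.
intros H He. unfold boundary_int.
assert (Hh : forall y, Cint (fun x => df (x, y)) a b = (f (b, y) - f (a, y))%C).
{ intros y.
  transitivity (Cint (fun u => 1 * df ((0, y) + RtoC u * 1))%C a b).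
  { apply Cint_ext. intros x _. rewrite Cmult_1_l. f_equal. apply injective_projections; simpl; ring. }
  rewrite (Cint_FTC f df) by (trivial; now apply holomorphic_line).
  f_equal; [|f_equal]; f_equal; apply injective_projections; simpl; ring. }
assert (Hv : forall x, (Ci * Cint (fun y => df (x, y)) c d)%C = (f (x, d) - f (x, c))%C).
{ intros x. rewrite <- Cint_mult by now apply holomorphic_ver.
  transitivity (Cint (fun u => Ci * df ((x, 0) + RtoC u * Ci))%C c d).
  { apply Cint_ext. intros y _. do 2 f_equal. apply injective_projections; simpl; ring. }
  rewrite (Cint_FTC f df) by (trivial; now apply holomorphic_line).
  f_equal; [|f_equal]; f_equal; apply injective_projections; simpl; ring. }
rewrite !Hh, !Hv. ring.
Qed.

Lemma boundary_int_le f a b c d M : holomorphic f -> a <= b -> c <= d ->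
  (forall x y, a <= x <= b -> c <= y <= d -> Cmod (f (x, y)) <= M) ->
  Cmod (boundary_int f a b c d) <= 2 * ((b - a) + (d - c)) * M.
Proof.
intros Hf Hab Hcd H. unfold boundary_int, Cminus.
eapply Rle_trans; [apply Cmod_triangle|].
pose proof (Cmod_triangle (Cint (fun x => f (x, c)) a b + Ci * Cint (fun y => f (b, y)) c d)
   (- Cint (fun x => f (x, d)) a b)) as T1.
pose proof (Cmod_triangle (Cint (fun x => f (x, c)) a b) (Ci * Cint (fun y => f (b, y)) c d)) as T2.
rewrite !Cmod_opp, !Cmod_mult, !Cmod_Ci in *.
assert (B1 : Cmod (Cint (fun x => f (x, c)) a b) <= (b - a) * M).
{ apply Cint_le_const; trivial. now apply holomorphic_hor. intros; apply H; lra. }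
assert (B2 : Cmod (Cint (fun x => f (x, d)) a b) <= (b - a) * M).
{ apply Cint_le_const; trivial. now apply holomorphic_hor. intros; apply H; lra. }
assert (B3 : Cmod (Cint (fun y => f (b, y)) c d) <= (d - c) * M).
{ apply Cint_le_const; trivial. now apply holomorphic_ver. intros; apply H; lra. }
assert (B4 : Cmod (Cint (fun y => f (a, y)) c d) <= (d - c) * M).
{ apply Cint_le_const; trivial. now apply holomorphic_ver. intros; apply H; lra. }
lra.
Qed.

(** The bisection step: the boundary integrals of the four quarters add up to the
    whole one, so one of them has at least a quarter of its modulus. *)
Lemma quarter_rectangle f (r : (R * R) * (R * R)) : holomorphic f ->
  { s : (R * R) * (R * R) |
    let '((a, b), (c, d)) := r in let '((a', b'), (c', d')) := s in
    (a <= b -> a <= a' /\ b' <= b /\ b' - a' = (b - a) / 2) /\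
    (c <= d -> c <= c' /\ d' <= d /\ d' - c' = (d - c) / 2) /\
    Cmod (boundary_int f a b c d) <= 4 * Cmod (boundary_int f a' b' c' d') }.
Proof.
intros Hf. destruct r as [[a b] [c d]].
set (m := (a + b) / 2). set (n := (c + d) / 2).
pose proof (boundary_int_split f a m b c n d Hf) as E.
assert (Hm1 : a <= b -> a <= m /\ m <= b) by (unfold m; lra).
assert (Hn1 : c <= d -> c <= n /\ n <= d) by (unfold n; lra).
destruct (Rle_dec (Cmod (boundary_int f a b c d)) (4 * Cmod (boundary_int f a m c n))) as [H1|H1].
{ exists ((a, m), (c, n)). unfold m, n in *; repeat split; lra. }
destruct (Rle_dec (Cmod (boundary_int f a b c d)) (4 * Cmod (boundary_int f m b c n))) as [H2|H2].
{ exists ((m, b), (c, n)). unfold m, n in *; repeat split; lra. }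
destruct (Rle_dec (Cmod (boundary_int f a b c d)) (4 * Cmod (boundary_int f a m n d))) as [H3|H3].
{ exists ((a, m), (n, d)). unfold m, n in *; repeat split; lra. }
exists ((m, b), (n, d)).
assert (Cmod (boundary_int f a b c d) <= 4 * Cmod (boundary_int f m b n d)).
{ rewrite E in *.
  pose proof (Cmod_triangle (boundary_int f a m c n + boundary_int f m b c n) (boundary_int f a m n d + boundary_int f m b n d)).
  pose proof (Cmod_triangle (boundary_int f a m c n) (boundary_int f m b c n)).
  pose proof (Cmod_triangle (boundary_int f a m n d) (boundary_int f m b n d)). lra. }
unfold m, n in *; repeat split; lra.
Qed.

Lemma nested_intervals (a b : nat -> R) :
  (forall n, a n <= b n) -> (forall n, a n <= a (S n)) -> (forall n, b (S n) <= b n) ->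
  exists x, forall n, a n <= x <= b n.
Proof.
intros Hab Ha Hb.
assert (Ha' : forall n k, a n <= a (n + k)%nat).
{ intros n k; induction k as [|k IH]; [rewrite Nat.add_0_r; lra|].
  rewrite Nat.add_succ_r. specialize (Ha (n + k)%nat); lra. }
assert (Hb' : forall n k, b (n + k)%nat <= b n).
{ intros n k; induction k as [|k IH]; [rewrite Nat.add_0_r; lra|].
  rewrite Nat.add_succ_r. specialize (Hb (n + k)%nat); lra. }
assert (Hc : forall n m, a n <= b m).
{ intros n m. pose proof (Ha' n m). pose proof (Hb' m n). rewrite Nat.add_comm in H0.
  specialize (Hab (n + m)%nat). lra. }
destruct (completeness (fun x => exists n, x = a n)) as [x [Hx1 Hx2]].
- exists (b O). intros y [n ->]. apply Hc.
- exists (a O), O; reflexivity.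
- exists x. intros n. split.
  + apply Hx1. exists n; reflexivity.
  + apply Hx2. intros y [m ->]. apply Hc.
Qed.

(** Goursat's argument.  The rectangles of the bisection shrink to a point [w],
    near which [f] is affine up to [e |w' - w|]; affine functions have
    primitives, so the integral over the [n]-th rectangle is [O(e 4^(-n))],
    while by construction it is at least [4^(-n)] times the original one. *)
Theorem goursat f a b c d : holomorphic f -> a <= b -> c <= d -> boundary_int f a b c d = 0%C.
Proof.
intros Hf Hab Hcd.
set (s := fun n => Nat.iter n (fun r => proj1_sig (quarter_rectangle f r Hf)) ((a, b), (c, d))).
set (a' := fun n => fst (fst (s n))). set (b' := fun n => snd (fst (s n))).
set (c' := fun n => fst (snd (s n))). set (d' := fun n => snd (snd (s n))).
assert (Hs : forall n,
   (a' n <= b' n -> a' n <= a' (S n) /\ b' (S n) <= b' n /\ b' (S n) - a' (S n) = (b' n - a' n) / 2) /\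
   (c' n <= d' n -> c' n <= c' (S n) /\ d' (S n) <= d' n /\ d' (S n) - c' (S n) = (d' n - c' n) / 2) /\
   Cmod (boundary_int f (a' n) (b' n) (c' n) (d' n)) <=
     4 * Cmod (boundary_int f (a' (S n)) (b' (S n)) (c' (S n)) (d' (S n)))).
{ intros n. unfold a', b', c', d'.
  change (s (S n)) with (proj1_sig (quarter_rectangle f (s n) Hf)).
  destruct (quarter_rectangle f (s n) Hf) as [t Ht]. simpl.
  destruct (s n) as [[? ?] [? ?]], t as [[? ?] [? ?]]. exact Ht. }
assert (Hlen : forall n, b' n - a' n = (b - a) * (/ 2) ^ n /\ d' n - c' n = (d - c) * (/ 2) ^ n).
{ induction n as [|n [IH1 IH2]]; [simpl; unfold a', b', c', d'; simpl; lra|].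
  destruct (Hs n) as [A1 [A2 _]].
  assert (0 < (/ 2) ^ n) by (apply pow_lt; lra).
  destruct A1 as [_ [_ A1]]; [nra|]. destruct A2 as [_ [_ A2]]; [nra|].
  simpl. lra. }
assert (Hord : forall n, a' n <= b' n /\ c' n <= d' n).
{ intros n. destruct (Hlen n). assert (0 < (/ 2) ^ n) by (apply pow_lt; lra). nra. }
destruct (nested_intervals a' b') as [x Hx].
{ apply Hord. } { intros n. apply Hs, Hord. } { intros n. apply Hs, Hord. }
destruct (nested_intervals c' d') as [y Hy].
{ apply Hord. } { intros n. apply Hs, Hord. } { intros n. apply Hs, Hord. }
destruct (Hf (x, y)) as [l Hl].
set (P := (b - a) + (d - c)).
assert (HP : 0 <= P) by (unfold P; lra).
assert (Hlow : forall n, Cmod (boundary_int f a b c d) <=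
   4 ^ n * Cmod (boundary_int f (a' n) (b' n) (c' n) (d' n))).
{ induction n as [|n IH]; [simpl; right; unfold a', b', c', d'; simpl; ring|].
  destruct (Hs n) as [_ [_ A]]. assert (0 < 4 ^ n) by (apply pow_lt; lra).
  simpl. nra. }
apply Cmod_eq_0. apply Rle_antisym; [|apply Cmod_ge_0].
apply le_epsilon. intros eps Heps. rewrite Rplus_0_l.
set (e := eps / (2 * P * P + 1)).
assert (He : 0 < e) by (apply Rdiv_lt_0_compat; nra).
destruct (Hl e He) as [r [Hr H]].
destruct (pow_lt_1_zero (/ 2)) with (y := r / (P + 1)) as [n Hn].
{ rewrite Rabs_right; lra. } { apply Rdiv_lt_0_compat; lra. }
specialize (Hn n (Nat.le_refl _)).
assert (Hq : 0 < (/ 2) ^ n) by (apply pow_lt; lra).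
rewrite Rabs_right in Hn by lra.
set (q := (/ 2) ^ n) in *.
destruct (Hlen n) as [L1 L2]. fold q in L1, L2.
assert (HqP : q * P < r).
{ apply Rmult_lt_compat_r with (r := P + 1) in Hn; [|lra].
  replace (r / (P + 1) * (P + 1)) with r in Hn by (field; lra). nra. }
apply Rle_trans with (1 := Hlow n).
(* The affine approximation g of f at the common point, and a primitive G of it. *)
set (g := fun w => (f (x, y) + (w - (x, y)) * l)%C).
set (G := fun w => ((f (x, y) - (x, y) * l) * w + (l / 2) * (w * w))%C).
assert (HG : forall w, is_Cderive G w (g w)).
{ intros w. unfold G, g.
  replace (f (x, y) + (w - (x, y)) * l)%C with
   ((0 * w + (f (x, y) - (x, y) * l) * 1) + (0 * (w * w) + (l / 2) * (1 * w + w * 1)))%C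
   by (field; intros E; injection E; lra).
  apply is_Cderive_plus.
  - apply (is_Cderive_mult (fun _ => (f (x, y) - (x, y) * l)%C) (fun w => w)); [apply is_Cderive_const|apply is_Cderive_id].
  - apply (is_Cderive_mult (fun _ => (l / 2)%C) (fun w => w * w)%C); [apply is_Cderive_const|].
    apply (is_Cderive_mult (fun w => w) (fun w => w)); apply is_Cderive_id. }
assert (Hg : holomorphic g).
{ unfold g. apply holomorphic_plus; [apply holomorphic_const|]. apply holomorphic_mult; [|apply holomorphic_const].
  apply holomorphic_minus; [apply holomorphic_id|apply holomorphic_const]. }
assert (E : boundary_int f (a' n) (b' n) (c' n) (d' n) =
   boundary_int (fun w => f w - g w)%C (a' n) (b' n) (c' n) (d' n)).
{ rewrite boundary_int_minus by assumption. rewrite (boundary_int_primitive G g) by assumption. ring. }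
rewrite E.
destruct (Hord n) as [O1 O2].
assert (Hb : Cmod (boundary_int (fun w => f w - g w)%C (a' n) (b' n) (c' n) (d' n)) <=
  2 * ((b' n - a' n) + (d' n - c' n)) * (e * (q * P))).
{ apply boundary_int_le; trivial. { apply holomorphic_minus; assumption. }
  intros u v Hu Hv.
  assert (Hk : Cmod ((u, v) - (x, y)) <= q * P).
  { replace ((u, v) - (x, y))%C with (RtoC (u - x) + Ci * RtoC (v - y))%C
      by (apply injective_projections; simpl; ring).
    eapply Rle_trans; [apply Cmod_triangle|]. rewrite Cmod_mult, Cmod_Ci, !Cmod_R, Rmult_1_l.
    specialize (Hx n). specialize (Hy n).
    assert (Rabs (u - x) <= b' n - a' n) by (apply Rabs_le; lra).
    assert (Rabs (v - y) <= d' n - c' n) by (apply Rabs_le; lra).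
    unfold P. lra. }
  specialize (H ((u, v) - (x, y))%C (Rle_lt_trans _ _ _ Hk HqP)).
  replace ((x, y) + ((u, v) - (x, y)))%C with ((u, v) : C) in H by (apply injective_projections; simpl; ring).
  unfold g. replace (f (u, v) - (f (x, y) + ((u, v) - (x, y)) * l))%C
    with (f (u, v) - f (x, y) - ((u, v) - (x, y)) * l)%C by ring.
  apply Rle_trans with (1 := H). apply Rmult_le_compat_l; lra. }
assert (H4 : 0 < 4 ^ n) by (apply pow_lt; lra).
apply Rle_trans with (4 ^ n * (2 * (b' n - a' n + (d' n - c' n)) * (e * (q * P)))).
{ apply Rmult_le_compat_l; [lra|exact Hb]. }
rewrite L1, L2.
replace (4 ^ n * (2 * ((b - a) * q + (d - c) * q) * (e * (q * P)))) with
  ((4 ^ n * (q * q)) * (2 * P * P * e)) by (unfold P; ring).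
replace (4 ^ n * (q * q)) with 1.
2:{ unfold q. rewrite <- !Rpow_mult_distr. rewrite <- (pow1 n). f_equal. lra. }
unfold e. rewrite Rmult_1_l.
apply Rmult_le_reg_r with (2 * P * P + 1); [nra|].
replace (2 * P * P * (eps / (2 * P * P + 1)) * (2 * P * P + 1)) with (2 * P * P * eps) by (field; nra).
nra.
Qed.

(** * The complex exponential and its Taylor remainders *)

Lemma Cexp_plus z w : Cexp (z + w) = (Cexp z * Cexp w)%C.
Proof.
unfold Cexp, Cmult, Re, Im; simpl. rewrite exp_plus, cos_plus, sin_plus. f_equal; ring.
Qed.

Lemma Cexp_0 : Cexp 0 = 1%C.
Proof. unfold Cexp, Re, Im, RtoC; simpl. rewrite exp_0, cos_0, sin_0. f_equal; ring. Qed.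

Lemma Cmod_Cexp z : Cmod (Cexp z) = exp (Re z).
Proof.
unfold Cmod, Cexp; simpl fst; simpl snd.
replace ((exp (Re z) * cos (Im z)) ^ 2 + (exp (Re z) * sin (Im z)) ^ 2) with (exp (Re z) * exp (Re z)).
2:{ pose proof (sin2_cos2 (Im z)) as H. unfold Rsqr in H. 
    transitivity (exp (Re z) * exp (Re z) * (sin (Im z) * sin (Im z) + cos (Im z) * cos (Im z))); [rewrite H|]; ring. }
apply sqrt_square. left; apply exp_pos.
Qed.

Lemma Re_le_Cmod z : Re z <= Cmod z.
Proof. eapply Rle_trans; [apply Rle_abs|apply fst_le_Cmod]. Qed.

Lemma deriv_0_bound (f : R -> R) l : derivable_pt_lim f 0 l -> forall eps, 0 < eps ->
  exists d, 0 < d /\ forall h, Rabs h < d -> Rabs (f h - f 0 - l * h) <= eps * Rabs h.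
Proof.
intros H eps Heps. destruct (H eps Heps) as [d Hd].
exists d; split; [apply cond_pos|]. intros h Hh.
destruct (Req_dec h 0) as [->|Hn].
{ replace (f 0 - f 0 - l * 0) with 0 by ring. rewrite Rabs_R0; lra. }
specialize (Hd h Hn Hh). rewrite Rplus_0_l in Hd.
replace (f h - f 0 - l * h) with (((f h - f 0) / h - l) * h) by (field; assumption).
rewrite Rabs_mult. apply Rmult_le_compat_r; [apply Rabs_pos|lra].
Qed.

(** For [k = x + i y],
    [e^k - 1 - k = (e^x - 1 - x) e^(i y) + x (e^(i y) - 1) + (e^(i y) - 1 - i y)],
    so the real derivatives of [exp], [cos] and [sin] at [0] suffice. *)
Lemma is_Cderive_Cexp_0 : is_Cderive Cexp 0 1.
Proof.
intros e He.
assert (He' : 0 < Rmin 1 (e / 7)) by (apply Rmin_pos; lra).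
pose proof (Rmin_l 1 (e / 7)) as M1. pose proof (Rmin_r 1 (e / 7)) as M2.
set (e1 := Rmin 1 (e / 7)) in *.
destruct (deriv_0_bound exp 1 derivable_pt_lim_exp_0 e1 He') as [d1 [Hd1 H1]].
assert (Hs : derivable_pt_lim sin 0 1) by (rewrite <- cos_0; apply derivable_pt_lim_sin).
assert (Hc : derivable_pt_lim cos 0 0) by (replace 0 with (- sin 0) at 2 by (rewrite sin_0; ring); apply derivable_pt_lim_cos).
destruct (deriv_0_bound _ _ Hs e1 He') as [d2 [Hd2 H2]].
destruct (deriv_0_bound _ _ Hc e1 He') as [d3 [Hd3 H3]].
exists (Rmin e1 (Rmin d1 (Rmin d2 d3))); split. { repeat (first [assumption | apply Rmin_pos]). }
intros k Hk.
assert (K : Cmod k < e1 /\ Cmod k < d1 /\ Cmod k < d2 /\ Cmod k < d3).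
{ repeat split; eapply Rlt_le_trans; try exact Hk.
  - apply Rmin_l.
  - eapply Rle_trans; [apply Rmin_r|apply Rmin_l].
  - eapply Rle_trans; [apply Rmin_r|]. eapply Rle_trans; [apply Rmin_r|apply Rmin_l].
  - eapply Rle_trans; [apply Rmin_r|]. eapply Rle_trans; [apply Rmin_r|apply Rmin_r]. }
destruct K as [K0 [K1 [K2 K3]]].
rewrite Cplus_0_l, Cexp_0.
destruct k as [x y].
pose proof (fst_le_Cmod (x, y)) as Fx. pose proof (snd_le_Cmod (x, y)) as Fy. simpl in Fx, Fy.
set (r := Cmod (x, y)) in *.
specialize (H1 x ltac:(lra)). specialize (H2 y ltac:(lra)). specialize (H3 y ltac:(lra)).
rewrite exp_0 in H1. rewrite sin_0 in H2. rewrite cos_0 in H3.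
set (A := exp x - 1 - 1 * x) in *. set (B := sin y - 0 - 1 * y) in *. set (D := cos y - 1 - 0 * y) in *.
replace (Cexp (x, y) - 1 - (x, y) * 1)%C with
 (RtoC A * Cexp (0, y) + RtoC x * (RtoC D + Ci * RtoC (B + y)) + (RtoC D + Ci * RtoC B))%C.
2:{ unfold Cexp, A, B, D, Re, Im; simpl. rewrite exp_0. apply injective_projections; simpl; ring. }
eapply Rle_trans; [apply Cmod_triangle|].
pose proof (Cmod_triangle (RtoC A * Cexp (0, y)) (RtoC x * (RtoC D + Ci * RtoC (B + y)))) as T1.
pose proof (Cmod_triangle (RtoC D) (Ci * RtoC (B + y))) as T2.
pose proof (Cmod_triangle (RtoC D) (Ci * RtoC B)) as T3.
rewrite !Cmod_mult, !Cmod_R, !Cmod_Ci, Cmod_Cexp in *. unfold Re in *; simpl fst in *. rewrite exp_0 in *.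
pose proof (Rabs_triang B y) as T4.
pose proof (Rabs_pos A). pose proof (Rabs_pos B). pose proof (Rabs_pos D). pose proof (Rabs_pos x). pose proof (Rabs_pos y).
assert (X1 : e1 * Rabs x <= e1 * r) by (apply Rmult_le_compat_l; lra).
assert (X2 : e1 * Rabs y <= e1 * r) by (apply Rmult_le_compat_l; lra).
set (S := Cmod (RtoC D + Ci * RtoC (B + y))) in *.
assert (HS : S <= 3 * r) by nra.
assert (0 <= S) by apply Cmod_ge_0.
assert (Rabs x * S <= e1 * (3 * r)) by (apply Rmult_le_compat; lra).
assert (0 <= r) by lra.
nra.
Qed.

Lemma is_Cderive_Cexp z : is_Cderive Cexp z (Cexp z).
Proof.
intros e He.
pose proof (exp_pos (Re z)) as Hp.
destruct (is_Cderive_Cexp_0 (e / exp (Re z))) as [d [Hd H]]. { apply Rdiv_lt_0_compat; assumption. }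
exists d; split; trivial. intros k Hk. specialize (H k Hk).
rewrite Cplus_0_l, Cexp_0 in H.
rewrite Cexp_plus.
replace (Cexp z * Cexp k - Cexp z - k * Cexp z)%C with (Cexp z * (Cexp k - 1 - k * 1))%C by ring.
rewrite Cmod_mult, Cmod_Cexp.
apply Rmult_le_compat_l with (r := exp (Re z)) in H; [|lra].
replace (exp (Re z) * (e / exp (Re z) * Cmod k)) with (e * Cmod k) in H by (field; lra). exact H.
Qed.

Lemma holomorphic_Cexp f : holomorphic f -> holomorphic (fun w => Cexp (f w)).
Proof. intros H. apply (holomorphic_comp Cexp f); trivial. intros z; eexists; apply is_Cderive_Cexp. Qed.

Lemma curve_cont_comp f h : holomorphic f -> curve_cont h -> curve_cont (fun u => f (h u)).
Proof.
intros Hf Hh x e He.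
destruct (Hf (h x)) as [l Hl]. destruct (is_Cderive_lip _ _ _ Hl) as [d [Hd H]].
pose proof (Cmod_ge_0 l).
destruct (Hh x (Rmin d (e / (Cmod l + 1)))) as [r [Hr H1]].
{ apply Rmin_pos; trivial. apply Rdiv_lt_0_compat; lra. }
exists r; split; trivial. intros y Hy. specialize (H1 y Hy).
specialize (H (h y - h x)%C (Rlt_le_trans _ _ _ H1 (Rmin_l _ _))).
replace (h x + (h y - h x))%C with (h y) in H by ring.
apply Rle_lt_trans with (1 := H).
pose proof (Rlt_le_trans _ _ _ H1 (Rmin_r _ _)) as K.
apply Rmult_lt_compat_l with (r := Cmod l + 1) in K; [|lra].
replace ((Cmod l + 1) * (e / (Cmod l + 1))) with e in K by (field; lra). exact K.
Qed.

Lemma curve_cont_Cexp h : curve_cont h -> curve_cont (fun u => Cexp (h u)).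
Proof. apply curve_cont_comp. apply (holomorphic_Cexp (fun w => w)), holomorphic_id. Qed.

(** The exponential minus the first [K] terms of its series.  The recursion makes
    [exp_rem K] the derivative of [exp_rem (S K)]. *)
Fixpoint exp_rem (K : nat) (w : C) : C :=
  match K with
  | O => Cexp w
  | S K => (exp_rem K w - / RtoC (INR (fact K)) * w ^ K)%C
  end.

Lemma is_Cderive_pow n w : is_Cderive (fun w => w ^ S n)%C w (RtoC (INR (S n)) * w ^ n)%C.
Proof.
induction n as [|n IH].
- simpl INR. replace (RtoC 1 * w ^ 0)%C with (1 * 1 + w * 0)%C by (simpl; ring).
  apply (is_Cderive_mult (fun w => w) (fun w => 1%C)); [apply is_Cderive_id|apply is_Cderive_const].
- replace (RtoC (INR (S (S n))) * w ^ S n)%C with (1 * w ^ S n + w * (RtoC (INR (S n)) * w ^ n))%C.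
  + apply (is_Cderive_mult (fun w => w) (fun w => w ^ S n)%C); [apply is_Cderive_id|apply IH].
  + rewrite (S_INR (S n)), RtoC_plus. simpl Cpow. ring.
Qed.

Lemma RtoC_fact_neq_0 n : RtoC (INR (fact n)) <> 0%C.
Proof. intros H. apply (INR_fact_neq_0 n). apply RtoC_inj. exact H. Qed.

Lemma is_Cderive_exp_rem K w : is_Cderive (exp_rem (S K)) w (exp_rem K w).
Proof.
revert w; induction K as [|K IH]; intros w.
- apply is_Cderive_ext with (fun w => Cexp w + (-1))%C. { intros; simpl. field. }
  simpl exp_rem. replace (Cexp w) with (Cexp w + 0)%C by ring.
  apply is_Cderive_plus; [apply is_Cderive_Cexp|apply is_Cderive_const].
- apply is_Cderive_ext with (fun w => exp_rem (S K) w + (- / RtoC (INR (fact (S K)))) * w ^ S K)%C.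
  { intros v. change (exp_rem (S (S K)) v) with (exp_rem (S K) v - / RtoC (INR (fact (S K))) * v ^ S K)%C. ring. }
  change (exp_rem (S K) w) with (exp_rem K w - / RtoC (INR (fact K)) * w ^ K)%C.
  replace (exp_rem K w - / RtoC (INR (fact K)) * w ^ K)%C with
    (exp_rem K w + (0 * w ^ S K + - / RtoC (INR (fact (S K))) * (RtoC (INR (S K)) * w ^ K)))%C.
  + apply is_Cderive_plus; [apply IH|].
    apply (is_Cderive_mult (fun _ => - / RtoC (INR (fact (S K))))%C (fun w => w ^ S K)%C); [apply is_Cderive_const|apply is_Cderive_pow].
  + rewrite fact_simpl, mult_INR, RtoC_mult. field. split.
    * apply RtoC_fact_neq_0.
    * intros H. apply RtoC_inj in H. revert H; apply not_0_INR; lia.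
Qed.

Lemma holomorphic_exp_rem K : holomorphic (exp_rem K).
Proof. destruct K; [apply (holomorphic_Cexp (fun w => w)), holomorphic_id|]. intros z; eexists; apply is_Cderive_exp_rem. Qed.

Lemma exp_rem_0 K : exp_rem (S K) 0 = 0%C.
Proof.
induction K as [|K IH].
- simpl. rewrite Cexp_0. field.
- change (exp_rem (S (S K)) 0) with (exp_rem (S K) 0 - / RtoC (INR (fact (S K))) * 0 ^ S K)%C.
  rewrite IH. simpl Cpow. ring.
Qed.

(** Integrate [exp_rem K] along the segment from [0] to [w]. *)
Lemma exp_rem_le K w : Cmod (exp_rem K w) <= Cmod w ^ K * exp (Cmod w).
Proof.
revert w; induction K as [|K IH]; intros w.
- simpl. rewrite Cmod_Cexp, Rmult_1_l.
  destruct (Re_le_Cmod w) as [H| ->]; [left; apply exp_increasing, H|right; reflexivity].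
- assert (E : exp_rem (S K) w = Cint (fun u => w * exp_rem K (0 + RtoC u * w))%C 0 1).
  { rewrite (Cint_FTC (exp_rem (S K)) (exp_rem K)).
    - replace (0 + RtoC 1 * w)%C with w by ring. replace (0 + RtoC 0 * w)%C with (RtoC 0) by ring.
      rewrite exp_rem_0. ring.
    - apply is_Cderive_exp_rem.
    - apply holomorphic_line, holomorphic_exp_rem. }
  rewrite E. replace (Cmod w ^ S K * exp (Cmod w)) with ((1 - 0) * (Cmod w * (Cmod w ^ K * exp (Cmod w)))) by (simpl; ring).
  apply Cint_le_const; [|lra|].
  + apply curve_cont_mult; [apply curve_cont_const|]. apply holomorphic_line, holomorphic_exp_rem.
  + intros x Hx. rewrite Cmod_mult. apply Rmult_le_compat_l; [apply Cmod_ge_0|].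
    eapply Rle_trans; [apply IH|]. rewrite Cplus_0_l, Cmod_mult, Cmod_R, Rabs_right by lra.
    pose proof (Cmod_ge_0 w).
    apply Rmult_le_compat; [apply pow_le; nra|left; apply exp_pos| |].
    * apply pow_incr. nra.
    * destruct (Rle_lt_or_eq_dec (x * Cmod w) (Cmod w)) as [H1|H1]; [nra|left; now apply exp_increasing|right; now f_equal].
Qed.

Lemma sum_Sn_C (f : nat -> C) n : sum_n f (S n) = (sum_n f n + f (S n))%C.
Proof. exact (sum_Sn f n). Qed.

Lemma exp_rem_sum K w : exp_rem (S K) w =
  (Cexp w - sum_n (fun k => / RtoC (INR (fact k)) * w ^ k)%C K)%C.
Proof.
induction K as [|K IH].
- rewrite sum_O. reflexivity.
- rewrite sum_Sn_C. change (exp_rem (S (S K)) w) with (exp_rem (S K) w - / RtoC (INR (fact (S K))) * w ^ S K)%C.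
  rewrite IH. ring.
Qed.

(** Differentiation under the integral sign: the difference quotient is controlled
    by [exp_rem 2], uniformly on [a, b]. *)
Lemma holomorphic_param g h a b : curve_cont g -> curve_cont h -> a <= b ->
  holomorphic (fun z => Cint (fun u => g u * Cexp (z * h u))%C a b).
Proof.
intros Hg Hh Hab z.
assert (Hi : forall z, curve_cont (fun u => g u * Cexp (z * h u))%C).
{ intros w. apply curve_cont_mult; trivial. apply curve_cont_Cexp, curve_cont_mult; trivial. apply curve_cont_const. }
exists (Cint (fun u => h u * (g u * Cexp (z * h u)))%C a b).
destruct (curve_cont_bounded _ a b (Hi z)) as [M1 [HM1 H1]].
destruct (curve_cont_bounded _ a b Hh) as [M2 [HM2 H2]].
set (M := M1 * (M2 ^ 2 * exp M2) * (b - a)).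
assert (HM : 0 <= M).
{ unfold M. repeat apply Rmult_le_pos; try lra; left; apply exp_pos. }
intros e He. exists (Rmin 1 (e / (M + 1))). split. { apply Rmin_pos; [lra|]. apply Rdiv_lt_0_compat; lra. }
intros k Hk.
pose proof (Rlt_le_trans _ _ _ Hk (Rmin_l _ _)) as K1.
pose proof (Rlt_le_trans _ _ _ Hk (Rmin_r _ _)) as K2.
pose proof (Cmod_ge_0 k) as K0.
rewrite <- Cint_minus by apply Hi.
assert (Hc : curve_cont (fun u => h u * (g u * Cexp (z * h u)))%C) by (apply curve_cont_mult; trivial; apply Hi).
rewrite <- Cint_mult by assumption.
rewrite <- Cint_minus.
2:{ apply curve_cont_minus; apply Hi. } 2:{ apply curve_cont_mult; trivial. apply curve_cont_const. }
assert (Hb : Cmod (Cint (fun u => g u * Cexp ((z + k) * h u) - g u * Cexp (z * h u) - k * (h u * (g u * Cexp (z * h u))))%C a b)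
  <= (b - a) * (M1 * (Cmod k ^ 2 * (M2 ^ 2 * exp M2)))).
{ apply Cint_le_const; trivial.
  - apply curve_cont_minus; [apply curve_cont_minus; apply Hi|]. apply curve_cont_mult; trivial. apply curve_cont_const.
  - intros u Hu. specialize (H1 u Hu). specialize (H2 u Hu).
    replace ((z + k) * h u)%C with (z * h u + k * h u)%C by ring. rewrite Cexp_plus.
    replace (g u * (Cexp (z * h u) * Cexp (k * h u)) - g u * Cexp (z * h u) - k * (h u * (g u * Cexp (z * h u))))%C
     with ((g u * Cexp (z * h u)) * exp_rem 2 (k * h u))%C.
    2:{ simpl. field. }
    rewrite Cmod_mult. apply Rmult_le_compat; try apply Cmod_ge_0; trivial.
    eapply Rle_trans; [apply exp_rem_le|]. rewrite Cmod_mult, Rpow_mult_distr, Rmult_assoc.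
    pose proof (Cmod_ge_0 (h u)).
    apply Rmult_le_compat_l; [apply pow_le; lra|].
    apply Rmult_le_compat; [apply pow_le; lra|left; apply exp_pos|apply pow_incr; lra|].
    assert (L : Cmod k * Cmod (h u) <= M2) by nra.
    destruct L as [L| ->]; [left; now apply exp_increasing|lra]. }
eapply Rle_trans; [exact Hb|].
replace ((b - a) * (M1 * (Cmod k ^ 2 * (M2 ^ 2 * exp M2)))) with (Cmod k * M * Cmod k) by (unfold M; ring).
apply Rmult_le_compat_r; trivial.
apply Rmult_lt_compat_r with (r := M + 1) in K2; [|lra].
replace (e / (M + 1) * (M + 1)) with e in K2 by (field; lra). nra.
Qed.

(** * An identity principle for locally uniform limits *)

Lemma Re_Cint_ge c f a b m : curve_cont f -> a <= b ->
  (forall x, a <= x <= b -> m <= Re (c * f x)%C) -> m * (b - a) <= Re (c * Cint f a b)%C.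
Proof.
intros Hf Hab H. rewrite <- Cint_mult by assumption.
assert (Hc : curve_cont (fun x => c * f x)%C) by (apply curve_cont_mult; trivial; apply curve_cont_const).
pose proof (is_RInt_fct_extend_fst _ _ _ _ (Cint_correct _ a b Hc)) as H1.
rewrite Rmult_comm.
apply (is_RInt_le (fun _ => m) (fun x => Re (c * f x)%C) a b); trivial.
- apply (is_RInt_const (V := R_NormedModule)).
- intros x Hx. apply H. lra.
Qed.

Lemma exp_le x y : x <= y -> exp x <= exp y.
Proof. intros [H| ->]; [left; now apply exp_increasing|lra]. Qed.

Lemma exp_le_1 x : x <= 0 -> exp x <= 1.
Proof. intros H. rewrite <- exp_0. now apply exp_le. Qed.

Lemma exp_ge_1 x : 0 <= x -> 1 <= exp x.
Proof. intros H. rewrite <- exp_0. now apply exp_le. Qed.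

Lemma exp_neg_le t : 0 < t -> exp (- t) <= / t.
Proof.
intros H. rewrite exp_Ropp. apply Rinv_le_contravar; trivial.
pose proof (exp_ineq1 t). lra.
Qed.

(** The members of the sequence close to the limit are within distance [2] of a
    single bounded one. *)
Lemma segment_uniform_bound (f : nat -> R -> C) (g : R -> C) a b :
  (forall n, curve_cont (f n)) ->
  (exists N, forall n u, (N <= n)%nat -> a <= u <= b -> Cmod (f n u - g u)%C <= 1) ->
  exists B N, 0 <= B /\ forall n u, (N <= n)%nat -> a <= u <= b -> Cmod (f n u) <= B.
Proof.
intros Hf [N HN]. destruct (curve_cont_bounded (f N) a b (Hf N)) as [M [HM H]].
exists (M + 2), N; split; [lra|]. intros n u Hn Hu.
pose proof (HN n u Hn Hu) as A. pose proof (HN N u (Nat.le_refl _) Hu) as B.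
specialize (H u Hu).
replace (f n u) with ((f n u - g u) + (f N u + - (f N u - g u)))%C by ring.
eapply Rle_trans; [apply Cmod_triangle|].
pose proof (Cmod_triangle (f N u) (- (f N u - g u))) as T. rewrite Cmod_opp in T. lra.
Qed.

(** Suppose that [H (x0, y0) = c0] is not [0], and integrate [Hn w * exp (- lam (w - (x0, y0))^2)] around the rectangle
    with top side through [(x0, y0)], half-width [L = y0 + 2] and bottom side in
    the lower half-plane.  The total is [0].  For fixed [lam] the bottom
    contributes nothing in the limit, and on the vertical sides the Gaussian is
    at most [e^(- lam)] because [L^2 - (y0 + 1)^2 >= 1].  On the top side it is
    real and concentrates at [x0]: for some [r <= 1] the part over
    [|x - x0| <= r / 2] has modulus at least a constant times
    [e^(- lam r^2 / 4)], and everything else is at most a constant times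
    [e^(- lam r^2)].  For [lam] large this is a contradiction. *)
Lemma unif_limit_zero (Hn : nat -> C -> C) (H : C -> C) :
  (forall n, holomorphic (Hn n)) ->
  (forall rho eps, 0 < eps -> exists N, forall n z, (N <= n)%nat -> Cmod z <= rho ->
      Cmod (Hn n z - H z)%C <= eps) ->
  (forall z, Im z < 0 -> H z = 0%C) ->
  forall z, H z = 0%C.
Proof.
intros HE Hu H0 [x0 y0].
destruct (Rlt_le_dec y0 0) as [Hy|Hy]. { apply H0; exact Hy. }
set (c0 := H (x0, y0)).
destruct (Ceq_dec c0 0) as [E|E]; [exact E|exfalso].
apply Cmod_gt_0 in E. set (eta := Cmod c0) in *.
set (L := y0 + 2).
set (rho := Rabs x0 + L + (y0 + 1)).
assert (Hrho : forall x y, x0 - L <= x <= x0 + L -> -1 <= y <= y0 -> Cmod (x, y) <= rho).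
{ intros x y Hx Hy'. replace ((x, y) : C) with (RtoC x0 + (RtoC (x - x0) + Ci * RtoC y))%C
   by (apply injective_projections; simpl; ring).
  eapply Rle_trans; [apply Cmod_triangle|].
  pose proof (Cmod_triangle (RtoC (x - x0)) (Ci * RtoC y)) as T.
  rewrite Cmod_mult, Cmod_Ci, !Cmod_R in *.
  assert (Rabs (x - x0) <= L) by (apply Rabs_le; lra).
  assert (Rabs y <= y0 + 1) by (apply Rabs_le; lra). unfold rho; lra. }
(* Bounds on the top and vertical sides that hold for all large n. *)
destruct (Hu rho 1) as [N1 HN1]; [lra|].
destruct (segment_uniform_bound (fun n x => Hn n (x, y0)) (fun x => H (x, y0)) (x0 - L) (x0 + L)) as [B1 [M1 [HB1 Hb1]]].
{ intros; now apply holomorphic_hor. }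
{ exists N1. intros. apply HN1; trivial. apply Hrho; lra. }
destruct (segment_uniform_bound (fun n y => Hn n (x0 - L, y)) (fun y => H (x0 - L, y)) (-1) y0) as [B2 [M2 [HB2 Hb2]]].
{ intros; now apply holomorphic_ver. }
{ exists N1. intros. apply HN1; trivial. apply Hrho; unfold L; lra. }
destruct (segment_uniform_bound (fun n y => Hn n (x0 + L, y)) (fun y => H (x0 + L, y)) (-1) y0) as [B3 [M3 [HB3 Hb3]]].
{ intros; now apply holomorphic_ver. }
{ exists N1. intros. apply HN1; trivial. apply Hrho; unfold L; lra. }
(* On the top side, within distance r of x0, Hn differs from c0 by at most eta / 2. *)
destruct (Hu rho (eta / 8)) as [N2 HN2]; [lra|].
destruct (holomorphic_hor (Hn N2) y0 (HE N2) x0 (eta / 8)) as [r' [Hr' Hcont]]; [lra|].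
set (r := Rmin (r' / 2) 1).
assert (Hr : 0 < r) by (apply Rmin_pos; lra).
assert (Hr1 : r <= 1) by apply Rmin_r.
assert (Hr2 : r < r') by (unfold r; pose proof (Rmin_l (r' / 2) 1); lra).
assert (Hnear : forall n x, (N2 <= n)%nat -> Rabs (x - x0) <= r -> Cmod (Hn n (x, y0) - c0)%C <= eta / 2).
{ intros n x Hn' Hx. pose proof (proj1 (Rabs_le_between _ _) Hx) as Hx'.
  assert (Z1 : Cmod (x, y0) <= rho) by (apply Hrho; unfold L; lra).
  assert (Z0 : Cmod (x0, y0) <= rho) by (apply Hrho; unfold L; lra).
  pose proof (HN2 n _ Hn' Z1) as A1. pose proof (HN2 N2 _ (Nat.le_refl _) Z1) as A2.
  pose proof (HN2 N2 _ (Nat.le_refl _) Z0) as A3.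
  specialize (Hcont x ltac:(lra)). fold c0 in A3.
  replace (Hn n (x, y0) - c0)%C with ((Hn n (x, y0) - H (x, y0)) + (- (Hn N2 (x, y0) - H (x, y0)) +
     ((Hn N2 (x, y0) - Hn N2 (x0, y0)) + (Hn N2 (x0, y0) - c0))))%C by ring.
  eapply Rle_trans; [apply Cmod_triangle|].
  eapply Rle_trans; [apply Rplus_le_compat_l, Cmod_triangle|].
  eapply Rle_trans; [apply Rplus_le_compat_l, Rplus_le_compat_l, Cmod_triangle|].
  rewrite Cmod_opp. lra. }
(* K2 collects all error terms, each multiplied by exp (- lam r^2), and [a] is the
   gain, multiplied by exp (- lam r^2 / 4); lam is chosen so that the quotient of
   the two exponentials is exp (- s) <= a / (K2 + 1). *)
assert (Ec : Cmod (Cconj c0) = eta). { unfold eta, Cmod, Cconj; simpl. f_equal. ring. }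
set (K2 := eta * (2 * L * B1 + 2 * L + (y0 + 1) * (B2 + B3))).
set (a := r * (eta * eta / 2)).
assert (Ha : 0 < a) by (unfold a; repeat apply Rmult_lt_0_compat; lra).
assert (HL : 2 <= L) by (unfold L; lra).
assert (HK2 : 0 <= K2).
{ unfold K2. apply Rmult_le_pos; [lra|].
  assert (0 <= L * B1) by (apply Rmult_le_pos; lra).
  assert (0 <= (y0 + 1) * (B2 + B3)) by (apply Rmult_le_pos; lra). lra. }
set (s := (K2 + 1) / a).
assert (Hs : 0 < s) by (apply Rdiv_lt_0_compat; lra).
set (lam := 4 / (3 * (r * r)) * s).
assert (Hlam : 0 < lam) by (apply Rmult_lt_0_compat; trivial; apply Rdiv_lt_0_compat; nra).
assert (Hls : lam * (r * r) - lam * (r * r / 4) = s) by (unfold lam; field; lra).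
set (w0 := exp (- (lam * (r * r)))).
assert (Hw0 : 0 < w0) by apply exp_pos.
set (eps := w0 * exp (- (lam * ((y0 + 1) * (y0 + 1))))).
assert (Heps : 0 < eps) by (apply Rmult_lt_0_compat; apply exp_pos).
destruct (Hu rho eps Heps) as [N3 HN3].
set (n := (N2 + M1 + M2 + M3 + N3)%nat).
set (G := fun w : C => Cexp (RtoC (- lam) * ((w - (x0, y0)) * (w - (x0, y0))))%C).
assert (HG : holomorphic G).
{ apply holomorphic_Cexp. apply holomorphic_mult; [apply holomorphic_const|].
  assert (holomorphic (fun w => w - (x0, y0))%C) by (apply holomorphic_minus; [apply holomorphic_id|apply holomorphic_const]).
  apply holomorphic_mult; assumption. }
assert (HGm : forall x y, Cmod (G (x, y)) = exp (- lam * ((x - x0) * (x - x0) - (y - y0) * (y - y0)))).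
{ intros x y. unfold G. rewrite Cmod_Cexp. f_equal. unfold Re; simpl. ring. }
assert (HGt : forall x, G (x, y0) = RtoC (exp (- lam * ((x - x0) * (x - x0))))).
{ intros x. unfold G, Cexp, Re, Im, RtoC; simpl. apply injective_projections; simpl.
  - replace (cos _) with 1. { rewrite Rmult_1_r. f_equal. ring. } symmetry. transitivity (cos 0); [f_equal; ring|apply cos_0].
  - replace (sin _) with 0. { ring. } symmetry. transitivity (sin 0); [f_equal; ring|apply sin_0]. }
set (f := fun w => (Hn n w * G w)%C).
assert (Hf : holomorphic f) by (apply holomorphic_mult; [apply HE|exact HG]).
pose proof (goursat f (x0 - L) (x0 + L) (-1) y0 Hf ltac:(lra) ltac:(lra)) as HGo.
unfold boundary_int in HGo.
set (bot := Cint (fun x => f (x, -1)) (x0 - L) (x0 + L)) in HGo.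
set (rig := Cint (fun y => f (x0 + L, y)) (-1) y0) in HGo.
set (top := Cint (fun x => f (x, y0)) (x0 - L) (x0 + L)) in HGo.
set (lef := Cint (fun y => f (x0 - L, y)) (-1) y0) in HGo.
assert (Etop : top = (bot + Ci * rig - Ci * lef)%C).
{ transitivity (top + 0)%C; [ring|]. rewrite <- HGo. ring. }
assert (Hside : forall x y, (x - x0) * (x - x0) = L * L -> -1 <= y <= y0 -> Cmod (G (x, y)) <= w0).
{ intros x y Hx Hy'. rewrite HGm, Hx. apply exp_le.
  assert ((y - y0) * (y - y0) <= (y0 + 1) * (y0 + 1)) by nra.
  assert (1 <= L * L - (y - y0) * (y - y0)) by (unfold L in *; nra).
  assert (r * r <= 1) by nra.
  assert (lam * (r * r) <= lam * (L * L - (y - y0) * (y - y0))) by (apply Rmult_le_compat_l; lra). lra. }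
assert (Brig : Cmod rig <= (y0 - -1) * (B3 * w0)).
{ apply Cint_le_const; [now apply holomorphic_ver|lra|]. intros y Hy'. unfold f. rewrite Cmod_mult.
  apply Rmult_le_compat; try apply Cmod_ge_0; [apply Hb3; trivial; unfold n; lia|].
  apply Hside; trivial. ring. }
assert (Blef : Cmod lef <= (y0 - -1) * (B2 * w0)).
{ apply Cint_le_const; [now apply holomorphic_ver|lra|]. intros y Hy'. unfold f. rewrite Cmod_mult.
  apply Rmult_le_compat; try apply Cmod_ge_0; [apply Hb2; trivial; unfold n; lia|].
  apply Hside; trivial. ring. }
assert (Bbot : Cmod bot <= (x0 + L - (x0 - L)) * w0).
{ apply Cint_le_const; [now apply holomorphic_hor|lra|]. intros x Hx. unfold f. rewrite Cmod_mult.
  assert (A1 : Cmod (Hn n (x, -1)) <= eps).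
  { assert (Z : H (x, -1) = 0%C) by (apply H0; simpl; lra).
    replace (Hn n (x, -1)) with (Hn n (x, -1) - H (x, -1))%C by (rewrite Z; ring).
    apply HN3; [unfold n; lia|]. apply Hrho; lra. }
  assert (A2 : Cmod (G (x, -1)) <= exp (lam * ((y0 + 1) * (y0 + 1)))).
  { rewrite HGm. apply exp_le. assert (0 <= lam * ((x - x0) * (x - x0))) by (apply Rmult_le_pos; [lra|apply Rle_0_sqr]). lra. }
  apply Rle_trans with (eps * exp (lam * ((y0 + 1) * (y0 + 1)))).
  { apply Rmult_le_compat; try apply Cmod_ge_0; assumption. }
  unfold eps. rewrite Rmult_assoc, <- exp_plus, Rplus_opp_l, exp_0. lra. }
assert (Btop : Cmod top <= (2 * L + (y0 + 1) * (B2 + B3)) * w0).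
{ rewrite Etop. unfold Cminus. eapply Rle_trans; [apply Cmod_triangle|].
  pose proof (Cmod_triangle bot (Ci * rig)) as T.
  rewrite Cmod_opp, !Cmod_mult, !Cmod_Ci in *. lra. }
assert (Hupper : Re (Cconj c0 * top)%C <= eta * ((2 * L + (y0 + 1) * (B2 + B3)) * w0)).
{ eapply Rle_trans; [apply Re_le_Cmod|]. rewrite Cmod_mult.
  rewrite Ec. apply Rmult_le_compat_l; lra. }
assert (Hpt : forall x, f (x, y0) = (RtoC (exp (- lam * ((x - x0) * (x - x0)))) * Hn n (x, y0))%C).
{ intros x. unfold f. rewrite HGt. ring. }
assert (Hre : forall x, Re (Cconj c0 * f (x, y0))%C =
   exp (- lam * ((x - x0) * (x - x0))) * Re (Cconj c0 * Hn n (x, y0))%C).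
{ intros x. rewrite Hpt. unfold Re; simpl. ring. }
assert (Hnr : forall x, Rabs (x - x0) <= r -> eta * eta / 2 <= Re (Cconj c0 * Hn n (x, y0))%C).
{ intros x Hx. pose proof (Hnear n x ltac:(unfold n; lia) Hx) as A.
  assert (Ee : eta * eta = fst c0 * fst c0 + snd c0 * snd c0).
  { unfold eta, Cmod. rewrite sqrt_sqrt; [ring|]. nra. }
  replace (Re (Cconj c0 * Hn n (x, y0))%C) with (eta * eta - Re (Cconj c0 * - (Hn n (x, y0) - c0))%C).
  2:{ rewrite Ee. unfold Re; simpl. ring. }
  assert (Re (Cconj c0 * - (Hn n (x, y0) - c0))%C <= eta * (eta / 2)).
  { eapply Rle_trans; [apply Re_le_Cmod|]. rewrite Cmod_mult, Cmod_opp.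
      rewrite Ec. apply Rmult_le_compat_l; lra. }
  lra. }
assert (Hout : forall x, x0 - L <= x <= x0 + L -> - (eta * B1 * w0) <= Re (Cconj c0 * f (x, y0))%C).
{ intros x Hx. rewrite Hre. pose proof (exp_pos (- lam * ((x - x0) * (x - x0)))) as Hp.
  assert (0 <= eta * B1) by nra.
  destruct (Rle_dec (Rabs (x - x0)) r) as [D|D].
  - specialize (Hnr x D). assert (0 <= eta * eta / 2) by nra. 
    assert (0 <= eta * B1 * w0) by nra.
    assert (0 <= exp (- lam * ((x - x0) * (x - x0))) * Re (Cconj c0 * Hn n (x, y0))%C) by (apply Rmult_le_pos; lra).
    lra.
  - assert (Hq : exp (- lam * ((x - x0) * (x - x0))) <= w0).
    { apply exp_le. assert (r * r <= (x - x0) * (x - x0)).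
      { pose proof (Rsqr_abs (x - x0)) as Q. unfold Rsqr in Q. rewrite Q. apply Rnot_le_lt in D. nra. }
      assert (lam * (r * r) <= lam * ((x - x0) * (x - x0))) by (apply Rmult_le_compat_l; lra). lra. }
    assert (Hr3 : Rabs (Re (Cconj c0 * Hn n (x, y0))%C) <= eta * B1).
    { eapply Rle_trans; [apply fst_le_Cmod|]. rewrite Cmod_mult.
          rewrite Ec. apply Rmult_le_compat_l; [lra|]. apply Hb1; trivial. unfold n; lia. }
    apply Rabs_le_between in Hr3.
    assert (- (eta * B1) * exp (- lam * ((x - x0) * (x - x0))) <=
       exp (- lam * ((x - x0) * (x - x0))) * Re (Cconj c0 * Hn n (x, y0))%C) by nra.
    assert (eta * B1 * exp (- lam * ((x - x0) * (x - x0))) <= eta * B1 * w0) by (apply Rmult_le_compat_l; lra).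
    lra. }
set (w1 := exp (- (lam * (r * r / 4)))).
assert (Hw1 : 0 < w1) by apply exp_pos.
assert (Hmid : forall x, x0 - r / 2 <= x <= x0 + r / 2 -> eta * eta / 2 * w1 <= Re (Cconj c0 * f (x, y0))%C).
{ intros x Hx. rewrite Hre.
  assert (D : Rabs (x - x0) <= r) by (apply Rabs_le; lra). specialize (Hnr x D).
  assert (w1 <= exp (- lam * ((x - x0) * (x - x0)))).
  { apply exp_le. assert ((x - x0) * (x - x0) <= r * r / 4) by nra.
    assert (lam * ((x - x0) * (x - x0)) <= lam * (r * r / 4)) by (apply Rmult_le_compat_l; lra). lra. }
  rewrite Rmult_comm. apply Rmult_le_compat; nra. }
assert (Hc : curve_cont (fun x => f (x, y0))) by now apply holomorphic_hor.
assert (Hlower : a * w1 - 2 * L * (eta * B1 * w0) <= Re (Cconj c0 * top)%C).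
{ unfold top. rewrite <- (Cint_Chasles _ (x0 - L) (x0 - r / 2) (x0 + L) Hc).
  rewrite <- (Cint_Chasles _ (x0 - r / 2) (x0 + r / 2) (x0 + L) Hc).
  pose proof (Re_Cint_ge (Cconj c0) (fun x => f (x, y0)) (x0 - L) (x0 - r / 2) (- (eta * B1 * w0)) Hc ltac:(lra)
     ltac:(intros; apply Hout; lra)) as I1.
  pose proof (Re_Cint_ge (Cconj c0) (fun x => f (x, y0)) (x0 - r / 2) (x0 + r / 2) (eta * eta / 2 * w1) Hc ltac:(lra)
     ltac:(intros; apply Hmid; lra)) as I2.
  pose proof (Re_Cint_ge (Cconj c0) (fun x => f (x, y0)) (x0 + r / 2) (x0 + L) (- (eta * B1 * w0)) Hc ltac:(lra)
     ltac:(intros; apply Hout; lra)) as I3.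
  rewrite !Cmult_plus_distr_l. unfold Re in *. simpl fst in *.
  assert (0 <= eta * B1 * w0) by (repeat apply Rmult_le_pos; lra).
  unfold a. nra. }
assert (Hfin : a * w1 <= K2 * w0) by (unfold K2; lra).
assert (Hw : w0 = w1 * exp (- s)).
{ unfold w0, w1. rewrite <- exp_plus. f_equal. lra. }
rewrite Hw in Hfin.
assert (Hfin2 : a <= K2 * exp (- s)).
{ apply Rmult_le_reg_r with w1; lra. }
pose proof (exp_neg_le s Hs) as He.
assert (Ei : / s = a / (K2 + 1)) by (unfold s; field; lra).
rewrite Ei in He.
assert (K2 * exp (- s) <= K2 * (a / (K2 + 1))) by (apply Rmult_le_compat_l; lra).
assert (a / (K2 + 1) * (K2 + 1) = a) by (field; lra).
assert (0 < a / (K2 + 1)) by (apply Rdiv_lt_0_compat; lra).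
lra.
Qed.

(** * The contour representation and its truncations *)

Definition double_sum (B : nat) (f : nat -> nat -> C) : C := sum_n (fun m => sum_n (f m) B) B.

Lemma sum_n_plus_C f g n : sum_n (fun k => f k + g k)%C n = (sum_n f n + sum_n g n)%C.
Proof. exact (sum_n_plus f g n). Qed.

Lemma sum_n_mult_C c f n : sum_n (fun k => c * f k)%C n = (c * sum_n f n)%C.
Proof. exact (sum_n_mult_l (K := C_Ring) c f n). Qed.

Lemma sum_n_ext_C (f g : nat -> C) n : (forall k, f k = g k) -> sum_n f n = sum_n g n.
Proof. intros; apply sum_n_ext; assumption. Qed.

Lemma double_sum_ext B f g : (forall m n, f m n = g m n) -> double_sum B f = double_sum B g.
Proof. intros H. apply sum_n_ext_C; intros m. apply sum_n_ext_C; intros n. apply H. Qed.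

Lemma double_sum_plus B f g : double_sum B (fun m n => f m n + g m n)%C = (double_sum B f + double_sum B g)%C.
Proof.
unfold double_sum. rewrite <- sum_n_plus_C. apply sum_n_ext_C; intros m. apply sum_n_plus_C.
Qed.

Lemma double_sum_mult B c f : double_sum B (fun m n => c * f m n)%C = (c * double_sum B f)%C.
Proof.
unfold double_sum. rewrite <- sum_n_mult_C. apply sum_n_ext_C; intros m. apply sum_n_mult_C.
Qed.

Lemma double_sum_prod B f g : double_sum B (fun m n => f n * g m)%C = (sum_n f B * sum_n g B)%C.
Proof.
unfold double_sum. rewrite <- sum_n_mult_C. apply sum_n_ext_C; intros m.
rewrite Cmult_comm, <- sum_n_mult_C. apply sum_n_ext_C; intros; ring.
Qed.

(** Continuity, holomorphy, boundedness and convergence to [0] all pass to double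
    sums by the same induction. *)
Lemma double_sum_closed {T : Type} (P : (T -> C) -> Prop) B (f : nat -> nat -> T -> C) :
  (forall g h, P g -> P h -> P (fun t => g t + h t)%C) ->
  (forall g h, (forall t, g t = h t) -> P g -> P h) ->
  (forall m n, P (f m n)) -> P (fun t => double_sum B (fun m n => f m n t)).
Proof.
intros Hp He Hf.
assert (Hs : forall (g : nat -> T -> C) k, (forall n, P (g n)) -> P (fun t => sum_n (fun n => g n t) k)).
{ intros g k Hg. induction k as [|k IH].
  - apply (He (g O)); [|apply Hg]. intros; now rewrite sum_O.
  - apply (He (fun t => sum_n (fun n => g n t) k + g (S k) t)%C).
    + intros; now rewrite sum_Sn_C.
    + apply Hp; auto. }
unfold double_sum. apply (Hs (fun m t => sum_n (fun n => f m n t) B)).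
intros m. apply (Hs (f m)). auto.
Qed.

Lemma curve_cont_ext f g : (forall x, f x = g x) -> curve_cont f -> curve_cont g.
Proof. intros E H x e He. destruct (H x e He) as [d [Hd H1]]. exists d; split; trivial. intros. rewrite <- !E. auto. Qed.

Lemma curve_cont_double_sum B f : (forall m n, curve_cont (f m n)) -> curve_cont (fun u => double_sum B (fun m n => f m n u)).
Proof. apply double_sum_closed; [apply curve_cont_plus|apply curve_cont_ext]. Qed.

Lemma holomorphic_double_sum B f : (forall m n, holomorphic (f m n)) -> holomorphic (fun u => double_sum B (fun m n => f m n u)).
Proof. apply double_sum_closed; [apply holomorphic_plus|apply holomorphic_ext]. Qed.

Lemma Cint_double_sum B (f : nat -> nat -> R -> C) a b : (forall m n, curve_cont (f m n)) ->
  Cint (fun u => double_sum B (fun m n => f m n u)) a b = double_sum B (fun m n => Cint (f m n) a b).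
Proof.
intros H.
assert (Hs : forall (g : nat -> R -> C) k, (forall n, curve_cont (g n)) ->
   curve_cont (fun t => sum_n (fun n => g n t) k) /\
   Cint (fun t => sum_n (fun n => g n t) k) a b = sum_n (fun n => Cint (g n) a b) k).
{ intros g k Hg. induction k as [|k [IH1 IH2]].
  - split.
    + apply (curve_cont_ext (g O)); [|apply Hg]. intros; now rewrite sum_O.
    + rewrite sum_O. apply Cint_ext. intros; now rewrite sum_O.
  - split.
    + apply (curve_cont_ext (fun t => sum_n (fun n => g n t) k + g (S k) t)%C).
      * intros; now rewrite sum_Sn_C.
      * apply curve_cont_plus; auto.
    + rewrite sum_Sn_C, <- IH2, <- Cint_plus by auto. apply Cint_ext. intros; now rewrite sum_Sn_C. }
unfold double_sum. destruct (Hs (fun m t => sum_n (fun n => f m n t) B) B) as [_ E].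
{ intros m. apply (Hs (f m)). auto. }
rewrite E. apply sum_n_ext_C. intros m. apply (Hs (f m)). auto.
Qed.

(** [t^(beta + 1) e^(i t^alpha - i z t)] at [t = e^w], where the extra power
    of [t] comes from [dt = t dw]. *)
Definition integrand (alpha : R) (beta z w : C) : C :=
  Cexp ((beta + 1) * w + Ci * Cexp (RtoC alpha * w) - Ci * z * Cexp w)%C.

Lemma holomorphic_integrand alpha beta z : holomorphic (integrand alpha beta z).
Proof.
apply holomorphic_Cexp. apply holomorphic_minus; [apply holomorphic_plus|].
- apply holomorphic_mult; [apply holomorphic_const|apply holomorphic_id].
- apply holomorphic_mult; [apply holomorphic_const|]. apply holomorphic_Cexp, holomorphic_mult; [apply holomorphic_const|apply holomorphic_id].
- apply holomorphic_mult; [apply holomorphic_const|]. apply (holomorphic_Cexp (fun w => w)), holomorphic_id.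
Qed.

(** The exponent is the real part of the one in [integrand]; every estimate below
    is an estimate of this real exponent. *)
Lemma Cmod_integrand alpha beta z u phi :
  Cmod (integrand alpha beta z (u, phi)) =
  exp ((Re beta + 1) * u - Im beta * phi - exp (alpha * u) * sin (alpha * phi)
       + exp u * (Re z * sin phi + Im z * cos phi)).
Proof.
unfold integrand. rewrite Cmod_Cexp. f_equal.
unfold Cexp, Re, Im; simpl.
replace (alpha * u - 0 * phi) with (alpha * u) by ring.
replace (alpha * phi + 0 * u) with (alpha * phi) by ring. ring.
Qed.

(** The path goes from [p] to [U] on the real line, up to height
    [PI / (2 alpha)], and on to real part [q]. *)
Definition contour (alpha : R) (beta z : C) (p U q : R) : C :=
  (Cint (fun u => integrand alpha beta z (u, 0%R)) p U
   + Ci * Cint (fun phi => integrand alpha beta z (U, phi)) 0 (PI / (2 * alpha))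
   + Cint (fun u => integrand alpha beta z (u, PI / (2 * alpha))%R) U q)%C.

Lemma theta_pos alpha : 1 < alpha -> 0 < PI / (2 * alpha) < PI / 2.
Proof.
intros H. pose proof PI_RGT_0. split; [apply Rdiv_lt_0_compat; lra|].
apply Rmult_lt_compat_l; trivial. apply Rinv_lt_contravar; nra.
Qed.

(** Two such paths differ by the boundary of a rectangle. *)
Lemma contour_indep alpha beta z p U U' q : 1 < alpha ->
  contour alpha beta z p U q = contour alpha beta z p U' q.
Proof.
intros Ha.
assert (H : forall U U', U <= U' -> contour alpha beta z p U q = contour alpha beta z p U' q).
{ clear U U'; intros U U' HU. unfold contour. set (th := PI / (2 * alpha)).
  pose proof (holomorphic_integrand alpha beta z) as HE.
  assert (Hth : 0 <= th) by (unfold th; destruct (theta_pos alpha Ha); lra).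
  pose proof (goursat _ U U' 0 th HE HU Hth) as G. unfold boundary_int in G.
  rewrite <- (Cint_Chasles (fun u => integrand alpha beta z (u, 0)) p U U') by now apply holomorphic_hor.
  rewrite <- (Cint_Chasles (fun u => integrand alpha beta z (u, th)) U U' q) by now apply holomorphic_hor.
  set (A := Cint (fun u => integrand alpha beta z (u, 0)) U U') in *.
  set (A' := Cint (fun u => integrand alpha beta z (u, 0)) p U) in *.
  set (V := Cint (fun u => integrand alpha beta z (U, u)) 0 th) in *.
  set (V' := Cint (fun u => integrand alpha beta z (U', u)) 0 th) in *.
  set (D := Cint (fun u => integrand alpha beta z (u, th)) U U') in *.
  set (D' := Cint (fun u => integrand alpha beta z (u, th)) U' q) in *.
  replace (A' + Ci * V + (D + D'))%C with (A' + A + Ci * V' + D' - (A + Ci * V' - D - Ci * V))%C by ring.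
  rewrite G. ring. }
destruct (Rle_lt_dec U U'); [auto|symmetry; apply H; lra].
Qed.

Definition fp_exponent (alpha : R) (beta : C) (m n : nat) : C :=
  (beta + (INR n * alpha)%R + INR m + 1)%C.

(** A primitive of [e^(s u)], normalized so that for [s <> 0] it has no constant
    term; this is the normalization of the Hadamard finite part. *)
Definition power_primitive (s : C) (u : R) : C :=
  if Ceq_dec s 0 then RtoC u else (Cexp (s * u) / s)%C.

Definition singular_part (alpha : R) (beta z : C) (p : R) : C :=
  double_sum (fp_bound beta) (fun m n => fp_coef z m n * power_primitive (fp_exponent alpha beta m n) p)%C.

(** The finite part of the contour integral, with the contour cut off at real
    parts [- N] and [N]. *)
Definition approx (alpha : R) (beta z : C) (N : nat) : C :=
  (singular_part alpha beta z (- INR N) + contour alpha beta z (- INR N) 0 (INR N))%C.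

Lemma holomorphic_pow f n : holomorphic f -> holomorphic (fun z => f z ^ n)%C.
Proof.
intros H. induction n as [|n IH]; simpl; [apply holomorphic_const|]. apply holomorphic_mult; assumption.
Qed.

Lemma holomorphic_fp_coef m n : holomorphic (fun z => fp_coef z m n).
Proof.
unfold fp_coef, Cdiv. apply holomorphic_mult; [|apply holomorphic_const].
apply holomorphic_mult; [apply holomorphic_const|]. apply holomorphic_pow. apply holomorphic_mult; [apply holomorphic_const|apply holomorphic_id].
Qed.

Lemma holomorphic_singular_part alpha beta p : holomorphic (fun z => singular_part alpha beta z p).
Proof.
apply (holomorphic_double_sum _ (fun m n z => fp_coef z m n * power_primitive (fp_exponent alpha beta m n) p)%C).
intros. apply holomorphic_mult; [apply holomorphic_fp_coef|apply holomorphic_const].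
Qed.

Lemma holomorphic_integral_z alpha beta (w : R -> C) a b : curve_cont w -> a <= b ->
  holomorphic (fun z => Cint (fun u => integrand alpha beta z (w u)) a b).
Proof.
intros Hw Hab.
apply holomorphic_ext with (fun z => Cint (fun u => Cexp ((beta + 1) * w u + Ci * Cexp (RtoC alpha * w u)) * Cexp (z * (- Ci * Cexp (w u))))%C a b).
{ intros z. apply Cint_ext. intros u _. unfold integrand. rewrite <- Cexp_plus. f_equal. ring. }
apply holomorphic_param; trivial.
- apply curve_cont_Cexp, curve_cont_plus; apply curve_cont_mult; trivial; try apply curve_cont_const.
  apply curve_cont_Cexp, curve_cont_mult; trivial; apply curve_cont_const.
- apply curve_cont_mult; [apply curve_cont_const|]. apply curve_cont_Cexp; trivial.
Qed.

Lemma holomorphic_approx alpha beta N : 1 < alpha -> holomorphic (fun z => approx alpha beta z N).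
Proof.
intros Ha. pose proof (theta_pos alpha Ha). pose proof (pos_INR N).
apply holomorphic_plus; [apply holomorphic_singular_part|].
apply holomorphic_plus; [apply holomorphic_plus|].
- apply (holomorphic_integral_z alpha beta (fun u => (u, 0))); [|lra]. apply (holomorphic_hor (fun w => w)), holomorphic_id.
- apply holomorphic_mult; [apply holomorphic_const|].
  apply (holomorphic_integral_z alpha beta (fun u => (0, u))); [|lra]. apply (holomorphic_ver (fun w => w)), holomorphic_id.
- apply (holomorphic_integral_z alpha beta (fun u => (u, PI / (2 * alpha)))); [|lra]. apply (holomorphic_hor (fun w => w)), holomorphic_id.
Qed.

Lemma is_Cderive_Cexp_scal s w : is_Cderive (fun w => Cexp (s * w))%C w (s * Cexp (s * w))%C.
Proof.
apply (is_Cderive_comp Cexp (fun w => s * w)%C); [|apply is_Cderive_Cexp].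
assert (H : is_Cderive (fun w => s * w)%C w (0 * w + s * 1)%C)
  by (apply (is_Cderive_mult (fun _ => s) (fun w => w)); [apply is_Cderive_const|apply is_Cderive_id]).
replace (0 * w + s * 1)%C with s in H by ring. exact H.
Qed.

Lemma curve_cont_Cexp_scal s : curve_cont (fun u => Cexp (s * RtoC u)).
Proof.
apply (curve_cont_ext (fun u => Cexp (s * (0 + RtoC u * 1)))%C). { intros; do 2 f_equal; ring. }
apply (holomorphic_line (fun w => Cexp (s * w))). apply holomorphic_Cexp, holomorphic_mult; [apply holomorphic_const|apply holomorphic_id].
Qed.

Lemma Cint_power s p q : Cint (fun u => Cexp (s * RtoC u)) p q = (power_primitive s q - power_primitive s p)%C.
Proof.
unfold power_primitive. destruct (Ceq_dec s 0) as [->|Hs].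
- rewrite (Cint_ext _ (fun _ => RtoC 1)).
  + rewrite Cint_const, RtoC_minus. ring.
  + intros. rewrite Cmult_0_l. apply Cexp_0.
- assert (H : (s * Cint (fun u => Cexp (s * RtoC u)) p q)%C = (Cexp (s * q) - Cexp (s * p))%C).
  { rewrite <- Cint_mult by apply curve_cont_Cexp_scal.
    transitivity (Cint (fun u => 1 * (s * Cexp (s * (0 + RtoC u * 1))))%C p q).
    { apply Cint_ext. intros. rewrite Cmult_1_l. do 3 f_equal; ring. }
    rewrite (Cint_FTC (fun w => Cexp (s * w))%C (fun w => s * Cexp (s * w))%C).
    - f_equal; [|f_equal]; do 2 f_equal; ring.
    - apply is_Cderive_Cexp_scal.
    - apply (holomorphic_line (fun w => s * Cexp (s * w))%C). apply holomorphic_mult; [apply holomorphic_const|].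
      apply holomorphic_Cexp, holomorphic_mult; [apply holomorphic_const|apply holomorphic_id]. }
  replace (Cint (fun u => Cexp (s * RtoC u)) p q) with (s * Cint (fun u => Cexp (s * RtoC u)) p q / s)%C by (field; trivial).
  rewrite H. field; trivial.
Qed.

(** The integrand minus the terms whose primitives make up [singular_part].  All
    pairs [m, n <= fp_bound beta] are subtracted, which makes the sum a product
    of two exponential polynomials; the terms beyond the finite-part range have
    exponents with positive real part and vanish at minus infinity. *)
Definition regular (alpha : R) (beta z : C) (u : R) : C :=
  (integrand alpha beta z (u, 0%R)
   - double_sum (fp_bound beta) (fun m n => fp_coef z m n * Cexp (fp_exponent alpha beta m n * RtoC u)))%C.

Lemma curve_cont_regular alpha beta z : curve_cont (regular alpha beta z).
Proof.
apply curve_cont_minus; [apply holomorphic_hor, holomorphic_integrand|].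
apply (curve_cont_double_sum _ (fun m n u => fp_coef z m n * Cexp (fp_exponent alpha beta m n * RtoC u))%C).
intros. apply curve_cont_mult; [apply curve_cont_const|apply curve_cont_Cexp_scal].
Qed.

(** The terms of [singular_part] are primitives of the terms that [regular]
    subtracts, so moving the cut costs only an integral of [regular]. *)
Lemma singular_shift alpha beta z p q :
  (singular_part alpha beta z p + Cint (fun u => integrand alpha beta z (u, 0%R)) p q =
   singular_part alpha beta z q + Cint (regular alpha beta z) p q)%C.
Proof.
unfold regular. rewrite Cint_minus.
- rewrite (Cint_double_sum _ (fun m n u => fp_coef z m n * Cexp (fp_exponent alpha beta m n * RtoC u))%C).
  2:{ intros. apply curve_cont_mult; [apply curve_cont_const|apply curve_cont_Cexp_scal]. }
  unfold singular_part.
  rewrite (double_sum_ext _ (fun m n => Cint (fun u => fp_coef z m n * Cexp (fp_exponent alpha beta m n * RtoC u))%C p q)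
    (fun m n => fp_coef z m n * power_primitive (fp_exponent alpha beta m n) q + (-1) * (fp_coef z m n * power_primitive (fp_exponent alpha beta m n) p))%C).
  + rewrite double_sum_plus, double_sum_mult. ring.
  + intros. rewrite Cint_mult by apply curve_cont_Cexp_scal. rewrite Cint_power. ring.
- apply holomorphic_hor, holomorphic_integrand.
- apply (curve_cont_double_sum _ (fun m n u => fp_coef z m n * Cexp (fp_exponent alpha beta m n * RtoC u))%C).
  intros. apply curve_cont_mult; [apply curve_cont_const|apply curve_cont_Cexp_scal].
Qed.

Lemma Cexp_nat_mult n w : Cexp (RtoC (INR n) * w) = (Cexp w ^ n)%C.
Proof.
induction n as [|n IH].
- simpl. rewrite Cmult_0_l. apply Cexp_0.
- rewrite S_INR, RtoC_plus. simpl Cpow. rewrite <- IH, <- Cexp_plus. f_equal. ring.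
Qed.

Lemma Cexp_RtoC r : Cexp (RtoC r) = RtoC (exp r).
Proof.
unfold Cexp, RtoC, Re, Im; simpl. rewrite cos_0, sin_0. f_equal; ring.
Qed.

(** With [E] the truncated exponential series and [r] its remainder,
    [e^a e^b - E(a) E(b) = r(a) e^b + e^a r(b) - r(a) r(b)]. *)
Lemma regular_factor alpha beta z u :
  regular alpha beta z u =
  (Cexp ((beta + 1) * RtoC u) *
   (exp_rem (S (fp_bound beta)) (Ci * RtoC (exp (alpha * u))) * Cexp (- Ci * z * RtoC (exp u))
    + Cexp (Ci * RtoC (exp (alpha * u))) * exp_rem (S (fp_bound beta)) (- Ci * z * RtoC (exp u))
    - exp_rem (S (fp_bound beta)) (Ci * RtoC (exp (alpha * u))) * exp_rem (S (fp_bound beta)) (- Ci * z * RtoC (exp u))))%C.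
Proof.
set (a := (Ci * RtoC (exp (alpha * u)))%C). set (b := (- Ci * z * RtoC (exp u))%C).
unfold regular.
assert (E1 : integrand alpha beta z (u, 0) = (Cexp ((beta + 1) * RtoC u) * (Cexp a * Cexp b))%C).
{ unfold integrand. rewrite <- !Cexp_plus. f_equal. unfold a, b.
  change ((u, 0) : C) with (RtoC u). rewrite <- RtoC_mult, !Cexp_RtoC. ring. }
rewrite E1.
rewrite (double_sum_ext _ (fun m n => (fp_coef z m n * Cexp (fp_exponent alpha beta m n * RtoC u))%C)
  (fun m n => Cexp ((beta + 1) * RtoC u) * ((/ RtoC (INR (fact n)) * a ^ n) * (/ RtoC (INR (fact m)) * b ^ m)))%C).
- rewrite double_sum_mult, (double_sum_prod _ (fun n => / RtoC (INR (fact n)) * a ^ n)%C (fun m => / RtoC (INR (fact m)) * b ^ m)%C).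
  rewrite !exp_rem_sum. ring.
- intros m n. unfold fp_coef, fp_exponent.
  replace ((beta + (INR n * alpha)%R + INR m + 1) * u)%C with
    ((beta + 1) * u + (RtoC (INR n) * RtoC (alpha * u) + RtoC (INR m) * RtoC u))%C
    by (rewrite !RtoC_mult; ring).
  rewrite !Cexp_plus, !Cexp_nat_mult, !Cexp_RtoC.
  unfold a, b. rewrite !Cpow_mult_l.
  field. split; apply RtoC_fact_neq_0.
Qed.

Lemma fp_bound_gt beta : Rabs (Re beta) < INR (fp_bound beta).
Proof.
unfold fp_bound. destruct (archimed (Rabs (Re beta))) as [H _].
pose proof (Rabs_pos (Re beta)). rewrite INR_IZR_INZ, Z2Nat.id; [lra|].
apply le_IZR. lra.
Qed.

(** The rate of exponential decay of [regular] at minus infinity: each remainder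
    contributes [e^u] to the power [fp_bound beta + 1]. *)
Definition reg_order (beta : C) : R := Re beta + 1 + INR (S (fp_bound beta)).

Lemma reg_order_gt beta : 1 < reg_order beta.
Proof.
unfold reg_order. rewrite S_INR. pose proof (fp_bound_gt beta). pose proof (Rle_abs (- Re beta)) as H1.
rewrite Rabs_Ropp in H1. lra.
Qed.

(** In [regular_factor] put [a = i e^(alpha u)], [b = - i z e^u]; for [u <= 0] both
    are at most [rho e^u], as [alpha >= 1]. *)
Lemma regular_le alpha beta z u rho : 1 <= alpha -> 1 <= rho -> Cmod z <= rho -> u <= 0 ->
  Cmod (regular alpha beta z u) <=
  3 * rho ^ S (fp_bound beta) * exp ((1 + rho) * exp u) * exp (reg_order beta * u).
Proof.
intros Ha Hr Hz Hu. rewrite regular_factor. set (M := S (fp_bound beta)).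
set (a := (Ci * RtoC (exp (alpha * u)))%C). set (b := (- Ci * z * RtoC (exp u))%C).
set (t := exp u).
assert (Ht : 0 < t <= 1). { split; [apply exp_pos|]. rewrite <- exp_0. apply exp_le, Hu. }
assert (Hma : Cmod a <= t).
{ unfold a. rewrite Cmod_mult, Cmod_Ci, Cmod_R, Rmult_1_l, Rabs_right by (left; apply exp_pos).
  apply exp_le. nra. }
assert (Hmb : Cmod b <= rho * t).
{ unfold b. rewrite !Cmod_mult, Cmod_opp, Cmod_Ci, Cmod_R, Rmult_1_l, Rabs_right by (left; apply exp_pos).
  apply Rmult_le_compat_r; trivial. left; apply exp_pos. }
pose proof (Cmod_ge_0 a) as Pa. pose proof (Cmod_ge_0 b) as Pb.
set (E := exp ((1 + rho) * t)).
assert (HE : exp (Cmod a) * exp (Cmod b) <= E) by (rewrite <- exp_plus; apply exp_le; lra).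
assert (Hea : Cmod (Cexp a) <= exp (Cmod a)) by (rewrite Cmod_Cexp; apply exp_le, Re_le_Cmod).
assert (Heb : Cmod (Cexp b) <= exp (Cmod b)) by (rewrite Cmod_Cexp; apply exp_le, Re_le_Cmod).
pose proof (exp_rem_le M a) as Ra. pose proof (exp_rem_le M b) as Rb.
assert (Pt : 0 < t ^ M) by (apply pow_lt; lra).
assert (Pt1 : t ^ M <= 1). { rewrite <- (pow1 M). apply pow_incr; lra. }
assert (Pr : 1 <= rho ^ M) by (apply pow_R1_Rle; lra).
assert (Qa : Cmod a ^ M <= t ^ M) by (apply pow_incr; lra).
assert (Qb : Cmod b ^ M <= rho ^ M * t ^ M) by (rewrite <- Rpow_mult_distr; apply pow_incr; lra).
assert (Qa0 : 0 <= Cmod a ^ M) by (apply pow_le; lra).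
assert (Qb0 : 0 <= Cmod b ^ M) by (apply pow_le; lra).
pose proof (exp_pos (Cmod a)) as Xa. pose proof (exp_pos (Cmod b)) as Xb.
assert (HE0 : 0 < E) by apply exp_pos.
set (W := rho ^ M * t ^ M * E).
assert (B1 : Cmod (exp_rem M a * Cexp b) <= W).
{ rewrite Cmod_mult. apply Rle_trans with ((Cmod a ^ M * exp (Cmod a)) * exp (Cmod b)).
  { apply Rmult_le_compat; trivial; apply Cmod_ge_0. }
  rewrite Rmult_assoc. apply Rmult_le_compat; trivial; try nra. }
assert (B2 : Cmod (Cexp a * exp_rem M b) <= W).
{ rewrite Cmod_mult. apply Rle_trans with (exp (Cmod a) * (Cmod b ^ M * exp (Cmod b))).
  { apply Rmult_le_compat; trivial; apply Cmod_ge_0. }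
  replace (exp (Cmod a) * (Cmod b ^ M * exp (Cmod b))) with (Cmod b ^ M * (exp (Cmod a) * exp (Cmod b))) by ring.
  apply Rmult_le_compat; trivial; try nra. }
assert (B3 : Cmod (exp_rem M a * exp_rem M b) <= W).
{ rewrite Cmod_mult. apply Rle_trans with ((Cmod a ^ M * exp (Cmod a)) * (Cmod b ^ M * exp (Cmod b))).
  { apply Rmult_le_compat; trivial; apply Cmod_ge_0. }
  replace ((Cmod a ^ M * exp (Cmod a)) * (Cmod b ^ M * exp (Cmod b))) with ((Cmod a ^ M * Cmod b ^ M) * (exp (Cmod a) * exp (Cmod b))) by ring.
  apply Rmult_le_compat; trivial; try nra. }
rewrite Cmod_mult, Cmod_Cexp.
replace (Re ((beta + 1) * u)%C) with ((Re beta + 1) * u) by (unfold Re; simpl; ring).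
assert (Ht2 : exp (reg_order beta * u) = exp ((Re beta + 1) * u) * t ^ M).
{ unfold reg_order, t. fold M. replace ((Re beta + 1 + INR M) * u) with ((Re beta + 1) * u + INR M * u) by ring.
  rewrite exp_plus. f_equal. clear. induction M as [|k IH]; [simpl; rewrite Rmult_0_l; apply exp_0|].
  rewrite S_INR. simpl. rewrite <- IH, <- exp_plus. f_equal. ring. }
rewrite Ht2.
replace (3 * rho ^ M * E * (exp ((Re beta + 1) * u) * t ^ M)) with (exp ((Re beta + 1) * u) * (W + W + W)) by (unfold W; ring).
apply Rmult_le_compat_l; [left; apply exp_pos|].
unfold Cminus. eapply Rle_trans; [apply Cmod_triangle|]. rewrite Cmod_opp.
apply Rplus_le_compat; trivial. eapply Rle_trans; [apply Cmod_triangle|]. lra.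
Qed.

(** Since [alpha > 1], [e^(alpha u)] is eventually larger than any multiple
    of [e^u]. *)
Lemma exp_tail_bound a c d alpha : 1 < alpha -> 0 < d ->
  exists M, forall u, 0 <= u -> a * u + c * exp u - d * exp (alpha * u) <= M.
Proof.
intros Ha Hd. set (D := Rabs a + Rabs c + 1).
assert (HD : 1 <= D) by (unfold D; pose proof (Rabs_pos a); pose proof (Rabs_pos c); lra).
set (u0 := ln (D / d) / (alpha - 1)).
exists (D * exp (Rmax 0 u0)). intros u Hu.
assert (Hp : 0 < exp u) by apply exp_pos.
assert (Hle : a * u + c * exp u <= D * exp u).
{ assert (u <= exp u) by (pose proof (exp_ineq1_le u); lra).
  assert (a * u <= Rabs a * exp u).
  { apply Rle_trans with (Rabs a * u); [apply Rmult_le_compat_r; [lra|apply Rle_abs]|apply Rmult_le_compat_l; [apply Rabs_pos|lra]]. }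
  assert (c * exp u <= Rabs c * exp u) by (apply Rmult_le_compat_r; [lra|apply Rle_abs]).
  unfold D. lra. }
assert (He : exp (alpha * u) = exp u * exp ((alpha - 1) * u)) by (rewrite <- exp_plus; f_equal; ring).
assert (Hm : 0 < D * exp (Rmax 0 u0)) by (apply Rmult_lt_0_compat; [lra|apply exp_pos]).
destruct (Rle_dec u (Rmax 0 u0)) as [L|L].
- pose proof (exp_le _ _ L). pose proof (exp_pos (alpha * u)). nra.
- assert (u0 < u) by (pose proof (Rmax_r 0 u0); lra).
  assert (D / d <= exp ((alpha - 1) * u)).
  { rewrite <- (exp_ln (D / d)) by (apply Rdiv_lt_0_compat; lra). apply exp_le.
    assert (u0 * (alpha - 1) = ln (D / d)) by (unfold u0; field; lra). nra. }
  assert (D <= d * exp ((alpha - 1) * u)).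
  { apply Rmult_le_compat_l with (r := d) in H0; [|lra]. replace (d * (D / d)) with D in H0 by (field; lra). exact H0. }
  rewrite He. nra.
Qed.

(** The left-hand side is the imaginary part of [z e^(i phi)]. *)
Lemma Im_rot_le (z : C) phi : Re z * sin phi + Im z * cos phi <= Cmod z.
Proof.
replace (Re z * sin phi + Im z * cos phi) with (Im (z * Cexp (0, phi))%C).
- eapply Rle_trans; [apply Rle_abs|]. eapply Rle_trans; [apply snd_le_Cmod|].
  rewrite Cmod_mult, Cmod_Cexp. unfold Re; simpl. rewrite exp_0. lra.
- unfold Cexp, Im, Re; simpl. rewrite exp_0. ring.
Qed.

Lemma sin_alpha_theta alpha : 1 < alpha -> sin (alpha * (PI / (2 * alpha))) = 1.
Proof. intros. replace (alpha * (PI / (2 * alpha))) with (PI / 2) by (field; lra). apply sin_PI2. Qed.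

(** At height [PI / (2 alpha)] the sine in [Cmod_integrand] equals [1], and
    [exp_tail_bound] applies uniformly in [|z| <= rho]. *)
Lemma ray_le alpha beta rho : 1 < alpha -> 
  exists K, 0 < K /\ forall z u, Cmod z <= rho -> 0 <= u ->
    Cmod (integrand alpha beta z (u, PI / (2 * alpha))) <= K * exp (-1 * u).
Proof.
intros Ha.
destruct (exp_tail_bound (Re beta + 2) rho 1 alpha Ha ltac:(lra)) as [M HM].
exists (exp (M - Im beta * (PI / (2 * alpha)))). split; [apply exp_pos|].
intros z u Hz Hu. rewrite Cmod_integrand, sin_alpha_theta, <- exp_plus by assumption. apply exp_le.
specialize (HM u Hu). pose proof (Im_rot_le z (PI / (2 * alpha))) as H.
assert (exp u * (Re z * sin (PI / (2 * alpha)) + Im z * cos (PI / (2 * alpha))) <= rho * exp u).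
{ rewrite Rmult_comm. apply Rmult_le_compat_r; [left; apply exp_pos|lra]. }
lra.
Qed.

Lemma ray_tail_le alpha beta z K q q' : 0 <= K -> q <= q' ->
  (forall u, q <= u -> Cmod (integrand alpha beta z (u, PI / (2 * alpha))) <= K * exp (-1 * u)) ->
  Cmod (Cint (fun u => integrand alpha beta z (u, PI / (2 * alpha))) q q') <= K * exp (- q).
Proof.
intros HK Hq H.
eapply Rle_trans; [apply (Cint_le_exp _ K (-1)); trivial; try lra|].
- apply holomorphic_hor, holomorphic_integrand.
- intros; apply H; lra.
- apply Rmult_le_compat_l; trivial.
  replace ((exp (-1 * q') - exp (-1 * q)) / -1) with (exp (-1 * q) - exp (-1 * q')) by field.
  pose proof (exp_pos (-1 * q')). replace (- q) with (-1 * q) by ring. lra.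
Qed.

Lemma regular_tail_le alpha beta z p q K : 0 <= K -> p <= q ->
  (forall u, u <= q -> Cmod (regular alpha beta z u) <= K * exp (reg_order beta * u)) ->
  Cmod (Cint (regular alpha beta z) p q) <= K * exp (reg_order beta * q).
Proof.
intros HK Hp H. pose proof (reg_order_gt beta) as Hl. set (l := reg_order beta) in *.
eapply Rle_trans; [apply (Cint_le_exp _ K l); trivial; try lra|].
- apply curve_cont_regular.
- intros; apply H; lra.
- apply Rmult_le_compat_l; trivial.
  pose proof (exp_pos (l * p)). pose proof (exp_pos (l * q)).
  apply Rmult_le_reg_r with l; [lra|].
  replace ((exp (l * q) - exp (l * p)) / l * l) with (exp (l * q) - exp (l * p)) by (field; lra). nra.
Qed.

(** Passing from [N] to [N'] changes the left end by an integral of [regular] and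
    the right end by an integral over the line at height [PI / (2 alpha)]; both
    are [O(e^(- N))] uniformly in [|z| <= rho]. *)
Lemma approx_cauchy alpha beta rho : 1 < alpha -> 1 <= rho ->
  exists T, 0 <= T /\ forall z N N', Cmod z <= rho -> (N <= N')%nat ->
    Cmod (approx alpha beta z N' - approx alpha beta z N)%C <= T * exp (- INR N).
Proof.
intros Ha Hr.
destruct (ray_le alpha beta rho Ha) as [K [HK Hray]].
set (K' := 3 * rho ^ S (fp_bound beta) * exp (1 + rho)).
assert (HK' : 0 <= K').
{ unfold K'. pose proof (pow_le rho (S (fp_bound beta))). pose proof (exp_pos (1 + rho)). nra. }
exists (K' + K); split; [lra|].
intros z N N' Hz HN. unfold approx, contour.
pose proof (pos_INR N) as P1. pose proof (le_INR _ _ HN) as P2.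
rewrite <- (Cint_Chasles _ (- INR N') (- INR N) 0) by apply holomorphic_hor, holomorphic_integrand.
rewrite <- (Cint_Chasles _ 0 (INR N) (INR N')) by apply holomorphic_hor, holomorphic_integrand.
pose proof (singular_shift alpha beta z (- INR N') (- INR N)) as E.
set (S' := singular_part alpha beta z (- INR N')) in *. set (S := singular_part alpha beta z (- INR N)) in *.
set (I1 := Cint (fun u => integrand alpha beta z (u, 0)) (- INR N') (- INR N)) in *.
set (I2 := Cint (fun u => integrand alpha beta z (u, 0)) (- INR N) 0).
set (J := Cint (regular alpha beta z) (- INR N') (- INR N)) in *.
set (Y1 := Cint (fun u => integrand alpha beta z (u, PI / (2 * alpha))) 0 (INR N)).
set (Y2 := Cint (fun u => integrand alpha beta z (u, PI / (2 * alpha))) (INR N) (INR N')).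
set (V := Cint (fun phi => integrand alpha beta z (0, phi)) 0 (PI / (2 * alpha))).
replace (S' + (I1 + I2 + Ci * V + (Y1 + Y2)) - (S + (I2 + Ci * V + Y1)))%C with (J + Y2)%C.
2:{ replace (S' + (I1 + I2 + Ci * V + (Y1 + Y2)) - (S + (I2 + Ci * V + Y1)))%C with ((S' + I1) - S + Y2)%C by ring.
    rewrite E. ring. }
eapply Rle_trans; [apply Cmod_triangle|]. rewrite Rmult_plus_distr_r.
apply Rplus_le_compat.
- apply Rle_trans with (K' * exp (reg_order beta * - INR N)).
  + apply regular_tail_le; try lra. intros u Hu.
    eapply Rle_trans; [apply (regular_le _ _ _ _ rho); lra|].
    apply Rmult_le_compat_r; [left; apply exp_pos|]. unfold K'.
    apply Rmult_le_compat_l. { pose proof (pow_le rho (Datatypes.S (fp_bound beta))). nra. }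
    apply exp_le. assert (exp u <= 1) by (apply exp_le_1; lra). nra.
  + apply Rmult_le_compat_l; trivial. apply exp_le. pose proof (reg_order_gt beta). nra.
- apply ray_tail_le; try lra. intros u Hu. apply Hray; trivial; lra.
Qed.

(** The componentwise limit, a junk value if the sequence diverges. *)
Definition Clim (s : nat -> C) : C := (real (Lim_seq (fun n => fst (s n))), real (Lim_seq (fun n => snd (s n)))).

Lemma exp_neg_INR_small T eps : 0 <= T -> 0 < eps -> exists N, forall n, (N <= n)%nat -> T * exp (- INR n) <= eps.
Proof.
intros HT He.
set (x := Rmax 0 (ln ((T + 1) / eps))).
exists (Z.to_nat (up x)). intros n Hn.
assert (Hx : x < INR n).
{ destruct (archimed x) as [H _]. assert (0 <= x) by apply Rmax_l.
  apply le_INR in Hn. rewrite INR_IZR_INZ, Z2Nat.id in Hn; [lra|]. apply le_IZR. lra. }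
assert (ln ((T + 1) / eps) <= INR n) by (pose proof (Rmax_r 0 (ln ((T + 1) / eps))); unfold x in *; lra).
apply exp_le in H. rewrite exp_ln in H by (apply Rdiv_lt_0_compat; lra).
rewrite exp_Ropp. pose proof (exp_pos (INR n)).
apply Rmult_le_reg_r with (exp (INR n)); trivial.
rewrite Rmult_assoc, Rinv_l, Rmult_1_r by lra.
apply Rmult_le_compat_l with (r := eps) in H; [|lra].
replace (eps * ((T + 1) / eps)) with (T + 1) in H by (field; lra). lra.
Qed.

Lemma Clim_correct (s : nat -> C) T : 0 <= T ->
  (forall N N', (N <= N')%nat -> Cmod (s N' - s N)%C <= T * exp (- INR N)) ->
  forall N, Cmod (s N - Clim s)%C <= 2 * (T * exp (- INR N)).
Proof.
intros HT H N.
assert (Hl : forall c : C -> R, (forall z, Rabs (c z) <= Cmod z) -> (forall z w, c (z - w)%C = c z - c w) ->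
   Rabs (c (s N) - real (Lim_seq (fun n => c (s n)))) <= T * exp (- INR N)).
{ intros c Hc1 Hc2.
  assert (Hex : ex_finite_lim_seq (fun n => c (s n))).
  { apply ex_lim_seq_cauchy_corr. intros eps.
    destruct (exp_neg_INR_small T (eps / 3) HT) as [N0 HN0]. { pose proof (cond_pos eps); lra. }
    exists N0. intros n m Hn Hm.
    assert (A : forall k, (N0 <= k)%nat -> Rabs (c (s k) - c (s N0)) <= eps / 3).
    { intros k Hk. rewrite <- Hc2. eapply Rle_trans; [apply Hc1|]. eapply Rle_trans; [apply H, Hk|]. apply HN0; lia. }
    pose proof (A n Hn) as A1. pose proof (A m Hm) as A2.
    apply Rabs_le_between in A1. apply Rabs_le_between in A2.
    pose proof (cond_pos eps). apply Rabs_lt_between; lra. }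
  apply Lim_seq_correct' in Hex. set (l := real (Lim_seq (fun n => c (s n)))) in *.
  assert (Hlim : is_lim_seq (fun n => Rabs (c (s N) - c (s n))) (Rabs (c (s N) - l))).
  { apply (is_lim_seq_abs _ (Finite (c (s N) - l))). apply is_lim_seq_minus'; trivial. apply is_lim_seq_const. }
  apply (is_lim_seq_le_loc (fun n => Rabs (c (s N) - c (s n))) (fun _ => T * exp (- INR N)) (Finite (Rabs (c (s N) - l))) (Finite (T * exp (- INR N)))); [|exact Hlim|apply is_lim_seq_const].
  exists N. intros n Hn. rewrite Rabs_minus_sym, <- Hc2. eapply Rle_trans; [apply Hc1|]. apply H, Hn. }
pose proof (Hl fst fst_le_Cmod ltac:(intros; simpl; ring)) as H1.
pose proof (Hl snd snd_le_Cmod ltac:(intros; simpl; ring)) as H2.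
replace (s N - Clim s)%C with (RtoC (fst (s N) - real (Lim_seq (fun n => fst (s n)))) + Ci * RtoC (snd (s N) - real (Lim_seq (fun n => snd (s n)))))%C
  by (unfold Clim; apply injective_projections; simpl; ring).
eapply Rle_trans; [apply Cmod_triangle|]. rewrite Cmod_mult, Cmod_Ci, !Cmod_R. lra.
Qed.

Lemma approx_converges alpha beta rho : 1 < alpha -> 1 <= rho ->
  exists T, 0 <= T /\ forall z N, Cmod z <= rho ->
    Cmod (approx alpha beta z N - Clim (approx alpha beta z))%C <= T * exp (- INR N).
Proof.
intros Ha Hr. destruct (approx_cauchy alpha beta rho Ha Hr) as [T [HT H]].
exists (2 * T); split; [lra|]. intros z N Hz. rewrite Rmult_assoc. apply Clim_correct; auto.
Qed.

(** The function [F - approx N] is entire and tends to [F - lim approx], which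
    vanishes on the lower half-plane. *)
Lemma eq_Clim_everywhere alpha beta F : 1 < alpha -> entire F ->
  (forall z, Im z < 0 -> F z = Clim (approx alpha beta z)) ->
  forall z, F z = Clim (approx alpha beta z).
Proof.
intros Ha HF H.
assert (E : forall z, (F z - Clim (approx alpha beta z))%C = 0%C).
{ apply (unif_limit_zero (fun N z => F z - approx alpha beta z N)%C).
  - intros n. apply holomorphic_minus; [apply entire_holomorphic, HF|apply holomorphic_approx, Ha].
  - intros rho eps He.
    destruct (approx_converges alpha beta (Rmax 1 rho) Ha (Rmax_l _ _)) as [T [HT HA]].
    destruct (exp_neg_INR_small T eps HT He) as [N HN]. exists N. intros n z Hn Hz.
    replace (F z - approx alpha beta z n - (F z - Clim (approx alpha beta z)))%C with (- (approx alpha beta z n - Clim (approx alpha beta z)))%C by ring.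
    rewrite Cmod_opp. eapply Rle_trans; [apply HA|apply HN, Hn]. eapply Rle_trans; [exact Hz|apply Rmax_r].
  - intros z Hz. rewrite H by exact Hz. ring. }
intros z. specialize (E z). transitivity (F z - Clim (approx alpha beta z) + Clim (approx alpha beta z))%C; [ring|]. rewrite E. ring.
Qed.

(** * The finite part as the limit of the truncations *)

Lemma exp_linear_bound a d : 0 < d -> exists M, forall u, 0 <= u -> a * u - d * exp u <= M.
Proof.
intros Hd. exists (a * a / d). intros u Hu.
assert (H : u / 2 * (u / 2) <= exp u).
{ replace u with (u / 2 + u / 2) at 3 by field. rewrite exp_plus.
  pose proof (exp_ineq1_le (u / 2)). apply Rmult_le_compat; lra. }
apply Rle_trans with (a * u - d * (u / 2 * (u / 2))); [nra|].
apply Rmult_le_reg_r with d; trivial. replace (a * a / d * d) with (a * a) by (field; lra).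
pose proof (Rle_0_sqr (a - d * u / 2)). unfold Rsqr in *. nra.
Qed.

(** Otherwise the mean slope of [sin] on [0, x] would be smaller than its mean
    slope on [x, PI / 2], against the monotonicity of [cos]. *)
Lemma jordan_sin x : 0 <= x <= PI / 2 -> 2 / PI * x <= sin x.
Proof.
intros [H0 H1]. pose proof PI_RGT_0 as HP.
destruct (Rle_lt_dec (2 / PI * x) (sin x)) as [|L]; trivial. exfalso.
assert (Hx0 : x <> 0). { intros ->. rewrite sin_0 in L. lra. }
assert (Hx1 : x <> PI / 2). { intros ->. rewrite sin_PI2 in L. replace (2 / PI * (PI / 2)) with 1 in L by (field; lra). lra. }
destruct (MVT_cor2 sin cos 0 x) as [c1 [E1 C1]]; [lra|intros; apply derivable_pt_lim_sin|].
destruct (MVT_cor2 sin cos x (PI / 2)) as [c2 [E2 C2]]; [lra|intros; apply derivable_pt_lim_sin|].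
rewrite sin_0 in E1. rewrite sin_PI2 in E2.
assert (Hc : cos c2 < cos c1) by (apply cos_decreasing_1; lra).
assert (K1 : cos c1 < 2 / PI).
{ apply Rmult_lt_reg_r with x; lra. }
assert (K2 : 2 / PI < cos c2).
{ apply Rmult_lt_reg_r with (PI / 2 - x); [lra|].
  replace (2 / PI * (PI / 2 - x)) with (1 - 2 / PI * x) by (field; lra). lra. }
lra.
Qed.

(** The limit along the integers is also the limit along the reals. *)
Lemma real_limit (g : R -> C) T : 0 <= T ->
  (forall q q', 0 <= q <= q' -> Cmod (g q' - g q)%C <= T * exp (- q)) ->
  exists L, forall q, 0 <= q -> Cmod (g q - L)%C <= 3 * (T * exp (- q)).
Proof.
intros HT H. exists (Clim (fun n => g (INR n))). intros q Hq.
assert (HC : forall N, Cmod (g (INR N) - Clim (fun n => g (INR n)))%C <= 2 * (T * exp (- INR N))).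
{ apply (Clim_correct (fun n => g (INR n))); trivial. intros N N' HN. apply H. split; [apply pos_INR|apply le_INR, HN]. }
destruct (archimed q) as [A _].
set (N := Z.to_nat (up q)).
assert (HN : q <= INR N). { unfold N. rewrite INR_IZR_INZ, Z2Nat.id; [lra|]. apply le_IZR. lra. }
specialize (HC N).
replace (g q - Clim (fun n => g (INR n)))%C with (- (g (INR N) - g q) + (g (INR N) - Clim (fun n => g (INR n))))%C by ring.
eapply Rle_trans; [apply Cmod_triangle|]. rewrite Cmod_opp.
specialize (H q (INR N) (conj Hq HN)).
assert (exp (- INR N) <= exp (- q)) by (apply exp_le; lra).
assert (T * exp (- INR N) <= T * exp (- q)) by (apply Rmult_le_compat_l; lra). lra.
Qed.

Definition left_part alpha beta z (p : R) : C :=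
  (singular_part alpha beta z p + Cint (fun u => integrand alpha beta z (u, 0%R)) p 0)%C.

Definition right_part alpha beta z (q : R) : C :=
  (Ci * Cint (fun phi => integrand alpha beta z (0%R, phi)) 0 (PI / (2 * alpha))
   + Cint (fun u => integrand alpha beta z (u, PI / (2 * alpha))%R) 0 q)%C.

Lemma left_part_limit alpha beta z : 1 < alpha -> exists L T, 0 <= T /\ forall p, p <= 0 ->
  Cmod (left_part alpha beta z p - L)%C <= T * exp p.
Proof.
intros Ha.
set (rho := Rmax 1 (Cmod z)).
assert (Hr : 1 <= rho) by apply Rmax_l. assert (Hz : Cmod z <= rho) by apply Rmax_r.
set (K' := 3 * rho ^ S (fp_bound beta) * exp (1 + rho)).
assert (HK' : 0 <= K').
{ unfold K'. pose proof (pow_le rho (S (fp_bound beta))). pose proof (exp_pos (1 + rho)). nra. }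
destruct (real_limit (fun q => left_part alpha beta z (- q)) K' HK') as [L HL].
{ intros q q' Hq. unfold left_part.
  rewrite <- (Cint_Chasles _ (- q') (- q) 0) by apply holomorphic_hor, holomorphic_integrand.
  rewrite Cplus_assoc, singular_shift.
  match goal with |- Cmod ?X <= _ => replace X with (Cint (regular alpha beta z) (- q') (- q)) by ring end.
  apply Rle_trans with (K' * exp (reg_order beta * - q)).
  + apply regular_tail_le; try lra. intros u Hu.
    eapply Rle_trans; [apply (regular_le _ _ _ _ rho); lra|].
    apply Rmult_le_compat_r; [left; apply exp_pos|]. unfold K'.
    apply Rmult_le_compat_l. { pose proof (pow_le rho (S (fp_bound beta))). nra. }
    apply exp_le. assert (exp u <= 1) by (apply exp_le_1; lra). nra.
  + apply Rmult_le_compat_l; trivial. apply exp_le. pose proof (reg_order_gt beta). nra. }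
exists L, (3 * K'); split; [lra|]. intros p Hp. specialize (HL (- p)).
rewrite Ropp_involutive in HL. rewrite Rmult_assoc. apply HL. lra.
Qed.

Lemma right_part_limit alpha beta z : 1 < alpha -> exists L T, 0 <= T /\ forall q, 0 <= q ->
  Cmod (right_part alpha beta z q - L)%C <= T * exp (- q).
Proof.
intros Ha. destruct (ray_le alpha beta (Cmod z) Ha) as [K [HK Hray]].
destruct (real_limit (right_part alpha beta z) K) as [L HL]; [lra| |].
{ intros q q' Hq. unfold right_part.
  rewrite <- (Cint_Chasles _ 0 q q') by apply holomorphic_hor, holomorphic_integrand.
  match goal with |- Cmod ?X <= _ => replace X with (Cint (fun u => integrand alpha beta z (u, PI / (2 * alpha))) q q') by ring end.
  apply ray_tail_le; try lra. intros u Hu. apply Hray; lra. }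
exists L, (3 * K); split; [lra|]. intros q Hq. rewrite Rmult_assoc. apply HL; trivial.
Qed.

Lemma approx_parts alpha beta z N :
  approx alpha beta z N = (left_part alpha beta z (- INR N) + right_part alpha beta z (INR N))%C.
Proof. unfold approx, left_part, right_part, contour. ring. Qed.

Lemma Cmod_eq_0_eps (w : C) T : 0 <= T -> (forall n : nat, Cmod w <= T * exp (- INR n)) -> w = 0%C.
Proof.
intros HT H. apply Cmod_eq_0. apply Rle_antisym; [|apply Cmod_ge_0].
apply le_epsilon. intros eps He. destruct (exp_neg_INR_small T eps HT He) as [N HN].
specialize (HN N (Nat.le_refl _)). specialize (H N). lra.
Qed.

Lemma Clim_approx alpha beta z L1 T1 L2 T2 : 1 < alpha -> 0 <= T1 -> 0 <= T2 ->
  (forall p, p <= 0 -> Cmod (left_part alpha beta z p - L1)%C <= T1 * exp p) ->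
  (forall q, 0 <= q -> Cmod (right_part alpha beta z q - L2)%C <= T2 * exp (- q)) ->
  Clim (approx alpha beta z) = (L1 + L2)%C.
Proof.
intros Ha HT1 HT2 H1 H2.
destruct (approx_converges alpha beta (Rmax 1 (Cmod z)) Ha (Rmax_l _ _)) as [T [HT H]].
assert (E : (Clim (approx alpha beta z) - (L1 + L2))%C = 0%C).
{ apply (Cmod_eq_0_eps _ (T + T1 + T2)); [lra|]. intros n.
  specialize (H z n (Rmax_r _ _)). pose proof (pos_INR n).
  specialize (H1 (- INR n) ltac:(lra)). specialize (H2 (INR n) ltac:(lra)).
  replace (Clim (approx alpha beta z) - (L1 + L2))%C with
    (- (approx alpha beta z n - Clim (approx alpha beta z)) +
      ((left_part alpha beta z (- INR n) - L1) + (right_part alpha beta z (INR n) - L2)))%C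
    by (rewrite approx_parts; ring).
  eapply Rle_trans; [apply Cmod_triangle|]. rewrite Cmod_opp.
  pose proof (Cmod_triangle (left_part alpha beta z (- INR n) - L1) (right_part alpha beta z (INR n) - L2)). lra. }
transitivity (Clim (approx alpha beta z) - (L1 + L2) + (L1 + L2))%C; [ring|]. rewrite E. ring.
Qed.

(** The substitution [t = e^u]. *)
Lemma is_RInt_log (f : R -> C) a b : curve_cont f -> 0 < a -> 0 < b ->
  is_RInt (V := CV) (fun t => RtoC (/ t) * f (ln t))%C a b (Cint f (ln a) (ln b)).
Proof.
intros Hf Ha Hb.
assert (Hpos : forall x, Rmin a b <= x -> 0 < x).
{ intros x Hx. eapply Rlt_le_trans; [|exact Hx]. apply Rmin_pos; assumption. }
apply (is_RInt_ext (V := CV) (fun t => scal (V := CV) (/ t) (f (ln t)))).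
- intros t _. unfold scal; simpl; unfold prod_scal, scal; simpl; unfold mult; simpl.
  unfold Cmult; simpl. f_equal; ring.
- apply (is_RInt_comp (V := CV) f ln Rinv a b).
  + intros x _. apply curve_cont_continuous, Hf.
  + intros x [Hx _]. specialize (Hpos x Hx). split.
    * apply is_derive_Reals. apply derivable_pt_lim_ln. exact Hpos.
    * apply (ex_derive_continuous (V := R_NormedModule) Rinv). apply ex_derive_inv; [apply ex_derive_id|lra].
Qed.

Lemma is_RInt_log_l (f : R -> C) b : curve_cont f -> 0 < b ->
  is_RInt (V := CV) (fun t => RtoC (/ t) * f (ln t))%C 1 b (Cint f 0 (ln b)).
Proof. intros Hf Hb. rewrite <- ln_1 at 1. apply is_RInt_log; trivial. lra. Qed.

Lemma is_RInt_log_r (f : R -> C) a : curve_cont f -> 0 < a ->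
  is_RInt (V := CV) (fun t => RtoC (/ t) * f (ln t))%C a 1 (Cint f (ln a) 0).
Proof. intros Hf Hb. rewrite <- ln_1 at 1. apply is_RInt_log; trivial. lra. Qed.

Lemma integrand_log alpha beta z t : 0 < t ->
  (cpower t beta * osc alpha z t = RtoC (/ t) * integrand alpha beta z (ln t, 0%R))%C.
Proof.
intros Ht. unfold cpower, osc, integrand. change ((ln t, 0) : C) with (RtoC (ln t)).
rewrite <- RtoC_mult, !Cexp_RtoC, exp_ln by assumption. unfold Rpower.
replace (RtoC (/ t)) with (Cexp (- RtoC (ln t))).
- rewrite <- !Cexp_plus. f_equal. ring.
- rewrite <- RtoC_opp, Cexp_RtoC, exp_Ropp, exp_ln by assumption. reflexivity.
Qed.

Lemma ball_CV (x y : C) (eps : posreal) : Cmod (y - x)%C < eps -> ball (M := CV) x eps y.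
Proof.
intros H. split; [ eapply Rle_lt_trans; [ apply (fst_le_Cmod (y - x)%C) | exact H ]
       | eapply Rle_lt_trans; [ apply (snd_le_Cmod (y - x)%C) | exact H ]].
Qed.

Lemma is_RInt_gen_infty (f : R -> C) (I : R -> C) (l : C) :
  (forall b, 1 < b -> is_RInt (V := CV) f 1 b (I (ln b))) ->
  (forall eps, 0 < eps -> exists q0, forall q, q0 <= q -> Cmod (I q - l)%C < eps) ->
  is_RInt_gen (V := CV) f (at_point 1) (Rbar_locally p_infty) l.
Proof.
intros HI Hl P [eps HP].
destruct (Hl eps (cond_pos eps)) as [q0 Hq].
apply (Filter_prod _ _ _ (fun a => a = 1) (fun b => Rmax 1 (exp q0) < b)).
- reflexivity.
- exists (Rmax 1 (exp q0)). auto.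
- intros a b -> Hb. exists (I (ln b)); split.
  + apply HI. eapply Rle_lt_trans; [apply Rmax_l|exact Hb].
  + apply HP. apply ball_CV. apply Hq.
    left. rewrite <- (ln_exp q0). apply ln_increasing; [apply exp_pos|].
    eapply Rle_lt_trans; [apply Rmax_r|exact Hb].
Qed.

Lemma is_RInt_gen_zero (f : R -> C) (I : R -> C) (l : C) :
  (forall a, 0 < a < 1 -> is_RInt (V := CV) f a 1 (I (ln a))) ->
  (forall eps, 0 < eps -> exists p0, forall p, p <= p0 -> Cmod (I p - l)%C < eps) ->
  is_RInt_gen (V := CV) f (at_right 0) (at_point 1) l.
Proof.
intros HI Hl P [eps HP].
destruct (Hl eps (cond_pos eps)) as [p0 Hp].
apply (Filter_prod _ _ _ (fun a => 0 < a < Rmin 1 (exp p0)) (fun b => b = 1)).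
- assert (Hm : 0 < Rmin 1 (exp p0)) by (apply Rmin_pos; [lra|apply exp_pos]).
  exists (mkposreal _ Hm). intros y Hy H0. split; trivial.
  unfold ball in Hy; simpl in Hy. unfold AbsRing_ball, minus, plus, opp, abs in Hy; simpl in Hy.
  rewrite Rabs_right in Hy by lra. lra.
- reflexivity.
- intros a b Hb ->. exists (I (ln a)); split.
  + apply HI. pose proof (Rmin_l 1 (exp p0)). lra.
  + apply HP. apply ball_CV. apply Hp.
    left. rewrite <- (ln_exp p0). apply ln_increasing; [lra|]. pose proof (Rmin_r 1 (exp p0)); lra.
Qed.

(** For [Im z < 0] the term [e^q Im z cos phi] is at most a negative multiple of
    [e^q], while [e^(alpha q) sin (alpha phi)] dominates [e^q Re z sin phi] for
    large [q] by Jordan's inequality. *)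
Lemma arc_small alpha beta z : 1 < alpha -> Im z < 0 ->
  exists K q0, 0 <= K /\ 0 <= q0 /\ forall q, q0 <= q ->
   Cmod (Cint (fun phi => integrand alpha beta z (q, phi)) 0 (PI / (2 * alpha))) <= K * exp (- q).
Proof.
intros Ha Hz. pose proof PI_RGT_0 as HP. destruct (theta_pos alpha Ha) as [Ht1 Ht2].
set (th := PI / (2 * alpha)) in *.
assert (Hcos : 0 < cos th) by (apply cos_gt_0; lra).
destruct (exp_linear_bound (Re beta + 2) (- Im z * cos th)) as [M HM]; [nra|].
set (q0 := Rmax 0 (ln (Rmax 1 (PI / (2 * alpha) * Rabs (Re z))) / (alpha - 1))).
exists (th * exp (M + Rabs (Im beta) * th)), q0.
assert (Hp : 0 < exp (M + Rabs (Im beta) * th)) by apply exp_pos.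
split; [nra|]. split; [apply Rmax_l|]. intros q Hq.
replace (th * exp (M + Rabs (Im beta) * th) * exp (- q)) with ((th - 0) * (exp (M + Rabs (Im beta) * th) * exp (- q))) by ring.
apply Cint_le_const; [apply holomorphic_ver, holomorphic_integrand|lra|].
intros phi Hphi. rewrite Cmod_integrand, <- exp_plus. apply exp_le.
assert (Hq0 : 0 <= q) by (pose proof (Rmax_l 0 (ln (Rmax 1 (PI / (2 * alpha) * Rabs (Re z))) / (alpha - 1))); unfold q0 in Hq; lra).
assert (H1 : - Im beta * phi <= Rabs (Im beta) * th).
{ apply Rle_trans with (Rabs (Im beta) * phi).
  - apply Rmult_le_compat_r; [lra|]. rewrite <- Rabs_Ropp. apply Rle_abs.
  - apply Rmult_le_compat_l; [apply Rabs_pos|lra]. }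
assert (H2 : PI / (2 * alpha) * Rabs (Re z) <= exp ((alpha - 1) * q)).
{ apply Rle_trans with (Rmax 1 (PI / (2 * alpha) * Rabs (Re z))); [apply Rmax_r|].
  pose proof (Rmax_l 1 (PI / (2 * alpha) * Rabs (Re z))).
  rewrite <- (exp_ln (Rmax 1 (PI / (2 * alpha) * Rabs (Re z)))) by lra. apply exp_le.
  pose proof (Rmax_r 0 (ln (Rmax 1 (PI / (2 * alpha) * Rabs (Re z))) / (alpha - 1))) as H3.
  fold q0 in H3.
  apply Rle_trans with (((ln (Rmax 1 (PI / (2 * alpha) * Rabs (Re z))) / (alpha - 1))) * (alpha - 1)); [right; field; lra|]. nra. }
assert (H3 : 2 / PI * (alpha * phi) <= sin (alpha * phi)).
{ apply jordan_sin. split; [nra|]. 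
  apply Rle_trans with (alpha * th); [nra|]. right. unfold th. field. lra. }
assert (H4 : sin phi <= phi).
{ destruct (Req_dec phi 0) as [->|]; [rewrite sin_0; lra|]. left. apply sin_lt_x. lra. }
assert (H5 : 0 <= sin phi) by (apply sin_ge_0; lra).
assert (H6 : cos th <= cos phi) by (apply cos_decr_1; lra).
assert (He : exp (alpha * q) = exp q * exp ((alpha - 1) * q)) by (rewrite <- exp_plus; f_equal; ring).
pose proof (exp_pos q) as Hpq.
assert (H7 : exp q * (Re z * sin phi) <= exp (alpha * q) * sin (alpha * phi)).
{ rewrite He, Rmult_assoc. apply Rmult_le_compat_l; [lra|].
  apply Rle_trans with (Rabs (Re z) * phi).
  - apply Rle_trans with (Rabs (Re z) * sin phi); [apply Rmult_le_compat_r; [lra|apply Rle_abs]|].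
    apply Rmult_le_compat_l; [apply Rabs_pos|lra].
  - apply Rle_trans with (exp ((alpha - 1) * q) * (2 / PI * (alpha * phi))).
    + replace (Rabs (Re z) * phi) with (PI / (2 * alpha) * Rabs (Re z) * (2 / PI * (alpha * phi))) by (field; lra).
      apply Rmult_le_compat_r; trivial. apply Rmult_le_pos; [left; apply Rdiv_lt_0_compat; lra|nra].
    + apply Rmult_le_compat_l; [left; apply exp_pos|lra]. }
assert (H8 : exp q * (Im z * cos phi) <= - (- Im z * cos th * exp q)).
{ replace (- (- Im z * cos th * exp q)) with (exp q * (Im z * cos th)) by ring.
  apply Rmult_le_compat_l; [lra|]. nra. }
specialize (HM q Hq0). lra.
Qed.

Lemma fp_sum_double_sum alpha beta f :
  fp_sum alpha beta f = double_sum (fp_bound beta) (fun m n => if fp_index_dec alpha beta m n then f m n else 0%C).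
Proof. reflexivity. Qed.

Definition vanishes_at_m_infty (g : R -> C) : Prop :=
  forall eps, 0 < eps -> exists p0, forall p, p <= p0 -> Cmod (g p) < eps.

Lemma vanishes_at_m_infty_plus f g : vanishes_at_m_infty f -> vanishes_at_m_infty g -> vanishes_at_m_infty (fun p => f p + g p)%C.
Proof.
intros Hf Hg eps He. destruct (Hf (eps / 2)) as [p1 H1]; [lra|]. destruct (Hg (eps / 2)) as [p2 H2]; [lra|].
exists (Rmin p1 p2). intros p Hp. pose proof (Rmin_l p1 p2). pose proof (Rmin_r p1 p2).
specialize (H1 p ltac:(lra)). specialize (H2 p ltac:(lra)).
eapply Rle_lt_trans; [apply Cmod_triangle|]. lra.
Qed.

Lemma vanishes_at_m_infty_exp_bound g K lam : 0 < lam -> 0 <= K -> (forall p, p <= 0 -> Cmod (g p) <= K * exp (lam * p)) -> vanishes_at_m_infty g.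
Proof.
intros Hl HK H eps He. set (p1 := ln (eps / (K + 1)) / lam).
exists (Rmin 0 p1). intros p Hp. pose proof (Rmin_l 0 p1). pose proof (Rmin_r 0 p1).
specialize (H p ltac:(lra)). eapply Rle_lt_trans; [exact H|].
assert (exp (lam * p) <= eps / (K + 1)).
{ rewrite <- (exp_ln (eps / (K + 1))) by (apply Rdiv_lt_0_compat; lra). apply exp_le.
  apply Rle_trans with (lam * p1); [nra|]. right; unfold p1; field; lra. }
apply Rle_lt_trans with (K * (eps / (K + 1))); [apply Rmult_le_compat_l; lra|].
apply Rmult_lt_reg_r with (K + 1); [lra|]. replace (K * (eps / (K + 1)) * (K + 1)) with (K * eps) by (field; lra). nra.
Qed.

Lemma vanishes_at_m_infty_ext f g : (forall p, f p = g p) -> vanishes_at_m_infty f -> vanishes_at_m_infty g.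
Proof. intros E H eps He. destruct (H eps He) as [p0 Hp]. exists p0. intros. rewrite <- E. auto. Qed.

Lemma Re_fp_exponent alpha beta m n : Re (fp_exponent alpha beta m n) = INR m + INR n * alpha + Re beta + 1.
Proof. unfold fp_exponent, Re; simpl. ring. Qed.

Lemma power_primitive_le (s : C) (u : R) : s <> 0%C -> Cmod (power_primitive s u) = exp (Re s * u) / Cmod s.
Proof.
intros Hs. unfold power_primitive. destruct (Ceq_dec s 0) as [E|_]; [destruct (Hs E)|].
rewrite Cmod_div by assumption. rewrite Cmod_Cexp. f_equal. f_equal. unfold Re; simpl; ring.
Qed.

(** The first improper integral is the limit of the contour integral to the
    right of [0], the arc being pushed to infinity.  The second one differs from
    the limit of singular part plus integral by the primitives at [0] of the
    finite-part terms, which the third summand of [fp_integral] restores, and by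
    the terms [k] outside the finite-part range, which vanish in the limit. *)
Theorem fp_integral_eq alpha beta z : 1 < alpha -> Im z < 0 ->
  fp_integral alpha beta z = Clim (approx alpha beta z).
Proof.
intros Ha Hz.
destruct (left_part_limit alpha beta z Ha) as [L1 [T1 [HT1 H1]]].
destruct (right_part_limit alpha beta z Ha) as [L2 [T2 [HT2 H2]]].
rewrite (Clim_approx alpha beta z L1 T1 L2 T2) by assumption.
unfold fp_integral.
set (f0 := fun m n => (if fp_index_dec alpha beta m n then fp_coef z m n * power_primitive (fp_exponent alpha beta m n) 0 else 0)%C).
set (S0 := double_sum (fp_bound beta) f0).
assert (R1 : is_RInt_gen (V := CV) (fun t => (cpower t beta * osc alpha z t)%C) (at_point 1) (Rbar_locally p_infty) L2).
{ apply (is_RInt_gen_infty _ (fun q => Cint (fun u => integrand alpha beta z (u, 0%R)) 0 q)).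
  - intros b Hb.
    apply (is_RInt_ext (V := CV) (fun t => RtoC (/ t) * integrand alpha beta z (ln t, 0%R))%C).
    + intros t Ht. rewrite Rmin_left in Ht by lra. symmetry. apply integrand_log. lra.
    + apply (is_RInt_log_l (fun u => integrand alpha beta z (u, 0%R))); try lra. apply holomorphic_hor, holomorphic_integrand.
  - intros eps He. destruct (arc_small alpha beta z Ha Hz) as [K [q0 [HK [Hq0 Harc]]]].
    destruct (exp_neg_INR_small (T2 + K) (eps / 2)) as [N HN]; [lra|lra|].
    exists (Rmax q0 (INR N)). intros q Hq.
    pose proof (Rmax_l q0 (INR N)). pose proof (Rmax_r q0 (INR N)).
    specialize (Harc q ltac:(lra)). specialize (H2 q ltac:(lra)).
    pose proof (contour_indep alpha beta z 0 0 q q Ha) as E. unfold contour in E. rewrite !Cint_point in E.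
    unfold right_part in H2.
    set (A := Cint (fun u => integrand alpha beta z (u, 0)) 0 q) in *.
    set (V := Cint (fun phi => integrand alpha beta z (q, phi)) 0 (PI / (2 * alpha))) in *.
    match type of H2 with Cmod (?X - _)%C <= _ => set (RP := X) in * end.
    assert (E2 : (A - L2)%C = ((RP - L2) + - (Ci * V))%C).
    { transitivity (A + Ci * V + 0 - Ci * V - L2)%C; [ring|]. rewrite <- E. unfold RP. ring. }
    rewrite E2. eapply Rle_lt_trans; [apply Cmod_triangle|]. rewrite Cmod_opp, Cmod_mult, Cmod_Ci.
    specialize (HN N (Nat.le_refl _)).
    assert (exp (- q) <= exp (- INR N)) by (apply exp_le; lra).
    assert ((T2 + K) * exp (- q) <= (T2 + K) * exp (- INR N)) by (apply Rmult_le_compat_l; lra). lra. }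
assert (R2 : is_RInt_gen (V := CV) (fun t => (cpower t beta * (osc alpha z t
         - fp_sum alpha beta (fun m n => fp_coef z m n * Rpower t (INR n * alpha + INR m)%R)))%C)
     (at_right 0) (at_point 1) (L1 - S0)%C).
{ set (h := fun m n u => (if fp_index_dec alpha beta m n then fp_coef z m n * Cexp (fp_exponent alpha beta m n * RtoC u) else 0)%C).
  assert (Hh : forall m n, curve_cont (h m n)).
  { intros m n. unfold h. destruct (fp_index_dec alpha beta m n); [|apply curve_cont_const].
    apply curve_cont_mult; [apply curve_cont_const|apply curve_cont_Cexp_scal]. }
  assert (HhD : curve_cont (fun u => double_sum (fp_bound beta) (fun m n => h m n u))) by (apply curve_cont_double_sum, Hh).
  (* The part of [singular_part] outside the finite-part range. *)
  set (k := fun m n p => (if fp_index_dec alpha beta m n then RtoC 0 else fp_coef z m n * power_primitive (fp_exponent alpha beta m n) p)%C).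
  apply (is_RInt_gen_zero _ (fun p => left_part alpha beta z p - double_sum (fp_bound beta) (fun m n => k m n p) - S0)%C).
  - intros a Ha1.
    assert (EI : Cint (fun u => integrand alpha beta z (u, 0%R) - double_sum (fp_bound beta) (fun m n => h m n u))%C (ln a) 0
       = (left_part alpha beta z (ln a) - double_sum (fp_bound beta) (fun m n => k m n (ln a)) - S0)%C).
    { rewrite Cint_minus; [|apply holomorphic_hor, holomorphic_integrand|exact HhD].
      rewrite (Cint_double_sum _ h) by exact Hh.
      unfold left_part, singular_part, S0.
      assert (Ed : double_sum (fp_bound beta) (fun m n => fp_coef z m n * power_primitive (fp_exponent alpha beta m n) (ln a))%C
        = (double_sum (fp_bound beta) (fun m n => k m n (ln a)) + (double_sum (fp_bound beta) f0 + (-1) * double_sum (fp_bound beta) (fun m n => Cint (h m n) (ln a) 0)))%C).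
      { rewrite <- double_sum_mult, <- !double_sum_plus. apply double_sum_ext. intros m n. unfold k, f0, h.
        destruct (fp_index_dec alpha beta m n).
        - rewrite Cint_mult by apply curve_cont_Cexp_scal. rewrite Cint_power. ring.
        - rewrite Cint_const. ring. }
      rewrite Ed. ring. }
    rewrite <- EI.
    eapply (is_RInt_ext (V := CV)); [|apply is_RInt_log_r; try lra].
    + intros t Ht. rewrite Rmin_left in Ht by lra. cbv beta.
      assert (Ht0 : 0 < t) by lra.
      assert (Et : (cpower t beta * (osc alpha z t - fp_sum alpha beta (fun m n => fp_coef z m n * Rpower t (INR n * alpha + INR m)%R)))%C
        = (cpower t beta * osc alpha z t - cpower t beta * fp_sum alpha beta (fun m n => fp_coef z m n * Rpower t (INR n * alpha + INR m)%R))%C) by ring.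
      rewrite Et, integrand_log by exact Ht0. rewrite fp_sum_double_sum, <- double_sum_mult.
      rewrite <- (Cmult_1_l (double_sum _ (fun m n => h m n (ln t)))).
      replace (RtoC (/ t) * (integrand alpha beta z (ln t, 0%R) - 1 * double_sum (fp_bound beta) (fun m n => h m n (ln t))))%C
       with (RtoC (/ t) * integrand alpha beta z (ln t, 0%R) - RtoC (/ t) * double_sum (fp_bound beta) (fun m n => h m n (ln t)))%C by ring.
      f_equal. rewrite <- double_sum_mult. apply double_sum_ext. intros m n. unfold h.
      destruct (fp_index_dec alpha beta m n); [|ring].
      replace (RtoC (/ t)) with (Cexp (- RtoC (ln t))).
      2:{ rewrite <- RtoC_opp, Cexp_RtoC, exp_Ropp, exp_ln by assumption. reflexivity. }
      unfold Rpower. rewrite <- Cexp_RtoC. unfold cpower.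
      transitivity (fp_coef z m n * (Cexp (- RtoC (ln t)) * Cexp (fp_exponent alpha beta m n * RtoC (ln t))))%C; [ring|].
      rewrite <- Cexp_plus.
      transitivity (fp_coef z m n * (Cexp (beta * RtoC (ln t)) * Cexp (RtoC ((INR n * alpha + INR m) * ln t))))%C; [|ring].
      rewrite <- Cexp_plus. do 2 f_equal. unfold fp_exponent. rewrite !RtoC_mult, !RtoC_plus, !RtoC_mult. ring.
    + apply curve_cont_minus; [apply holomorphic_hor, holomorphic_integrand|exact HhD].
  - intros eps He.
    assert (Hk : vanishes_at_m_infty (fun p => double_sum (fp_bound beta) (fun m n => k m n p))).
    { apply (double_sum_closed vanishes_at_m_infty); [apply vanishes_at_m_infty_plus|apply vanishes_at_m_infty_ext|].
      intros m n. unfold k. destruct (fp_index_dec alpha beta m n) as [i|i].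
      - intros e1 He1. exists 0. intros. rewrite Cmod_0. exact He1.
      - unfold fp_index in i. apply Rnot_le_lt in i.
        assert (Hs : 0 < Re (fp_exponent alpha beta m n)) by (rewrite Re_fp_exponent; lra).
        assert (Hs0 : fp_exponent alpha beta m n <> 0%C). { intros E. rewrite E in Hs. simpl in Hs. lra. }
        apply (vanishes_at_m_infty_exp_bound _ (Cmod (fp_coef z m n) / Cmod (fp_exponent alpha beta m n)) (Re (fp_exponent alpha beta m n))); trivial.
        + apply Rle_mult_inv_pos; [apply Cmod_ge_0|apply Cmod_gt_0, Hs0].
        + intros p _. rewrite Cmod_mult, power_primitive_le by exact Hs0. right. field. apply Rgt_not_eq, Cmod_gt_0, Hs0. }
    assert (HL : vanishes_at_m_infty (fun p => left_part alpha beta z p - L1)%C).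
    { apply (vanishes_at_m_infty_exp_bound _ T1 1); try lra. intros p Hp. rewrite Rmult_1_l. apply H1, Hp. }
    destruct (Hk (eps / 2)) as [p1 K1]; [lra|]. destruct (HL (eps / 2)) as [p2 K2]; [lra|].
    exists (Rmin p1 p2). intros p Hp. pose proof (Rmin_l p1 p2). pose proof (Rmin_r p1 p2).
    specialize (K1 p ltac:(lra)). specialize (K2 p ltac:(lra)).
    match goal with |- Cmod ?X < _ => replace X with ((left_part alpha beta z p - L1) + - double_sum (fp_bound beta) (fun m n => k m n p))%C by ring end.
    eapply Rle_lt_trans; [apply Cmod_triangle|]. rewrite Cmod_opp. lra. }
rewrite (is_RInt_gen_unique (V := CV) _ _ R1), (is_RInt_gen_unique (V := CV) _ _ R2).
rewrite fp_sum_double_sum.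
replace (double_sum (fp_bound beta) _) with S0.
- ring.
- unfold S0. apply double_sum_ext. intros m n. unfold f0, fp_exponent. cbv zeta.
  destruct (fp_index_dec alpha beta m n); [|reflexivity].
  unfold power_primitive. destruct (Ceq_dec _ 0) as [E|E]; [ring|].
  rewrite Cmult_0_r, Cexp_0. reflexivity.
Qed.

(** * Estimates of the contour integral *)

Lemma approx_decomp alpha beta z u1 U N : 1 < alpha ->
  approx alpha beta z N =
  (singular_part alpha beta z u1 + Cint (regular alpha beta z) (- INR N) u1
   + Cint (fun u => integrand alpha beta z (u, 0%R)) u1 U
   + Ci * Cint (fun phi => integrand alpha beta z (U, phi)) 0 (PI / (2 * alpha))
   + Cint (fun u => integrand alpha beta z (u, PI / (2 * alpha))%R) U (INR N))%C.
Proof.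
intros Ha. unfold approx. rewrite (contour_indep _ _ _ _ 0 U) by assumption. unfold contour.
rewrite <- (Cint_Chasles _ (- INR N) u1 U) by apply holomorphic_hor, holomorphic_integrand.
rewrite <- singular_shift. ring.
Qed.

(** The triangle inequality for [approx_decomp], in the limit [N -> oo]. *)
Lemma bound_by_parts alpha beta z u1 U B1 K2 B3 B4 K5 : 1 < alpha -> 0 <= K2 -> 0 <= K5 ->
  Cmod (singular_part alpha beta z u1) <= B1 ->
  (forall u, u <= u1 -> Cmod (regular alpha beta z u) <= K2 * exp (reg_order beta * u)) ->
  Cmod (Cint (fun u => integrand alpha beta z (u, 0%R)) u1 U) <= B3 ->
  (forall phi, 0 <= phi <= PI / (2 * alpha) -> Cmod (integrand alpha beta z (U, phi)) <= B4) ->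
  (forall u, U <= u -> Cmod (integrand alpha beta z (u, PI / (2 * alpha))) <= K5 * exp (-1 * u)) ->
  Cmod (Clim (approx alpha beta z)) <=
    B1 + K2 * exp (reg_order beta * u1) + B3 + PI / (2 * alpha) * B4 + K5 * exp (- U).
Proof.
intros Ha HK2 HK5 H1 H2 H3 H4 H5. destruct (theta_pos alpha Ha) as [Ht _].
destruct (approx_converges alpha beta (Rmax 1 (Cmod z)) Ha (Rmax_l _ _)) as [T [HT HA]].
apply le_epsilon. intros eps He.
destruct (exp_neg_INR_small T eps HT He) as [N0 HN0].
destruct (archimed (Rmax (- u1) U)) as [Harc _].
set (N := (N0 + Z.to_nat (up (Rmax (- u1) U)))%nat).
assert (HN : Rmax (- u1) U <= INR N).
{ unfold N. rewrite plus_INR. pose proof (pos_INR N0).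
  assert (Rmax (- u1) U <= INR (Z.to_nat (up (Rmax (- u1) U)))); [|lra].
  rewrite INR_IZR_INZ. destruct (Z_le_gt_dec 0 (up (Rmax (- u1) U))) as [Hz|Hz].
  - rewrite Z2Nat.id by exact Hz. lra.
  - assert (IZR (up (Rmax (- u1) U)) <= 0) by (apply IZR_le; lia).
    assert (0 <= IZR (Z.of_nat (Z.to_nat (up (Rmax (- u1) U))))) by (apply IZR_le; lia). lra. }
pose proof (Rmax_l (- u1) U). pose proof (Rmax_r (- u1) U).
specialize (HA z N (Rmax_r _ _)). specialize (HN0 N ltac:(unfold N; lia)).
replace (Clim (approx alpha beta z)) with (approx alpha beta z N + - (approx alpha beta z N - Clim (approx alpha beta z)))%C by ring.
eapply Rle_trans; [apply Cmod_triangle|]. rewrite Cmod_opp.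
assert (C2 : Cmod (Cint (regular alpha beta z) (- INR N) u1) <= K2 * exp (reg_order beta * u1)).
{ apply regular_tail_le; trivial. lra. }
assert (C4 : Cmod (Cint (fun phi => integrand alpha beta z (U, phi)) 0 (PI / (2 * alpha))) <= PI / (2 * alpha) * B4).
{ replace (PI / (2 * alpha) * B4) with ((PI / (2 * alpha) - 0) * B4) by ring.
  apply Cint_le_const; trivial; [apply holomorphic_ver, holomorphic_integrand|lra]. }
assert (C5 : Cmod (Cint (fun u => integrand alpha beta z (u, PI / (2 * alpha))) U (INR N)) <= K5 * exp (- U)).
{ apply ray_tail_le; trivial. lra. }
rewrite (approx_decomp alpha beta z u1 U N Ha) at 1.
match goal with |- Cmod (?a + ?b + ?c + ?d + ?e)%C + _ <= _ =>
  pose proof (Cmod_triangle (a + b + c + d) e); pose proof (Cmod_triangle (a + b + c) d);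
  pose proof (Cmod_triangle (a + b) c); pose proof (Cmod_triangle a b) end.
rewrite Cmod_mult, Cmod_Ci in *. lra.
Qed.

Lemma kappa_pos alpha : 1 < alpha -> 0 < kappa alpha.
Proof. intros. unfold kappa. apply Rdiv_lt_0_compat; lra. Qed.

Lemma ln_ge_1 X : 3 <= X -> 1 <= ln X.
Proof.
intros H. rewrite <- (ln_exp 1). pose proof exp_le_3.
destruct (Rle_lt_or_eq_dec (exp 1) X) as [L|L]; [lra| |].
- left. apply ln_increasing; [apply exp_pos|exact L].
- rewrite L. lra.
Qed.

(** The second bound is the definition of the region with [1 + X >= X] and
    [2 + X <= 2 X]; it implies the first one because [X^kappa >= kappa ln X]. *)
Lemma Omega_Im_le alpha c z : 1 < alpha -> 0 < c -> Omega alpha c z -> 3 <= Rabs (Re z) ->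
  Rabs (Im z) <= 2 * c / kappa alpha /\
  Rabs (Im z) * exp (kappa alpha * ln (Rabs (Re z))) <= c * (ln 2 + ln (Rabs (Re z))).
Proof.
intros Ha Hc HO HX. unfold Omega in HO. set (X := Rabs (Re z)) in *. set (y := Rabs (Im z)) in *.
pose proof (kappa_pos alpha Ha) as Hk. set (k := kappa alpha) in *.
pose proof (ln_ge_1 X HX) as Hl.
unfold Rpower in HO.
assert (E1 : exp (k * ln X) <= exp (k * ln (1 + X))).
{ apply exp_le. apply Rmult_le_compat_l; [lra|]. left; apply ln_increasing; lra. }
pose proof (exp_pos (k * ln X)) as P1.
assert (Hy : 0 <= y) by apply Rabs_pos.
assert (Hm : y * exp (k * ln X) <= c * ln (2 + X)).
{ apply Rle_trans with (y * exp (k * ln (1 + X))); [apply Rmult_le_compat_l; lra|].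
  apply Rmult_le_compat_r with (r := exp (k * ln (1 + X))) in HO; [|left; apply exp_pos].
  replace (c * (ln (2 + X) / exp (k * ln (1 + X))) * exp (k * ln (1 + X))) with (c * ln (2 + X)) in HO; trivial.
  field. apply Rgt_not_eq, exp_pos. }
assert (Hln : ln (2 + X) <= ln 2 + ln X).
{ rewrite <- ln_mult by lra. left; apply ln_increasing; lra. }
assert (Hln2 : ln 2 <= ln X) by (left; apply ln_increasing; lra).
assert (Hm2 : y * exp (k * ln X) <= c * (ln 2 + ln X)) by (apply Rle_trans with (1 := Hm); apply Rmult_le_compat_l; lra).
split; [|exact Hm2].
pose proof (exp_ineq1_le (k * ln X)) as P2.
apply Rmult_le_reg_r with (k * ln X); [nra|].
replace (2 * c / k * (k * ln X)) with (2 * c * ln X) by (field; lra).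
apply Rle_trans with (y * exp (k * ln X)); [apply Rmult_le_compat_l; lra|]. nra.
Qed.

Lemma Cmod_le_Re_Im z : Cmod z <= Rabs (Re z) + Rabs (Im z).
Proof.
replace z with (RtoC (Re z) + Ci * RtoC (Im z))%C at 1 by (unfold Re, Im; apply injective_projections; simpl; ring).
eapply Rle_trans; [apply Cmod_triangle|]. rewrite Cmod_mult, Cmod_Ci, !Cmod_R. lra.
Qed.

Lemma pow_exp X n : 0 < X -> X ^ n = exp (INR n * ln X).
Proof. intros H. rewrite <- Rpower_pow by assumption. reflexivity. Qed.

Lemma double_sum_bounded {T : Type} (S : T -> Prop) (g : T -> R) B (f : nat -> nat -> T -> C) :
  (forall t, S t -> 0 <= g t) ->
  (forall m n, exists K, forall t, S t -> Cmod (f m n t) <= K * g t) ->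
  exists K, forall t, S t -> Cmod (double_sum B (fun m n => f m n t)) <= K * g t.
Proof.
intros Hg. apply (double_sum_closed (fun h : T -> C => exists K, forall t, S t -> Cmod (h t) <= K * g t)).
- intros h1 h2 [K1 H1] [K2 H2]. exists (K1 + K2). intros t Ht.
  eapply Rle_trans; [apply Cmod_triangle|]. specialize (H1 t Ht). specialize (H2 t Ht). lra.
- intros h1 h2 E [K H]. exists K. intros t Ht. rewrite <- E. auto.
Qed.

Lemma Cmod_fp_coef_le z m n : Cmod (fp_coef z m n) <= Cmod z ^ m.
Proof.
unfold fp_coef. 
assert (Hn : forall k, 1 <= INR (fact k)).
{ intros k. apply (le_INR 1). pose proof (lt_O_fact k). lia. }
pose proof (Hn m) as Hm. specialize (Hn n).
rewrite <- RtoC_mult, Cmod_div.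
- rewrite Cmod_mult, !Cmod_pow, Cmod_mult, Cmod_opp, Cmod_Ci, Cmod_R, pow1, !Rmult_1_l.
  rewrite Rabs_right by nra. pose proof (pow_le (Cmod z) m (Cmod_ge_0 z)).
  apply Rmult_le_reg_r with (INR (fact n) * INR (fact m)); [nra|].
  unfold Rdiv. rewrite Rmult_assoc, Rinv_l by nra. assert (1 <= INR (fact n) * INR (fact m)) by nra. nra.
- intros E. apply RtoC_inj in E. nra.
Qed.

(** A term with exponent [s <> 0] is at most a constant times
    [X^m X^(- Re s) = X^(-1 - Re beta - n alpha)].  A term with [s = 0] is at most
    a constant times [X^m ln X] where [m = -1 - Re beta - n alpha]; for [n >= 1] the
    logarithm is absorbed by [X^(n alpha)], and for [n = 0] the number
    [-1 - beta] is natural.  The function [L] stands for [1] or [ln]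
    accordingly. *)
Lemma singular_part_le alpha beta (L : R -> R) : 1 < alpha ->
  (forall X, 3 <= X -> 1 <= L X) ->
  (is_natural (-1 - beta)%C -> forall X, 3 <= X -> ln X <= L X) ->
  exists K, forall z, 3 <= Rabs (Re z) /\ Cmod z <= 2 * Rabs (Re z) ->
    Cmod (singular_part alpha beta z (- ln (Rabs (Re z)))) <=
    K * (exp ((-1 - Re beta) * ln (Rabs (Re z))) * L (Rabs (Re z))).
Proof.
intros Ha HL1 HL2. unfold singular_part.
apply (double_sum_bounded (fun z : C => 3 <= Rabs (Re z) /\ Cmod z <= 2 * Rabs (Re z))
   (fun z => exp ((-1 - Re beta) * ln (Rabs (Re z))) * L (Rabs (Re z)))
   (fp_bound beta) (fun m n z => fp_coef z m n * power_primitive (fp_exponent alpha beta m n) (- ln (Rabs (Re z))))%C).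
{ intros z [Hz _]. specialize (HL1 _ Hz). apply Rmult_le_pos; [left; apply exp_pos|lra]. }
intros m n. set (s := fp_exponent alpha beta m n).
assert (Hcoef : forall z, 3 <= Rabs (Re z) -> Cmod z <= 2 * Rabs (Re z) ->
   Cmod (fp_coef z m n) <= 2 ^ m * exp (INR m * ln (Rabs (Re z)))).
{ intros z H3 Hz. eapply Rle_trans; [apply Cmod_fp_coef_le|].
  rewrite <- pow_exp by lra. rewrite <- Rpow_mult_distr. apply pow_incr. split; [apply Cmod_ge_0|exact Hz]. }
assert (H2m : 0 < 2 ^ m) by (apply pow_lt; lra).
pose proof (pos_INR n) as Pn.
pose proof (Re_fp_exponent alpha beta m n) as Hre. fold s in Hre.
destruct (Ceq_dec s 0) as [E|E].
- exists (2 ^ m). intros z [H3 Hz]. specialize (Hcoef z H3 Hz).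
  set (X := Rabs (Re z)) in *. pose proof (ln_ge_1 X H3) as Hl.
  unfold power_primitive. destruct (Ceq_dec s 0) as [_|E']; [|destruct (E' E)].
  rewrite Cmod_mult, Cmod_R, Rabs_Ropp, Rabs_right by lra.
  assert (Hr0 : Re s = 0) by (rewrite E; reflexivity). rewrite Hr0 in Hre.
  apply Rle_trans with (2 ^ m * exp (INR m * ln X) * ln X); [apply Rmult_le_compat_r; lra|].
  rewrite Rmult_assoc. apply Rmult_le_compat_l; [lra|].
  replace (-1 - Re beta) with (INR m + INR n * alpha) by lra.
  destruct n as [|n'].
  + simpl INR. replace (INR m + 0 * alpha) with (INR m) by ring.
    apply Rmult_le_compat_l; [left; apply exp_pos|]. apply HL2; trivial.
    exists m. unfold s, fp_exponent in E.
    transitivity (- (beta + (INR 0 * alpha)%R + INR m + 1) + RtoC (INR m) + RtoC (INR 0 * alpha))%C; [ring|].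
    rewrite E. simpl INR. rewrite Rmult_0_l. ring.
  + rewrite Rmult_plus_distr_r, exp_plus, Rmult_assoc. apply Rmult_le_compat_l; [left; apply exp_pos|].
    specialize (HL1 X H3).
    assert (ln X <= exp (INR (S n') * alpha * ln X)).
    { pose proof (exp_ineq1_le (INR (S n') * alpha * ln X)).
      assert (1 <= INR (S n')) by (rewrite S_INR; pose proof (pos_INR n'); lra).
      assert (1 <= INR (S n') * alpha) by nra. nra. }
    pose proof (exp_pos (INR (S n') * alpha * ln X)). nra.
- exists (2 ^ m / Cmod s). intros z [H3 Hz]. specialize (Hcoef z H3 Hz).
  set (X := Rabs (Re z)) in *. pose proof (ln_ge_1 X H3) as Hl.
  assert (Hs : 0 < Cmod s) by (apply Cmod_gt_0, E).
  rewrite Cmod_mult, power_primitive_le by exact E.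
  apply Rle_trans with (2 ^ m * exp (INR m * ln X) * (exp (Re s * - ln X) / Cmod s)).
  { apply Rmult_le_compat_r; trivial. apply Rle_mult_inv_pos; [left; apply exp_pos|exact Hs]. }
  replace (2 ^ m * exp (INR m * ln X) * (exp (Re s * - ln X) / Cmod s)) with
     (2 ^ m / Cmod s * (exp (INR m * ln X) * exp (Re s * - ln X))) by (field; lra).
  apply Rmult_le_compat_l. { apply Rle_mult_inv_pos; lra. }
  rewrite <- exp_plus. specialize (HL1 X H3).
  apply Rle_trans with (exp ((-1 - Re beta) * ln X) * 1).
  + rewrite Rmult_1_r. apply exp_le. rewrite Hre. 
    assert (0 <= INR n * alpha * ln X) by (repeat apply Rmult_le_pos; lra). lra.
  + apply Rmult_le_compat_l; [left; apply exp_pos|lra].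
Qed.

(** For [e^u <= 1 / X] the product [z e^u] is bounded, so the exponential
    factor in [regular_le] is harmless. *)
Lemma regular_scaled_le alpha beta z u : 1 < alpha -> 3 <= Rabs (Re z) -> Cmod z <= 2 * Rabs (Re z) ->
  u <= - ln (Rabs (Re z)) ->
  Cmod (regular alpha beta z u) <=
   3 * (2 * Rabs (Re z)) ^ S (fp_bound beta) * exp 3 * exp (reg_order beta * u).
Proof.
intros Ha H3 Hz Hu. set (X := Rabs (Re z)) in *. pose proof (ln_ge_1 X H3).
eapply Rle_trans; [apply (regular_le alpha beta z u (2 * X)); lra|].
apply Rmult_le_compat_r; [left; apply exp_pos|].
apply Rmult_le_compat_l. { pose proof (pow_le (2 * X) (S (fp_bound beta))). lra. }
apply exp_le.
assert (exp u <= / X).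
{ replace (/ X) with (exp (- ln X)); [apply exp_le, Hu|]. rewrite exp_Ropp, exp_ln by lra. reflexivity. }
apply Rle_trans with ((1 + 2 * X) * / X); [apply Rmult_le_compat_l; lra|].
apply Rmult_le_reg_r with X; [lra|]. rewrite Rmult_assoc, Rinv_l by lra. lra.
Qed.

Lemma regular_scaled_total beta X : 3 <= X ->
  3 * (2 * X) ^ S (fp_bound beta) * exp 3 * exp (reg_order beta * - ln X) =
  3 * 2 ^ S (fp_bound beta) * exp 3 * exp ((-1 - Re beta) * ln X).
Proof.
intros H. rewrite Rpow_mult_distr, (pow_exp X) by lra.
replace (exp ((-1 - Re beta) * ln X)) with (exp (INR (S (fp_bound beta)) * ln X) * exp (reg_order beta * - ln X)).
- ring.
- rewrite <- exp_plus. f_equal. unfold reg_order. ring.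
Qed.

Lemma Im_phase_le (b phi th : R) : 0 <= phi <= th -> - b * phi <= Rabs b * th.
Proof.
intros H. apply Rle_trans with (Rabs b * phi).
- apply Rmult_le_compat_r; [lra|]. rewrite <- Rabs_Ropp. apply Rle_abs.
- apply Rmult_le_compat_l; [apply Rabs_pos|lra].
Qed.

Lemma sin_alpha_ge alpha phi : 1 < alpha -> 0 <= phi <= PI / (2 * alpha) ->
  phi <= PI / (2 * alpha) * sin (alpha * phi).
Proof.
intros Ha Hp. pose proof PI_RGT_0.
assert (Ht : 0 < PI / (2 * alpha)) by (apply Rdiv_lt_0_compat; lra).
assert (H1 : 2 / PI * (alpha * phi) <= sin (alpha * phi)).
{ apply jordan_sin. split; [nra|]. apply Rle_trans with (alpha * (PI / (2 * alpha))); [nra|right; field; lra]. }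
apply Rle_trans with (PI / (2 * alpha) * (2 / PI * (alpha * phi))).
- right. field. lra.
- apply Rmult_le_compat_l; lra.
Qed.

Section Estimates.
Variables (alpha : R) (beta : C) (c : R).
Hypothesis Ha : 1 < alpha.
Hypothesis Hc : 0 < c.
Variable L : R -> R.
Hypothesis HL1 : forall X, 3 <= X -> 1 <= L X.
Hypothesis HL2 : is_natural (-1 - beta)%C -> forall X, 3 <= X -> ln X <= L X.

Let th := PI / (2 * alpha).
Let b := Re beta.
Let D := 2 * c / kappa alpha.
Let Fl (z : C) := Clim (approx alpha beta z).
Let G1 (X : R) := exp ((-1 - b) * ln X) * L X.

Lemma G1_ge X : 3 <= X -> exp ((-1 - b) * ln X) <= G1 X.
Proof.
intros H. unfold G1. specialize (HL1 X H). pose proof (exp_pos ((-1 - b) * ln X)). nra.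
Qed.

(** The contour leaves the real line at [u1 = - ln X].  As [Re z < 0], the
    exponent on the line at height [theta] is, up to an additive constant, at most
    [(b + 1) u - (sin theta / 2) X e^u], because [|y|] is bounded and so at most
    [X sin theta / 2]. *)
Lemma negative_side : exists K X0, 0 <= K /\ 3 <= X0 /\ forall z, Omega alpha c z -> Re z < 0 ->
  X0 <= Rabs (Re z) -> Cmod (Fl z) <= K * G1 (Rabs (Re z)).
Proof.
destruct (theta_pos alpha Ha) as [Ht1 Ht2]. fold th in Ht1, Ht2. pose proof PI_RGT_0 as HP.
destruct (singular_part_le alpha beta L Ha HL1 HL2) as [K1 HK1].
assert (Hs : 0 < sin th) by (apply sin_gt_0; lra).
destruct (exp_linear_bound (b + 2) (sin th / 2)) as [M HM]; [lra|].
pose proof (kappa_pos alpha Ha) as Hk.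
assert (HD : 0 < D) by (unfold D; apply Rdiv_lt_0_compat; lra).
set (KT2 := 3 * 2 ^ S (fp_bound beta) * exp 3).
set (KT4 := exp (Rabs (Im beta) * th + 1)).
set (KT5 := exp (M + Rabs (Im beta) * th)).
assert (HT2 : 0 <= KT2). { unfold KT2. pose proof (pow_lt 2 (S (fp_bound beta))). pose proof (exp_pos 3). nra. }
assert (HT4 : 0 < KT4) by apply exp_pos. assert (HT5 : 0 < KT5) by apply exp_pos.
exists (Rabs K1 + KT2 + th * KT4 + KT5), (Rmax 3 (Rmax D (2 * D / sin th))).
split; [pose proof (Rabs_pos K1); nra|]. split; [apply Rmax_l|].
intros z HO Hneg HX. set (X := Rabs (Re z)) in *.
assert (H3 : 3 <= X) by (eapply Rle_trans; [apply Rmax_l|exact HX]).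
assert (HXD : D <= X) by (eapply Rle_trans; [|exact HX]; eapply Rle_trans; [apply Rmax_l|apply Rmax_r]).
assert (HXs : 2 * D / sin th <= X) by (eapply Rle_trans; [|exact HX]; eapply Rle_trans; [apply Rmax_r|apply Rmax_r]).
destruct (Omega_Im_le alpha c z Ha Hc HO H3) as [Hy _]. fold D in Hy.
assert (Hmod : Cmod z <= 2 * X) by (eapply Rle_trans; [apply Cmod_le_Re_Im|]; fold X; lra).
assert (Hx : Re z = - X) by (unfold X; rewrite Rabs_left; lra).
pose proof (ln_ge_1 X H3) as Hl. pose proof (G1_ge X H3) as HG.
set (u1 := - ln X).
assert (Hu1 : exp u1 = / X) by (unfold u1; rewrite exp_Ropp, exp_ln by lra; reflexivity).
assert (Hy' : - Rabs (Im z) <= Im z <= Rabs (Im z)) by (apply Rabs_le_between; lra).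
assert (Hys : Rabs (Im z) <= X * (sin th / 2)).
{ apply Rmult_le_compat_r with (r := sin th / 2) in HXs; [|lra].
  replace (2 * D / sin th * (sin th / 2)) with D in HXs by (field; lra). lra. }
assert (Hbase : exp ((b + 1) * u1) = exp ((-1 - b) * ln X)) by (f_equal; unfold u1; ring).
pose proof (exp_pos ((-1 - b) * ln X)) as HE.
assert (Hmain := bound_by_parts alpha beta z u1 u1 (K1 * G1 X) (3 * (2 * X) ^ S (fp_bound beta) * exp 3) 0
   (KT4 * exp ((-1 - b) * ln X)) (KT5 * exp ((b + 2) * u1)) Ha).
assert (Hfin : Cmod (Fl z) <= K1 * G1 X + KT2 * exp ((-1 - b) * ln X) + 0 + th * (KT4 * exp ((-1 - b) * ln X)) + KT5 * exp ((-1 - b) * ln X)).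
{ unfold Fl.
  replace (KT2 * exp ((-1 - b) * ln X)) with (3 * (2 * X) ^ S (fp_bound beta) * exp 3 * exp (reg_order beta * u1))
    by (apply regular_scaled_total, H3).
  replace (KT5 * exp ((-1 - b) * ln X)) with (KT5 * exp ((b + 2) * u1) * exp (- u1)).
  2:{ rewrite Rmult_assoc, <- exp_plus. do 2 f_equal. unfold u1; ring. }
  apply Hmain.
  - pose proof (pow_le (2 * X) (S (fp_bound beta))). pose proof (exp_pos 3). apply Rmult_le_pos; lra.
  - pose proof (exp_pos ((b + 2) * u1)). nra.
  - apply HK1. split; assumption.
  - intros u Hu. apply regular_scaled_le; assumption.
  - rewrite Cint_point, Cmod_0. lra.
  - intros phi Hphi. rewrite Cmod_integrand. unfold KT4. rewrite <- exp_plus. apply exp_le.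
    fold b. replace ((b + 1) * u1) with ((-1 - b) * ln X) by (unfold u1; ring).
    pose proof (Im_phase_le (Im beta) phi th Hphi) as I1. fold th in Hphi.
    assert (S1 : 0 <= sin (alpha * phi)).
    { pose proof (sin_alpha_ge alpha phi Ha Hphi) as S1. fold th in S1. nra. }
    assert (S2 : 0 <= sin phi) by (apply sin_ge_0; lra).
    pose proof (exp_pos (alpha * u1)).
    assert (0 <= exp (alpha * u1) * sin (alpha * phi)) by (apply Rmult_le_pos; lra).
    assert (exp u1 * (Re z * sin phi + Im z * cos phi) <= 1).
    { rewrite Hu1, Hx. apply Rmult_le_reg_l with X; [lra|]. rewrite <- Rmult_assoc, Rinv_r by lra.
      assert (0 <= X * sin phi) by (apply Rmult_le_pos; lra).
      assert (Im z * cos phi <= Rabs (Im z) * 1).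
      { eapply Rle_trans; [apply Rle_abs|]. rewrite Rabs_mult. apply Rmult_le_compat_l; [apply Rabs_pos|].
        apply Rabs_le. pose proof (COS_bound phi). lra. }
      lra. }
    lra.
  - intros u Hu. fold th. rewrite Cmod_integrand. unfold KT5. rewrite <- !exp_plus. apply exp_le. fold b.
    pose proof (Im_phase_le (Im beta) th th ltac:(lra)) as I1.
    replace (alpha * th) with (alpha * (PI / (2 * alpha))) by reflexivity. rewrite sin_alpha_theta by exact Ha.
    pose proof (exp_pos (alpha * u)).
    specialize (HM (u - u1) ltac:(lra)).
    assert (Ee : exp u = exp (u - u1) * / X) by (rewrite <- Hu1, <- exp_plus; f_equal; ring).
    assert (exp u * (Re z * sin th + Im z * cos th) <= - (sin th / 2 * exp (u - u1))).
    { rewrite Ee, Hx. pose proof (exp_pos (u - u1)).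
      assert (Im z * cos th <= Rabs (Im z) * 1).
      { eapply Rle_trans; [apply Rle_abs|]. rewrite Rabs_mult. apply Rmult_le_compat_l; [apply Rabs_pos|].
        apply Rabs_le. pose proof (COS_bound th). lra. }
      rewrite Rmult_assoc. replace (- (sin th / 2 * exp (u - u1))) with (exp (u - u1) * (- (sin th / 2))) by ring.
      apply Rmult_le_compat_l; [lra|].
      apply Rmult_le_reg_l with X; [lra|]. rewrite <- Rmult_assoc, Rinv_r by lra. lra. }
    replace ((b + 1) * u) with ((b + 2) * (u - u1) + (b + 2) * u1 - u) by ring. lra. }
assert (K1 * G1 X <= Rabs K1 * G1 X) by (apply Rmult_le_compat_r; [lra|apply Rle_abs]).
assert (KT2 * exp ((-1 - b) * ln X) <= KT2 * G1 X) by (apply Rmult_le_compat_l; lra).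
assert (th * KT4 * exp ((-1 - b) * ln X) <= th * KT4 * G1 X) by (apply Rmult_le_compat_l; nra).
assert (KT5 * exp ((-1 - b) * ln X) <= KT5 * G1 X) by (apply Rmult_le_compat_l; lra).
lra.
Qed.

Section PositiveSide.
Variable A : R.
Hypothesis HA : Rmax 1 (Rpower (PI / (2 * alpha)) (kappa alpha)) < A.

Let cut (X : R) := ln A + kappa alpha * ln X.

Lemma A_gt_1 : 1 < A.
Proof. eapply Rle_lt_trans; [apply Rmax_l|exact HA]. Qed.

Lemma kappa_inv : kappa alpha * (alpha - 1) = 1.
Proof. unfold kappa. field. lra. Qed.

Lemma lnA_pos : 0 < ln A.
Proof. rewrite <- ln_1. apply ln_increasing; [lra|apply A_gt_1]. Qed.

(** Raised to the power [alpha - 1 = 1 / kappa], the condition on [A] reads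
    [A^(alpha - 1) > max (1, PI / (2 alpha))]. *)
Lemma A_pow_gt : 1 < exp ((alpha - 1) * ln A) /\ th < exp ((alpha - 1) * ln A).
Proof.
pose proof lnA_pos. split.
- rewrite <- exp_0 at 1. apply exp_increasing. apply Rmult_lt_0_compat; lra.
- assert (Ht : 0 < th) by (unfold th; apply theta_pos, Ha).
  assert (HR : Rpower th (kappa alpha) < A) by (eapply Rle_lt_trans; [apply Rmax_r|exact HA]).
  apply ln_increasing in HR; [|apply exp_pos]. unfold Rpower in HR. rewrite ln_exp in HR.
  rewrite <- (exp_ln th) at 1 by exact Ht. apply exp_increasing.
  pose proof kappa_inv. 
  apply Rmult_lt_compat_l with (r := alpha - 1) in HR; [|lra].
  replace ((alpha - 1) * (kappa alpha * ln th)) with (kappa alpha * (alpha - 1) * ln th) in HR by ring.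
  rewrite H0, Rmult_1_l in HR. exact HR.
Qed.

Lemma cut_facts X : 3 <= X -> 0 < cut X /\ exp ((alpha - 1) * cut X) = exp ((alpha - 1) * ln A) * X.
Proof.
intros H. pose proof (ln_ge_1 X H). pose proof lnA_pos. pose proof (kappa_pos alpha Ha). split.
- unfold cut. assert (0 < kappa alpha * ln X) by nra. lra.
- unfold cut. rewrite Rmult_plus_distr_l, exp_plus. f_equal.
  replace ((alpha - 1) * (kappa alpha * ln X)) with (kappa alpha * (alpha - 1) * ln X) by ring.
  rewrite kappa_inv, Rmult_1_l. apply exp_ln. lra.
Qed.

(** For [t <= A X^kappa] the region gives [|y| t <= A c ln (2 X)], the source of
    the factor [X^(A c)]. *)
Lemma growth_le z u : Omega alpha c z -> 3 <= Rabs (Re z) -> u <= cut (Rabs (Re z)) ->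
  Rabs (Im z) * exp u <= A * c * ln 2 + A * c * ln (Rabs (Re z)).
Proof.
intros HO H3 Hu. destruct (Omega_Im_le alpha c z Ha Hc HO H3) as [_ Hy].
pose proof A_gt_1. pose proof (Rabs_pos (Im z)).
apply Rle_trans with (Rabs (Im z) * exp (cut (Rabs (Re z)))).
{ apply Rmult_le_compat_l; trivial. apply exp_le, Hu. }
unfold cut. rewrite exp_plus, exp_ln by lra.
replace (Rabs (Im z) * (A * exp (kappa alpha * ln (Rabs (Re z))))) with (A * (Rabs (Im z) * exp (kappa alpha * ln (Rabs (Re z))))) by ring.
replace (A * c * ln 2 + A * c * ln (Rabs (Re z))) with (A * (c * (ln 2 + ln (Rabs (Re z))))) by ring.
apply Rmult_le_compat_l; lra.
Qed.

Lemma real_axis_le z u : Omega alpha c z -> 3 <= Rabs (Re z) -> u <= cut (Rabs (Re z)) ->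
  Cmod (integrand alpha beta z (u, 0)) <=
    exp (A * c * ln 2) * exp (A * c * ln (Rabs (Re z))) * exp ((b + 1) * u).
Proof.
intros HO H3 Hu. pose proof (growth_le z u HO H3 Hu) as HG.
rewrite Cmod_integrand, <- !exp_plus. apply exp_le.
rewrite !Rmult_0_r, sin_0, cos_0. fold b. pose proof (exp_pos u).
assert (exp u * (Im z) <= Rabs (Im z) * exp u) by (rewrite Rmult_comm; apply Rmult_le_compat_r; [lra|apply Rle_abs]).
lra.
Qed.

Lemma real_axis_le_0 z u : Omega alpha c z -> 3 <= Rabs (Re z) -> u <= 0 ->
  Cmod (integrand alpha beta z (u, 0)) <= exp D * exp ((b + 1) * u).
Proof.
intros HO H3 Hu. destruct (Omega_Im_le alpha c z Ha Hc HO H3) as [Hy _]. fold D in Hy.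
rewrite Cmod_integrand, <- !exp_plus. apply exp_le.
rewrite !Rmult_0_r, sin_0, cos_0. fold b. pose proof (exp_pos u).
assert (exp u <= 1) by (apply exp_le_1, Hu).
pose proof (Rle_abs (Im z)). pose proof (Rabs_pos (Im z)).
assert (exp u * Im z <= 1 * D). { apply Rle_trans with (exp u * Rabs (Im z)); [apply Rmult_le_compat_l; lra|]. apply Rmult_le_compat; lra. }
lra.
Qed.

(** The contour leaves the real line at [t = A X^kappa], where
    [t^(alpha - 1) = a0 X] with [a0 = A^(alpha - 1)].  On the arc, [a0 > theta] and
    [theta sin (alpha phi) >= phi >= sin phi] show that the term with [e^(alpha U)]
    outweighs the one with [Re z].  On the line, [a0 > 1] leaves room for [|y|]:
    [X + |y| <= (1 - del) a0 X <= (1 - del) t^(alpha - 1)], so that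
    [e^(- del t)] remains. *)
Lemma positive_side : exists K X0, 0 <= K /\ 3 <= X0 /\ forall z, Omega alpha c z -> 0 < Re z ->
  X0 <= Rabs (Re z) -> Cmod (Fl z) <= K * G1 (Rabs (Re z))
   + Cmod (Cint (fun u => integrand alpha beta z (u, 0%R)) (- ln (Rabs (Re z))) (cut (Rabs (Re z))))
   + K * (exp (A * c * ln (Rabs (Re z))) * exp ((b + 1) * cut (Rabs (Re z)))) + K.
Proof.
destruct (theta_pos alpha Ha) as [Ht1 Ht2]. fold th in Ht1, Ht2. pose proof PI_RGT_0 as HP.
destruct (singular_part_le alpha beta L Ha HL1 HL2) as [K1 HK1].
destruct A_pow_gt as [Ha0 Ha1]. set (a0 := exp ((alpha - 1) * ln A)) in *.
set (del := (a0 - 1) / (2 * a0)).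
assert (Hdel : 0 < del) by (apply Rdiv_lt_0_compat; lra).
assert (Hdel2 : (1 - del) * a0 = (a0 + 1) / 2) by (unfold del; field; lra).
destruct (exp_linear_bound (b + 2) del Hdel) as [M HM].
pose proof (kappa_pos alpha Ha) as Hk.
assert (HD : 0 < D) by (unfold D; apply Rdiv_lt_0_compat; lra).
set (KT2 := 3 * 2 ^ S (fp_bound beta) * exp 3).
set (KT4 := exp (Rabs (Im beta) * th + A * c * ln 2)).
set (KT5 := exp (M + Rabs (Im beta) * th)).
assert (HT2 : 0 <= KT2). { unfold KT2. pose proof (pow_lt 2 (S (fp_bound beta))). pose proof (exp_pos 3). nra. }
assert (HT4 : 0 < KT4) by apply exp_pos. assert (HT5 : 0 < KT5) by apply exp_pos.
exists (Rabs K1 + KT2 + th * KT4 + KT5), (Rmax 3 (Rmax D (2 * D / (a0 - 1)))).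
pose proof (Rabs_pos K1) as HK1p.
assert (HtK : 0 < th * KT4) by nra.
split; [lra|]. split; [apply Rmax_l|].
intros z HO Hpos HX. set (X := Rabs (Re z)) in *.
assert (H3 : 3 <= X) by (eapply Rle_trans; [apply Rmax_l|exact HX]).
assert (HXD : D <= X) by (eapply Rle_trans; [|exact HX]; eapply Rle_trans; [apply Rmax_l|apply Rmax_r]).
assert (HXs : 2 * D / (a0 - 1) <= X) by (eapply Rle_trans; [|exact HX]; eapply Rle_trans; [apply Rmax_r|apply Rmax_r]).
destruct (Omega_Im_le alpha c z Ha Hc HO H3) as [Hy _]. fold D in Hy.
assert (Hmod : Cmod z <= 2 * X) by (eapply Rle_trans; [apply Cmod_le_Re_Im|]; fold X; lra).
assert (Hx : Re z = X) by (unfold X; rewrite Rabs_right; lra).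
pose proof (ln_ge_1 X H3) as Hl. pose proof (G1_ge X H3) as HG.
destruct (cut_facts X H3) as [HU0 HU1]. fold a0 in HU1.
set (u1 := - ln X). set (U := cut X) in *.
assert (Hys : X + Rabs (Im z) <= (1 - del) * (a0 * X)).
{ apply Rmult_le_compat_r with (r := (a0 - 1) / 2) in HXs; [|lra].
  replace (2 * D / (a0 - 1) * ((a0 - 1) / 2)) with D in HXs by (field; lra).
  rewrite <- Rmult_assoc, Hdel2. lra. }
pose proof (exp_pos ((-1 - b) * ln X)) as HE.
assert (Hcos : forall phi, Im z * cos phi <= Rabs (Im z)).
{ intros phi. eapply Rle_trans; [apply Rle_abs|]. rewrite Rabs_mult, <- (Rmult_1_r (Rabs (Im z))) at 1.
  rewrite Rmult_1_r. rewrite <- (Rmult_1_r (Rabs (Im z))) at 2.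
  apply Rmult_le_compat_l; [apply Rabs_pos|]. apply Rabs_le. pose proof (COS_bound phi). lra. }
assert (He : forall u, exp (alpha * u) = exp u * exp ((alpha - 1) * u)) by (intros; rewrite <- exp_plus; f_equal; ring).
set (B3 := Cmod (Cint (fun u => integrand alpha beta z (u, 0%R)) u1 U)).
set (Q := exp (A * c * ln X) * exp ((b + 1) * U)).
assert (HQ : 0 < Q) by (apply Rmult_lt_0_compat; apply exp_pos).
assert (Hfin : Cmod (Fl z) <= K1 * G1 X + KT2 * exp ((-1 - b) * ln X) + B3 + th * (KT4 * Q) + KT5 * exp (- U)).
{ unfold Fl.
  replace (KT2 * exp ((-1 - b) * ln X)) with (3 * (2 * X) ^ S (fp_bound beta) * exp 3 * exp (reg_order beta * u1))
    by (apply regular_scaled_total, H3).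
  apply bound_by_parts; trivial.
  - pose proof (pow_le (2 * X) (S (fp_bound beta))). pose proof (exp_pos 3). apply Rmult_le_pos; lra.
  - lra.
  - apply HK1. split; assumption.
  - intros u Hu. apply regular_scaled_le; assumption.
  - unfold B3; lra.
  - intros phi Hphi. fold th in Hphi. rewrite Cmod_integrand. unfold KT4, Q. rewrite <- !exp_plus. apply exp_le.
    fold b. pose proof (Im_phase_le (Im beta) phi th Hphi) as I1.
    pose proof (growth_le z U HO H3 (Rle_refl _)) as Hgr. fold X in Hgr.
    pose proof (sin_alpha_ge alpha phi Ha Hphi) as S1. fold th in S1.
    assert (S0 : 0 <= sin (alpha * phi)) by nra.
    assert (S3 : sin phi <= phi).
    { destruct (Req_dec phi 0) as [->|]; [rewrite sin_0; lra|]. left. apply sin_lt_x. lra. }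
    pose proof (exp_pos U) as HpU.
    assert (S4 : exp U * (Re z * sin phi) <= exp (alpha * U) * sin (alpha * phi)).
    { rewrite He, HU1, Hx, Rmult_assoc. apply Rmult_le_compat_l; [lra|].
      replace (a0 * X * sin (alpha * phi)) with (X * (a0 * sin (alpha * phi))) by ring.
      apply Rmult_le_compat_l; [lra|].
      apply Rle_trans with (th * sin (alpha * phi)); [lra|]. apply Rmult_le_compat_r; lra. }
    assert (S5 : exp U * (Im z * cos phi) <= Rabs (Im z) * exp U).
    { rewrite (Rmult_comm (Rabs (Im z))). apply Rmult_le_compat_l; [lra|apply Hcos]. }
    lra.
  - intros u Hu. fold th. rewrite Cmod_integrand. unfold KT5. rewrite <- !exp_plus. apply exp_le. fold b.
    pose proof (Im_phase_le (Im beta) th th ltac:(lra)) as I1.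
    replace (alpha * th) with (alpha * (PI / (2 * alpha))) by reflexivity. rewrite sin_alpha_theta by exact Ha.
    specialize (HM u ltac:(lra)). pose proof (exp_pos u) as Hpu.
    assert (E1 : a0 * X <= exp ((alpha - 1) * u)). { rewrite <- HU1. apply exp_le. nra. }
    assert (E2 : Re z * sin th + Im z * cos th <= (1 - del) * exp ((alpha - 1) * u)).
    { assert (Re z * sin th <= X). { rewrite Hx. pose proof (SIN_bound th). nra. }
      pose proof (Hcos th).
      assert (0 <= 1 - del).
      { apply Rmult_le_reg_r with a0; lra. }
      apply Rle_trans with ((1 - del) * (a0 * X)); [lra|]. apply Rmult_le_compat_l; lra. }
    assert (E3 : 1 <= exp ((alpha - 1) * u)). { apply exp_ge_1. nra. }
    assert (E4 : exp u * (Re z * sin th + Im z * cos th) <= exp u * ((1 - del) * exp ((alpha - 1) * u))) by (apply Rmult_le_compat_l; lra).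
    rewrite He.
    assert (E5 : del * exp u <= del * exp u * exp ((alpha - 1) * u)) by (assert (0 < del * exp u) by nra; nra).
    lra. }
assert (N1 : K1 * G1 X <= Rabs K1 * G1 X) by (apply Rmult_le_compat_r; [lra|apply Rle_abs]).
assert (N2 : KT2 * exp ((-1 - b) * ln X) <= KT2 * G1 X) by (apply Rmult_le_compat_l; lra).
assert (N3 : exp (- U) <= 1) by (apply exp_le_1; lra).
assert (N5 : KT5 * exp (- U) <= KT5) by nra.
assert (0 <= (th * KT4 + KT5) * G1 X) by (apply Rmult_le_pos; lra).
assert (0 <= (Rabs K1 + KT2 + KT5) * Q) by (apply Rmult_le_pos; lra).
lra.
Qed.

(** Once the target [g] dominates [1], [X^(-1 - Re beta) L X] and the size
    [X^(A c) T^(Re beta + 1)] of the arc at [T = A X^kappa], only the real segment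
    is left to estimate. *)
Lemma dominated_both_sides (F : C -> C) (g : R -> R) K0 X0 : 0 <= K0 -> 
  (forall z, F z = Fl z) ->
  (forall X, 3 <= X -> X0 <= X -> 1 <= g X /\ G1 X <= K0 * g X /\ exp (A * c * ln X) * exp ((b + 1) * cut X) <= K0 * g X) ->
  (forall z, Omega alpha c z -> 3 <= Rabs (Re z) -> X0 <= Rabs (Re z) ->
     Cmod (Cint (fun u => integrand alpha beta z (u, 0%R)) (- ln (Rabs (Re z))) (cut (Rabs (Re z)))) <= K0 * g (Rabs (Re z))) ->
  dominated (Omega alpha c) F g.
Proof.
intros HK0 HF Hg HT3.
destruct negative_side as [Kn [Xn [HKn [HXn Hn]]]].
destruct positive_side as [Kp [Xp [HKp [HXp Hp]]]].
exists (Kn * K0 + Kp * K0 + K0 + Kp * K0 + Kp), (Rmax X0 (Rmax Xn Xp)).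
intros z HO HX. rewrite HF. set (X := Rabs (Re z)) in *.
assert (X0 <= X) by (eapply Rle_trans; [apply Rmax_l|exact HX]).
assert (Xn <= X) by (eapply Rle_trans; [|exact HX]; eapply Rle_trans; [apply Rmax_l|apply Rmax_r]).
assert (Xp <= X) by (eapply Rle_trans; [|exact HX]; eapply Rle_trans; [apply Rmax_r|apply Rmax_r]).
assert (H3 : 3 <= X) by lra.
destruct (Hg X H3 ltac:(assumption)) as [G_1 [G_2 G_3]].
assert (P1 : 0 <= K0 * g X) by nra.
destruct (Rlt_le_dec (Re z) 0) as [S|S].
- specialize (Hn z HO S ltac:(assumption)). fold X in Hn.
  assert (Kn * G1 X <= Kn * (K0 * g X)) by (apply Rmult_le_compat_l; lra).
  assert (0 <= Kp * (K0 * g X)) by (apply Rmult_le_pos; lra).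
  assert (0 <= Kp * g X) by (apply Rmult_le_pos; lra). lra.
- assert (S' : 0 < Re z). { destruct S as [S|S]; trivial. unfold X in H3. rewrite <- S, Rabs_R0 in H3. lra. }
  specialize (Hp z HO S' ltac:(assumption)). fold X in Hp.
  specialize (HT3 z HO H3 ltac:(assumption)). fold X in HT3.
  assert (Kp * G1 X <= Kp * (K0 * g X)) by (apply Rmult_le_compat_l; lra).
  assert (Kp * (exp (A * c * ln X) * exp ((b + 1) * cut X)) <= Kp * (K0 * g X)) by (apply Rmult_le_compat_l; lra).
  assert (Kp * 1 <= Kp * g X) by (apply Rmult_le_compat_l; lra).
  assert (0 <= Kn * (K0 * g X)) by (apply Rmult_le_pos; lra). lra.
Qed.
End PositiveSide.
End Estimates.

(** * The growth bounds *)

Lemma is_F_eq_Clim alpha beta F : 1 < alpha -> is_F alpha beta F ->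
  forall z, F z = Clim (approx alpha beta z).
Proof.
intros Ha [HE HF]. apply eq_Clim_everywhere; trivial.
intros z Hz. rewrite HF by exact Hz. apply fp_integral_eq; assumption.
Qed.

Lemma floor_spec x : IZR (floor x) <= x < IZR (floor x) + 1.
Proof. unfold floor. destruct (floor_ex x) as [n Hn]. exact Hn. Qed.

Lemma is_natural_floor beta : is_natural (-1 - beta)%C -> IZR (floor (-1 - Re beta)) = -1 - Re beta.
Proof.
intros [n Hn]. assert (E : -1 - Re beta = INR n).
{ change (-1 - Re beta) with (Re (-1 - beta)%C). rewrite Hn. reflexivity. }
rewrite E. destruct (floor_spec (INR n)) as [H1 H2].
rewrite INR_IZR_INZ in *. rewrite <- plus_IZR in H2. apply le_IZR in H1. apply lt_IZR in H2.
f_equal. lia.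
Qed.

Lemma ln_le_self x : 0 < x -> ln x <= x.
Proof.
intros H. pose proof (exp_ineq1_le (ln x)) as E. rewrite exp_ln in E by exact H. lra.
Qed.

Section Growth.
Variables (alpha : R) (beta : C) (c : R) (F : C -> C).
Hypothesis Ha : 1 < alpha.
Hypothesis Hc : 0 < c.
Hypothesis HF : forall z, F z = Clim (approx alpha beta z).

Lemma dominated_left (L : R -> R) :
  (forall X, 3 <= X -> 1 <= L X) ->
  (is_natural (-1 - beta)%C -> forall X, 3 <= X -> ln X <= L X) ->
  dominated (fun z => Omega alpha c z /\ Re z < 0) F (fun x => Rpower x (-1 - Re beta) * L x).
Proof.
intros HL1 HL2. destruct (negative_side alpha beta c Ha Hc L HL1 HL2) as [K [X0 [HK [HX0 H]]]].
exists K, X0. intros z [HO Hz] HX. rewrite HF. apply H; assumption.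
Qed.

Variable A : R.
Hypothesis HA : Rmax 1 (Rpower (PI / (2 * alpha)) (kappa alpha)) < A.

(** With [L X = X^(floor (-1 - Re beta) + 1 - (-1 - Re beta))] the product
    [X^(-1 - Re beta) L X] is exactly the first term of the bound for
    [Re beta < -1].  This [L] serves both cases of [singular_part_le]: its
    exponent is positive, and equal to [1] if [-1 - beta] is natural. *)
Lemma floor_factor_ge_1 X : 3 <= X -> 1 <= exp ((IZR (floor (-1 - Re beta)) + 1 - (-1 - Re beta)) * ln X).
Proof.
intros H. pose proof (ln_ge_1 X H). destruct (floor_spec (-1 - Re beta)).
apply exp_ge_1. apply Rmult_le_pos; lra.
Qed.

Lemma floor_factor_ge_ln : is_natural (-1 - beta)%C -> forall X, 3 <= X ->
  ln X <= exp ((IZR (floor (-1 - Re beta)) + 1 - (-1 - Re beta)) * ln X).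
Proof.
intros Hn X H. rewrite (is_natural_floor beta Hn).
replace ((-1 - Re beta + 1 - (-1 - Re beta)) * ln X) with (ln X) by ring.
rewrite exp_ln by lra. apply ln_le_self. lra.
Qed.

(** On [X^(-1) <= t <= 1] the exponential is bounded and [t^(Re beta)] integrates to
    [O(X^(-1 - Re beta))]; on [t >= 1] the power [t^(Re beta)] is integrable. *)
Lemma dominated_Re_lt : Re beta < -1 ->
  dominated (Omega alpha c) F
    (fun x => Rpower x (IZR (floor (-1 - Re beta)) + 1) + Rpower x (A * c)).
Proof.
intros Hb. pose proof (A_gt_1 alpha A HA) as HA1. pose proof (lnA_pos alpha A HA) as HlA.
set (W := exp (A * c * ln 2)). set (D := 2 * c / kappa alpha).
assert (HW : 0 < W) by apply exp_pos. pose proof (exp_pos D) as HD.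
assert (HAc : 0 < A * c) by (apply Rmult_lt_0_compat; lra).
set (k := - (Re beta + 1)). assert (Hk : 0 < k) by (unfold k; lra).
set (K0 := 1 + exp D / k + W / k).
assert (HDk : 0 < exp D / k) by (apply Rdiv_lt_0_compat; lra).
assert (HWk : 0 < W / k) by (apply Rdiv_lt_0_compat; lra).
apply (dominated_both_sides alpha beta c Ha Hc _ floor_factor_ge_1 floor_factor_ge_ln A HA F _ K0 3); trivial.
- unfold K0; lra.
- intros X H3 _. pose proof (ln_ge_1 X H3) as Hl. unfold Rpower.
  destruct (cut_facts alpha Ha A HA X H3) as [HU _]. set (U := ln A + kappa alpha * ln X) in *.
  assert (E1 : exp ((-1 - Re beta) * ln X) * exp ((IZR (floor (-1 - Re beta)) + 1 - (-1 - Re beta)) * ln X)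
     = exp ((IZR (floor (-1 - Re beta)) + 1) * ln X)) by (rewrite <- exp_plus; f_equal; ring).
  rewrite E1. pose proof (exp_pos ((IZR (floor (-1 - Re beta)) + 1) * ln X)) as P1.
  assert (P2 : 1 <= exp (A * c * ln X)).
  { apply exp_ge_1. apply Rmult_le_pos; lra. }
  assert (P3 : exp ((Re beta + 1) * U) <= 1). { (apply exp_le_1 || apply exp_ge_1). nra. }
  split; [lra|]. unfold K0. split; [nra|].
  assert (exp (A * c * ln X) * exp ((Re beta + 1) * U) <= exp (A * c * ln X)) by nra. nra.
- intros z HO H3 _. set (X := Rabs (Re z)) in *. pose proof (ln_ge_1 X H3) as Hl. unfold Rpower.
  destruct (cut_facts alpha Ha A HA X H3) as [HU _].
  rewrite <- (Cint_Chasles _ (- ln X) 0) by apply holomorphic_hor, holomorphic_integrand.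
  eapply Rle_trans; [apply Cmod_triangle|].
  set (G := exp ((IZR (floor (-1 - Re beta)) + 1) * ln X)). set (P := exp (A * c * ln X)).
  assert (HG : exp ((Re beta + 1) * - ln X) <= G).
  { apply exp_le. destruct (floor_spec (-1 - Re beta)). nra. }
  assert (HP : 0 < P) by apply exp_pos. assert (HG0 : 0 < G) by apply exp_pos.
  assert (B1 : Cmod (Cint (fun u => integrand alpha beta z (u, 0)) (- ln X) 0) <= exp D / k * G).
  { eapply Rle_trans; [apply (Cint_le_exp _ (exp D) (Re beta + 1)); try lra|].
    - apply holomorphic_hor, holomorphic_integrand.
    - intros u Hu. apply (real_axis_le_0 alpha beta c Ha Hc z u HO H3). lra.
    - rewrite Rmult_0_r, exp_0. unfold Rdiv. rewrite Rmult_assoc. apply Rmult_le_compat_l; [lra|].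
      replace ((1 - exp ((Re beta + 1) * - ln X)) * / (Re beta + 1)) with (/ k * (exp ((Re beta + 1) * - ln X) - 1))
        by (unfold k; field; lra).
      apply Rmult_le_compat_l; [left; apply Rinv_0_lt_compat, Hk|lra]. }
  assert (B2 : Cmod (Cint (fun u => integrand alpha beta z (u, 0)) 0 (ln A + kappa alpha * ln X)) <= W / k * P).
  { eapply Rle_trans; [apply (Cint_le_exp _ (W * P) (Re beta + 1)); try lra|].
    - apply holomorphic_hor, holomorphic_integrand.
    - intros u Hu. apply (real_axis_le alpha beta c Ha Hc A HA z u HO H3). apply Hu.
    - rewrite Rmult_0_r, exp_0.
      replace ((exp ((Re beta + 1) * (ln A + kappa alpha * ln X)) - 1) / (Re beta + 1)) with (/ k * (1 - exp ((Re beta + 1) * (ln A + kappa alpha * ln X))))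
        by (unfold k; field; lra).
      replace (W / k * P) with (W * P * (/ k * 1)) by (field; lra).
      apply Rmult_le_compat_l; [nra|]. apply Rmult_le_compat_l; [left; apply Rinv_0_lt_compat, Hk|].
      pose proof (exp_pos ((Re beta + 1) * (ln A + kappa alpha * ln X))). lra. }
  unfold K0. nra.
Qed.

(** Here [t^(Re beta) dt = du], and the segment has length [O(ln X)]. *)
Lemma dominated_Re_eq : Re beta = -1 ->
  dominated (Omega alpha c) F (fun x => x + Rpower x (A * c) * ln x).
Proof.
intros Hb. pose proof (A_gt_1 alpha A HA) as HA1. pose proof (lnA_pos alpha A HA) as HlA.
pose proof (kappa_pos alpha Ha) as Hk.
set (W := exp (A * c * ln 2)). assert (HW : 0 < W) by apply exp_pos.
assert (HAc : 0 < A * c) by (apply Rmult_lt_0_compat; lra).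
set (K0 := 1 + W * (ln A + kappa alpha + 1)).
assert (HW2 : 0 < W * (ln A + kappa alpha + 1)) by (apply Rmult_lt_0_compat; lra).
apply (dominated_both_sides alpha beta c Ha Hc (fun X => X)) with (A := A) (K0 := K0) (X0 := 3); trivial.
- intros; lra.
- intros _ X H. apply ln_le_self. lra.
- unfold K0; lra.
- intros X H3 _. pose proof (ln_ge_1 X H3) as Hl. unfold Rpower. rewrite Hb.
  assert (P2 : 1 <= exp (A * c * ln X)).
  { apply exp_ge_1. apply Rmult_le_pos; lra. }
  replace ((-1 - -1) * ln X) with 0 by ring. replace (-1 + 1) with 0 by ring. rewrite Rmult_0_l, exp_0.
  assert (exp (A * c * ln X) * 1 <= exp (A * c * ln X) * ln X) by (apply Rmult_le_compat_l; lra).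
  unfold K0. split; [lra|]. split; nra.
- intros z HO H3 _. set (X := Rabs (Re z)) in *. pose proof (ln_ge_1 X H3) as Hl. unfold Rpower.
  destruct (cut_facts alpha Ha A HA X H3) as [HU _].
  set (P := exp (A * c * ln X)). assert (HP : 0 < P) by apply exp_pos.
  eapply Rle_trans; [apply (Cint_le_const _ (W * P)); try lra|].
  + apply holomorphic_hor, holomorphic_integrand.
  + intros u Hu. eapply Rle_trans; [apply (real_axis_le alpha beta c Ha Hc A HA z u HO H3), Hu|].
    rewrite Hb. replace (-1 + 1) with 0 by ring. rewrite Rmult_0_l, exp_0, Rmult_1_r. apply Rle_refl.
  + assert (HL : ln A + kappa alpha * ln X - - ln X <= (ln A + kappa alpha + 1) * ln X) by nra.
    assert (HWP : 0 < W * P) by nra.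
    apply Rle_trans with ((ln A + kappa alpha + 1) * ln X * (W * P)); [apply Rmult_le_compat_r; lra|].
    replace ((ln A + kappa alpha + 1) * ln X * (W * P)) with (W * (ln A + kappa alpha + 1) * (P * ln X)) by ring.
    assert (0 < P * ln X) by nra. unfold K0. nra.
Qed.

(** The integral of [t^(Re beta)] up to [A X^kappa] is a constant times
    [X^(kappa (Re beta + 1))]. *)
Lemma dominated_Re_gt : Re beta > -1 ->
  dominated (Omega alpha c) F (fun x => Rpower x (A * c + (Re beta + 1) / (alpha - 1))).
Proof.
intros Hb. pose proof (A_gt_1 alpha A HA) as HA1. pose proof (lnA_pos alpha A HA) as HlA.
pose proof (kappa_pos alpha Ha) as Hk.
set (W := exp (A * c * ln 2)). assert (HW : 0 < W) by apply exp_pos.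
assert (HAc : 0 < A * c) by (apply Rmult_lt_0_compat; lra).
set (V := exp ((Re beta + 1) * ln A)). assert (HV : 0 < V) by apply exp_pos.
set (K0 := 1 + V + V * W / (Re beta + 1)).
assert (HVW : 0 < V * W / (Re beta + 1)) by (apply Rdiv_lt_0_compat; [nra|lra]).
assert (Hg : forall X, exp (A * c * ln X) * exp ((Re beta + 1) * (ln A + kappa alpha * ln X)) =
   V * exp ((A * c + (Re beta + 1) / (alpha - 1)) * ln X)).
{ intros X. unfold V. rewrite <- !exp_plus. f_equal. unfold kappa. field. lra. }
apply (dominated_both_sides alpha beta c Ha Hc (fun _ => 1)) with (A := A) (K0 := K0) (X0 := 3); trivial.
- intros; lra.
- intros [n Hn]. exfalso. assert (E : -1 - Re beta = INR n).
  { change (-1 - Re beta) with (Re (-1 - beta)%C). rewrite Hn. reflexivity. }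
  pose proof (pos_INR n). lra.
- unfold K0; lra.
- intros X H3 _. pose proof (ln_ge_1 X H3) as Hl. unfold Rpower. rewrite Hg, Rmult_1_r.
  assert (P2 : 1 <= exp ((A * c + (Re beta + 1) / (alpha - 1)) * ln X)).
  { apply exp_ge_1. apply Rmult_le_pos; [|lra].
    assert (0 < (Re beta + 1) / (alpha - 1)) by (apply Rdiv_lt_0_compat; lra). lra. }
  assert (P3 : exp ((-1 - Re beta) * ln X) <= 1). { (apply exp_le_1 || apply exp_ge_1). nra. }
  unfold K0. split; [lra|]. split; nra.
- intros z HO H3 _. set (X := Rabs (Re z)) in *. pose proof (ln_ge_1 X H3) as Hl. unfold Rpower.
  destruct (cut_facts alpha Ha A HA X H3) as [HU _].
  set (P := exp (A * c * ln X)). assert (HP : 0 < P) by apply exp_pos.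
  eapply Rle_trans; [apply (Cint_le_exp _ (W * P) (Re beta + 1)); try lra|].
  + apply holomorphic_hor, holomorphic_integrand.
  + intros u Hu. apply (real_axis_le alpha beta c Ha Hc A HA z u HO H3), Hu.
  + specialize (Hg X). fold P in Hg.
    set (g := exp ((A * c + (Re beta + 1) / (alpha - 1)) * ln X)) in *. assert (Hg0 : 0 < g) by apply exp_pos.
    apply Rle_trans with (W * P * (exp ((Re beta + 1) * (ln A + kappa alpha * ln X)) / (Re beta + 1))).
    * apply Rmult_le_compat_l; [nra|]. apply Rmult_le_compat_r; [left; apply Rinv_0_lt_compat; lra|].
      pose proof (exp_pos ((Re beta + 1) * - ln X)). lra.
    * replace (W * P * (exp ((Re beta + 1) * (ln A + kappa alpha * ln X)) / (Re beta + 1))) with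
        (W * (P * exp ((Re beta + 1) * (ln A + kappa alpha * ln X))) / (Re beta + 1)) by (field; lra).
      rewrite Hg. replace (W * (V * g) / (Re beta + 1)) with (V * W / (Re beta + 1) * g) by (field; lra).
      unfold K0. nra.
Qed.
End Growth.

Theorem mainTheorem6 (alpha : R) (beta : C) (c : R) (F : C -> C)
  (Halpha : 1 < alpha) (Hc : 0 < c) (HF : is_F alpha beta F) :
  ((~ is_natural (-1 - beta)%C ->
      dominated (fun z => Omega alpha c z /\ Re z < 0) F
        (fun x => Rpower x (-1 - Re beta)))
   /\
   (is_natural (-1 - beta)%C ->
      dominated (fun z => Omega alpha c z /\ Re z < 0) F
        (fun x => Rpower x (-1 - Re beta) * ln x)))
  /\
  (forall A : R, Rmax 1 (Rpower (PI / (2 * alpha)) (kappa alpha)) < A ->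
    (Re beta < -1 ->
      dominated (Omega alpha c) F
        (fun x => Rpower x (IZR (floor (-1 - Re beta)) + 1) + Rpower x (A * c)))
    /\
    (Re beta = -1 ->
      dominated (Omega alpha c) F
        (fun x => x + Rpower x (A * c) * ln x))
    /\
    (Re beta > -1 ->
      dominated (Omega alpha c) F
        (fun x => Rpower x (A * c + (Re beta + 1) / (alpha - 1))))).
Proof.
pose proof (is_F_eq_Clim alpha beta F Halpha HF) as HE.
split; [split|intros A HA; split; [|split]].
- intros Hn.
  destruct (dominated_left alpha beta c F Halpha Hc HE (fun _ => 1)) as [K [X H]].
  + intros; lra.
  + intros Hn'. destruct (Hn Hn').
  + exists K, X. intros z Hz HX. specialize (H z Hz HX). rewrite Rmult_1_r in H. exact H.
- intros _. apply (dominated_left alpha beta c F Halpha Hc HE ln).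
  + exact ln_ge_1.
  + intros; lra.
- apply dominated_Re_lt; assumption.
- apply dominated_Re_eq; assumption.
- apply dominated_Re_gt; assumption.
Qed.
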